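(* Assume Hypotheses 1 and 3 (see context). Then, uniformly in $z\in\mathbb C_{v_0}$ with $v_0\ge n^{-1/13}$, $s_{n,m}(z)$ converges to $s(z)$ in $L^2$, i.e. $$\sup_{z\in\mathbb C_{n^{-1/13}}}\mathbb E\big[|s_{n,m}(z)-s(z)|^2\big]\longrightarrow0,$$ where $s(z)=-\frac{1}{1+c}\Big(z-\frac{\sqrt{(z^2-c+1)^2-4z^2}}{z}\Big)=\frac{s^1(z)+cs^2(z)}{1+c}$.
   Context: Standing setup. For each $n$, $X=(X_1,\dots,X_n)$ is a random vector in $\mathbb R^n$ with law $Z_n^{-1}e^{-V(x)}\,dx$ for some $C^2$ function $V=V_n:\mathbb R^n\to\mathbb R$. Hypothesis 1: $\mathbb E[X]=0$, $\mathbb E[XX^T]=I_n$, $\mathbb E[X_i^4]=\mu$ for all $i$; $\mathrm{Hess}(V)\ge C^{-1}I_n$ for a constant $C>0$ independent of $n$; and the law of $(X_{\sigma(1)},\dots,X_{\sigma(n)})$ equals that of $(X_1,\dots,X_n)$ for every permutation $\sigma$. Hypothesis 3: $m=m(n)$ with $m/n\to c\in[1,\infty)$ and $cn-m\to\sigma\in\mathbb R$. $Y_{n,m}$ is the $n\times m$ matrix whose columns are $m$ independent copies of $X/\sqrt n$, and $W_{n,m}=\begin{pmatrix}0&Y_{n,m}^T\\ Y_{n,m}&0\end{pmatrix}$, of size $n+m$. $s_{n,m}(z)=\frac{1}{n+m}\mathrm{Tr}(W_{n,m}-z)^{-1}$. $s^1(z)=-\frac{1}{2z}\big(z^2-c+1-\sqrt{(z^2-c+1)^2-4z^2}\big)$,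 $s^2(z)=-\frac{1}{2cz}\big(z^2+c-1-\sqrt{(z^2+c-1)^2-4cz^2}\big)$, with square-root branches chosen so that $s^1,s^2$ are analytic on $\mathbb C\setminus\mathbb R$ and are Stieltjes transforms (convention $\int (x-z)^{-1}H(dx)$) of probability measures. For $v_0>0$, $\mathbb C_{v_0}=\{z=u+iv: |v|\ge v_0,\ |z|<R\}$, $R$ a fixed large constant. *)

(* Defs.v *)
From HB Require Import structures.
From mathcomp Require Import all_boot all_order all_algebra perm.
From mathcomp Require Import all_classical all_reals all_analysis.
From mathcomp Require Import complex.

Set Implicit Arguments.
Unset Strict Implicit.
Unset Printing Implicit Defensive.

Import Order.TTheory GRing.Theory Num.Theory.
Import numFieldNormedType.Exports.
Local Open Scope classical_set_scope.
Local Open Scope ring_scope.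

Section Defs.
Variable R : realType.

(* Lebesgue integration on R^k, as the iterated Lebesgue integral
   \int dx_0 \int dx_1 ... \int dx_{k-1} f(x_0,...,x_{k-1}).             *)
Fixpoint iint (k : nat) (f : (nat -> R) -> \bar R) : \bar R :=
  match k with
  | 0 => f (fun _ => 0)
  | k'.+1 => (\int[@lebesgue_measure R]_x
                iint k' (fun v => f (fun i => if i is j.+1 then v j else x)))%E
  end.

Definition intRn (n : nat) (f : 'rV[R]_n -> \bar R) : \bar R :=
  iint n (fun v => f (\row_(i < n) v i)).

Definition intMx (n m : nat) (f : 'M[R]_(n, m) -> \bar R) : \bar R :=
  iint (m * n) (fun v => f (\matrix_(i < n, j < m) v (j * n + i)%N)).

Definition normconst (n : nat) (V : 'rV[R]_n -> R) : \bar R :=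
  intRn (fun x => (expR (- V x))%:E).

Definition dens (n : nat) (V : 'rV[R]_n -> R) (x : 'rV[R]_n) : R :=
  expR (- V x) / fine (normconst V).

Definition Exp (n : nat) (V : 'rV[R]_n -> R) (f : 'rV[R]_n -> R) : \bar R :=
  intRn (fun x => (f x * dens V x)%:E).

(* R^n with its Borel (product) sigma-algebra, as n.-tuple R *)
Definition tup_of_row (n : nat) (x : 'rV[R]_n) : n.-tuple R :=
  [tuple x ord0 i | i < n].

Definition Prob (n : nat) (V : 'rV[R]_n -> R) (A : set (n.-tuple R)) : \bar R :=
  intRn (fun x => ((\1_A (tup_of_row x) : R) * dens V x)%:E).

Definition permrow (n : nat) (s : 'S_n) (x : 'rV[R]_n) : 'rV[R]_n :=
  \row_(i < n) x ord0 (s i).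

Definition permtup (n : nat) (s : 'S_n) (t : n.-tuple R) : n.-tuple R :=
  [tuple tnth t (s i) | i < n].

Definition evec (n : nat) (i : 'I_n) : 'rV[R]_n := delta_mx ord0 i.

Definition partial (n : nat) (i : 'I_n) (f : 'rV[R]_n -> R) : 'rV[R]_n -> R :=
  fun x => 'D_(evec i) f x.

Definition C2 (n : nat) (V : 'rV[R]_n -> R) : Prop :=
  [/\ (forall i x, derivable V x (evec i)),
      (forall i j x, derivable (partial j V) x (evec i)),
      (forall i, continuous (partial i V)) &
      (forall i j, continuous (partial i (partial j V)))].

Definition Hess (n : nat) (V : 'rV[R]_n -> R) (x : 'rV[R]_n) : 'M[R]_n :=
  \matrix_(i, j) partial i (partial j V) x.

Definition hess_lower_bound (n : nat) (V : 'rV[R]_n -> R) (C : R) : Prop :=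
  forall (x u : 'rV[R]_n),
    ((u *m (Hess V x - C^-1%:M) *m u^T) ord0 ord0) >= 0.

Definition Hyp1_n (mu C : R) (n : nat) (V : 'rV[R]_n -> R) : Prop :=
  C2 V /\
  (0 < normconst V < +oo)%E /\
  (forall i, Exp V (fun x => x ord0 i) = 0%E) /\
  (forall i j, Exp V (fun x => x ord0 i * x ord0 j) =
                 (if i == j then 1 else 0)%:E) /\
  (forall i, Exp V (fun x => x ord0 i ^+ 4) = mu%:E) /\
  hess_lower_bound V C /\
  (forall (s : 'S_n) (A : set (n.-tuple R)), measurable A ->
      Prob V [set t | A (permtup s t)] = Prob V A).

Local Open Scope complex_scope.

(* Y_{n,m} from the matrix Xs whose columns are the m copies of X *)
Definition Ymx (n m : nat) (Xs : 'M[R]_(n, m)) : 'M[R]_(n, m) :=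
  (Num.sqrt (n%:R))^-1 *: Xs.

Definition Wmx (n m : nat) (Y : 'M[R]_(n, m)) : 'M[R]_(m + n) :=
  block_mx 0 Y^T Y 0.

Definition snm (n m : nat) (Xs : 'M[R]_(n, m)) (z : R[i]) : R[i] :=
  ((n + m)%:R)^-1 *
  \tr (invmx (map_mx (fun r : R => r%:C) (Wmx (Ymx Xs)) - z%:M)).

(* s(z) = -(1+c)^{-1} (z - sqrt((z^2-c+1)^2 - 4 z^2)/z), with the branch
   of the square root chosen so that s maps the upper (lower) half plane
   into the upper (lower) half plane, as a Stieltjes transform of a
   probability measure does. *)
Definition s_lim (c : R) (z : R[i]) : R[i] :=
  let w := sqrtc ((z ^+ 2 - c%:C + 1) ^+ 2 - 4%:R * z ^+ 2) in
  let a := - (1 + c%:C)^-1 * (z - w / z) in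
  let b := - (1 + c%:C)^-1 * (z + w / z) in
  if 0 < complex.Im a * complex.Im z then a else b.

Definition Cset (v0 Rb : R) : set R[i] :=
  [set z | v0 <= `|complex.Im z| /\ Normc.normc z < Rb].

Definition L2err (n m : nat) (V : 'rV[R]_n -> R) (c : R) (z : R[i]) : \bar R :=
  intMx (fun Xs : 'M[R]_(n, m) =>
    ((Normc.normc (snm Xs z - s_lim c z)) ^+ 2 *
     \prod_(j < m) dens V (col j Xs)^T)%:E).

End Defs.

(* Main.v *)
(* Strong convexity of V and the Prekopa-Leindler inequality give Maurey's bound
   E e^h E e^(-h) <= e^(C L^2) for every L-Lipschitz h.  Applied to the square root
   of a positive quadratic form, it shows that x A x^T has variance O(n |A|^2).
   Let R be the resolvent of W_{n,m} at z, q_j the quadratic form of the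
   leave-one-out resolvent at the j-th column and g = Tr R_22 / n.  The Schur
   complement R_jj = -1/(z + q_j), the identity m + z Tr R_11 = n + z Tr R_22 and
   q_j ~ g yield z g^2 + (z^2 + 1 - c) g + z ~ 0.  The two roots have product 1;
   g lies in the half plane of z, while one root is at distance at least |Im z|
   from it, so that g is close to the other root, of which s is an affine image.
   With |Im z| >= n^(-1/13) the resulting squared error is O(n^(-7/13)). *)

Require Import Defs.
From HB Require Import structures.
From mathcomp Require Import all_boot all_order all_algebra perm.
From mathcomp Require Import all_classical all_reals all_analysis.
From mathcomp Require Import complex.
From mathcomp Require Import measurable_realfun.
From mathcomp Require Import ring lra.
Import Order.TTheory GRing.Theory Num.Theory.
Import numFieldNormedType.Exports.
Local Open Scope classical_set_scope.
Local Open Scope ring_scope.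

Set Implicit Arguments.
Unset Strict Implicit.
Unset Printing Implicit Defensive.

(** * Iterated integrals *)

(** Write eta for a lower bound on |Im z|. Negative powers of eta enter at three places: the bound
    |R_jj| <= 1/eta, the division by the distance to the wrong root, and the bound 1/eta on the
    leave-one-out resolvent, which lets the normalised quadratic form deviate by O(eta^-1 n^(-1/2))
    in mean square. Squared and combined over the columns this gives eta^-6 / n, which is eta^7 when
    eta = n^(-1/13). Since half planes alone select the root, spectral edges need no separate study,
    and near z = 0 the bound |z| >= |Im z| suffices. Expectations are iterated Lebesgue integrals
    rather than integrals against a product measure. Additivity and Tonelli are established for
    nonnegative measurable integrands, and signed expressions are rearranged until only nonnegative
    ones remain. Independence of the columns takes the form of Tonelli: column j is integrated
    first, while the resolvent with that column erased stays constant. A quadratic form is not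
    Lipschitz, but the square root of a positive one is; its deviations return those of the form
    once its size, E h^2 <= K n, is known. *)

Section SequenceSpace.
Variable R : realType.

Definition cylinders : set (set (nat -> R)) :=
  [set A | exists i, exists2 B : set R, measurable B & A = (fun v => v i) @^-1` B].

(** [iint] integrates functions of an infinite sequence whatever the number [k] of variables, the
    coordinates from [k] on being 0. One product sigma-algebra thus serves every dimension. *)
Definition seqR : measurableType _ := g_sigma_algebraType cylinders.

Lemma measurable_coord (i : nat) : measurable_fun [set: seqR] (fun v : seqR => v i).
Proof.
move=> _ B mB; rewrite setTI; apply: sub_sigma_algebra.
by exists i, B.
Qed.

Lemma measurable_seqR d (T : measurableType d) (f : T -> seqR) :
  (forall i, measurable_fun [set: T] (fun t => f t i)) -> measurable_fun [set: T] f.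
Proof.
move=> mf; apply: (@measurability _ _ _ seqR _ _ cylinders erefl) => _ [_ [i [B mB ->]] <-].
by rewrite setTI; have := mf i measurableT B mB; rewrite setTI.
Qed.

Definition consr (x : R) (v : seqR) : seqR := fun i => if i is j.+1 then v j else x.

Lemma measurable_consr d (T : measurableType d) (f : T -> R) (g : T -> seqR) :
  measurable_fun [set: T] f -> measurable_fun [set: T] g ->
  measurable_fun [set: T] (fun t => consr (f t) (g t)).
Proof.
move=> mf mg; apply: measurable_seqR => -[//|i] /=.
exact: (measurableT_comp (measurable_coord i) mg).
Qed.

Local Open Scope ereal_scope.
Local Notation mu := (@lebesgue_measure R).

Lemma iintS k (f : seqR -> \bar R) :
  iint k.+1 f = \int[mu]_x iint k (fun v => f (consr x v)).
Proof. by []. Qed.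

Lemma iint_ge0 k (f : seqR -> \bar R) : (forall v, 0 <= f v) -> 0 <= iint k f.
Proof.
elim: k f => [|k IH] f f0 //=; apply: integral_ge0 => x _.
by apply: IH => v; exact: f0.
Qed.

Lemma eq_iint k (f g : seqR -> \bar R) : f =1 g -> iint k f = iint k g.
Proof. by move=> /funext ->. Qed.

(** The parameter ranges over an arbitrary measurable space because the induction adds the outermost
    integration variable to it: the induction hypothesis is used at [T * R]. *)
Lemma measurable_iint k d (T : measurableType d) (f : T -> seqR -> \bar R) :
  measurable_fun [set: T * seqR] (fun p => f p.1 p.2) ->
  (forall t v, 0 <= f t v) ->
  measurable_fun [set: T] (fun t => iint k (f t)).
Proof.
elim: k d T f => [|k IH] d T f mf f0.
  apply: (measurableT_comp mf (_ : measurable_fun _ (fun t => (t, (fun=> 0%R) : seqR)))).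
  exact: measurable_fun_pair.
have mg : measurable_fun [set: T * measurableTypeR R]
    (fun p => iint k (fun v => f p.1 (consr p.2 v))).
  apply: (IH _ _ (fun p v => f p.1 (consr p.2 v))) => [|p v]; last exact: f0.
  apply: (measurableT_comp mf
    (_ : measurable_fun _ (fun q : (T * measurableTypeR R) * seqR =>
                             (q.1.1, consr q.1.2 q.2)))).
  apply: measurable_fun_pair => /=.
    exact: measurableT_comp measurable_fst measurable_fst.
  apply: measurable_consr; last exact: measurable_snd.
  exact: measurableT_comp measurable_snd measurable_fst.
apply: (measurable_fun_fubini_tonelli_F (m2 := mu) _ mg) => p.
by apply: iint_ge0 => v; exact: f0.
Qed.

Lemma measurable_consr2 (f : seqR -> \bar R) : measurable_fun setT f ->
  measurable_fun setT (fun p : R * seqR => f (consr p.1 p.2)).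
Proof.
move=> mf; apply: (measurableT_comp mf); apply: measurable_consr.
  exact: measurable_fst.
exact: measurable_snd.
Qed.

Lemma measurable_section (x : R) (f : seqR -> \bar R) : measurable_fun setT f ->
  measurable_fun setT (fun v => f (consr x v)).
Proof.
move=> mf; apply: (measurableT_comp mf).
exact: (@measurable_consr _ seqR (fun=> x) id).
Qed.

Lemma measurable_iint_consr k (f : seqR -> \bar R) : measurable_fun setT f ->
  (forall v, 0 <= f v) ->
  measurable_fun setT (fun x : R => iint k (fun v => f (consr x v))).
Proof.
move=> mf f0; apply: (@measurable_iint k _ R (fun x v => f (consr x v))) => [|x v].
  exact: measurable_consr2.
exact: f0.
Qed.

Lemma le_iint k (f g : seqR -> \bar R) :
  measurable_fun setT f -> measurable_fun setT g ->
  (forall v, 0 <= f v) -> (forall v, f v <= g v) -> iint k f <= iint k g.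
Proof.
elim: k f g => [|k IH] f g mf mg f0 fg; first exact: fg.
have g0 v : 0 <= g v by exact: le_trans (fg v).
rewrite !iintS; apply: ge0_le_integral => //.
- by move=> x _; apply: iint_ge0.
- exact: measurable_iint_consr.
- exact: measurable_iint_consr.
- by move=> x _; apply: IH => //; exact: measurable_section.
Qed.

Lemma iintD k (f g : seqR -> \bar R) :
  measurable_fun setT f -> measurable_fun setT g ->
  (forall v, 0 <= f v) -> (forall v, 0 <= g v) ->
  iint k (fun v => f v + g v) = iint k f + iint k g.
Proof.
elim: k f g => [//|k IH] f g mf mg f0 g0.
rewrite !iintS -ge0_integralD//.
- by apply: eq_integral => x _; apply: IH => //; exact: measurable_section.
- by move=> x _; apply: iint_ge0.
- exact: measurable_iint_consr.
- by move=> x _; apply: iint_ge0.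
- exact: measurable_iint_consr.
Qed.

Lemma iintZl k (a : \bar R) (f : seqR -> \bar R) :
  measurable_fun setT f -> (forall v, 0 <= f v) -> 0 <= a ->
  iint k (fun v => a * f v) = a * iint k f.
Proof.
elim: k f => [//|k IH] f mf f0 a0.
rewrite !iintS -ge0_integralZl//.
- by apply: eq_integral => x _; apply: IH => //; exact: measurable_section.
- exact: measurable_iint_consr.
- by move=> x _; apply: iint_ge0.
Qed.

Lemma iint_sum k (I : Type) (s : seq I) (f : I -> seqR -> \bar R) :
  (forall i, measurable_fun setT (f i)) -> (forall i v, 0 <= f i v) ->
  iint k (fun v => \sum_(i <- s) f i v) = \sum_(i <- s) iint k (f i).
Proof.
move=> mf f0; elim: s => [|i s IH].
  under eq_iint do rewrite big_nil.
  rewrite big_nil; elim: k => [//|k IHk]; rewrite iintS.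
  by apply: integral0_eq => x _; exact: IHk.
under eq_iint do rewrite big_cons.
rewrite big_cons iintD ?IH//; first exact: emeasurable_sum.
by move=> v; exact: sume_ge0.
Qed.

Lemma iint_int_swap k (f : R -> seqR -> \bar R) :
  measurable_fun setT (fun p : R * seqR => f p.1 p.2) ->
  (forall x v, 0 <= f x v) ->
  iint k (fun v => \int[mu]_x f x v) = \int[mu]_x iint k (f x).
Proof.
elim: k f => [//|k IH] f mf f0.
rewrite iintS.
have mF : measurable_fun [set: (R * R) * seqR]
    (fun q => f q.1.2 (consr q.1.1 q.2)).
  apply: (measurableT_comp mf
    (_ : measurable_fun _ (fun q : (R * R) * seqR => (q.1.2, consr q.1.1 q.2)))).
  apply: measurable_fun_pair => /=.
    exact: measurableT_comp measurable_snd measurable_fst.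
  apply: measurable_consr; last exact: measurable_snd.
  exact: measurableT_comp measurable_fst measurable_fst.
transitivity (\int[mu]_y \int[mu]_x iint k (fun v => f x (consr y v))).
  apply: eq_integral => y _; apply: (IH (fun x v => f x (consr y v))) => //.
  apply: (measurableT_comp mf
    (_ : measurable_fun _ (fun q : R * seqR => (q.1, consr y q.2)))).
  apply: measurable_fun_pair => /=; first exact: measurable_fst.
  by apply: measurable_consr => //; exact: measurable_snd.
rewrite (fubini_tonelli (m1 := mu) (m2 := mu)
  (fun p => iint k (fun v => f p.2 (consr p.1 v))))//.
- by apply: (@measurable_iint k _ _ (fun p v => f p.2 (consr p.1 v))).
- by move=> p; apply: iint_ge0.
Qed.

(** One variable of the first block at a time is moved past the whole second block by
    [iint_int_swap]. *)
Lemma iint_swap a b (f : seqR -> seqR -> \bar R) :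
  measurable_fun setT (fun p : seqR * seqR => f p.1 p.2) ->
  (forall u v, 0 <= f u v) ->
  iint a (fun u => iint b (f u)) = iint b (fun v => iint a (f ^~ v)).
Proof.
elim: a f => [//|a IH] f mf f0; rewrite iintS.
transitivity (\int[mu]_x iint b (fun v => iint a (fun u => f (consr x u) v))).
  apply: eq_integral => x _; apply: (IH (fun u v => f (consr x u) v)) => //.
  apply: (measurableT_comp mf
    (_ : measurable_fun _ (fun q : seqR * seqR => (consr x q.1, q.2)))).
  apply: measurable_fun_pair => /=; last exact: measurable_snd.
  by apply: measurable_consr => //; exact: measurable_fst.
rewrite -(@iint_int_swap b (fun x v => iint a (fun u => f (consr x u) v)))//.
- apply: (@measurable_iint a _ _
    (fun (p : R * seqR) u => f (consr p.1 u) p.2)) => //.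
  apply: (measurableT_comp mf (_ : measurable_fun _
     (fun q : (R * seqR) * seqR => (consr q.1.1 q.2, q.1.2)))).
  apply: measurable_fun_pair => /=.
    apply: measurable_consr; last exact: measurable_snd.
    exact: measurableT_comp measurable_fst measurable_fst.
  exact: measurableT_comp measurable_snd measurable_fst.
- by move=> x v; exact: iint_ge0.
Qed.

Definition catr (a : nat) (u v : seqR) : seqR :=
  fun i => if (i < a)%N then u i else v (i - a)%N.

(** Pure re-indexing of nested integrals, hence free of sign and measurability conditions. *)
Lemma iint_cat a b (f : seqR -> \bar R) :
  iint (a + b) f = iint a (fun u => iint b (fun v => f (catr a u v))).
Proof.
elim: a f => [|a IH] f.
  rewrite add0n /=; apply: eq_iint => v; congr (f _).
  by apply/funext => i; rewrite /catr ltn0 subn0.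
rewrite addSn !iintS; apply: eq_integral => x _; rewrite IH.
apply: eq_iint => u; apply: eq_iint => v; congr (f _).
by apply/funext => -[//|i]; rewrite /catr /= ltnS subSS.
Qed.

Lemma measurable_catr d (T : measurableType d) (a : nat) (f g : T -> seqR) :
  measurable_fun [set: T] f -> measurable_fun [set: T] g ->
  measurable_fun [set: T] (fun t => catr a (f t) (g t)).
Proof.
move=> mf mg; apply: measurable_seqR => i; rewrite /catr; case: (i < a)%N.
  exact: (measurableT_comp (measurable_coord i) mf).
exact: (measurableT_comp (measurable_coord _) mg).
Qed.

End SequenceSpace.

(** * The Prekopa-Leindler inequality *)

Section PrekopaLeindler.
Variable R : realType.
Local Open Scope ereal_scope.
Local Notation mu := (@lebesgue_measure R).

(** The right side defines a measure that agrees with Lebesgue measure on half-open intervals;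
    uniqueness extends this to all measurable sets. *)
Lemma lebesgue_measure_affine (a b : R) (A : set R) : (0 < a)%R -> measurable A ->
  mu A = a%:E * mu ((fun x => a * x + b)%R @^-1` A).
Proof.
move=> a0 mA.
pose f : measurableTypeR R -> measurableTypeR R := fun x : R => (a * x + b)%R.
have mf : measurable_fun [set: measurableTypeR R] f.
  by apply: measurable_funD => //; apply: measurable_funM.
have a0' : (0 <= a)%R by exact: ltW.
pose nu : {measure set (measurableTypeR R) -> \bar R} :=
  mscale (NngNum a0') (pushforward mu f).
apply: (@lebesgue_measure_unique R (nu mf) _ A mA) => _ [[c d] _ <-].
change (mu `]c, d]%classic = a%:E * mu (f @^-1` `]c, d]%classic)).
have -> : f @^-1` `]c, d] = `]((c - b) / a)%R, ((d - b) / a)%R]%classic.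
  apply/seteqP; split => x /=; rewrite !in_itv/= ltr_pdivrMr// ler_pdivlMr// /f;
    rewrite ltrBlDr lerBrDr (mulrC x); by [].
rewrite !lebesgue_measure_itv/= !lte_fin ltr_pM2r ?invr_gt0// ltrD2r.
case: ifP => _; last by rewrite mule0.
by rewrite -!EFinB -EFinM; congr EFin; field; rewrite gt_eqF.
Qed.

Lemma lebesgue_measure_shift (b : R) (A : set R) : measurable A ->
  mu ((fun x => x + b)%R @^-1` A) = mu A.
Proof.
move=> mA; rewrite (lebesgue_measure_affine b ltr01 mA) mul1e.
by congr (mu _); apply/seteqP; split => x /=; rewrite mul1r.
Qed.

Lemma lebesgue_measure_half (A : set R) : measurable A ->
  mu ((fun x => x / 2)%R @^-1` A) = 2%:E * mu A.
Proof.
move=> mA; rewrite [in RHS](@lebesgue_measure_affine 2^-1 0)// muleA -EFinM.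
rewrite divff// mul1e.
by congr (mu _); apply/seteqP; split => x /=; rewrite addr0 mulrC.
Qed.

Lemma measurable_preimage_affine (a b : R) (A : set R) : measurable A ->
  measurable ((fun x => a * x + b)%R @^-1` A).
Proof.
move=> mA; rewrite -[X in measurable X]setTI.
have mf : measurable_fun [set: measurableTypeR R] (fun x : R => a * x + b)%R.
  by apply: measurable_funD => //; apply: measurable_funM.
exact: mf.
Qed.

Lemma measurable_preimage_shift (b : R) (A : set R) : measurable A ->
  measurable ((fun x => x + b)%R @^-1` A).
Proof.
move=> mA; rewrite (_ : _ @^-1` A = (fun x => 1 * x + b)%R @^-1` A).
  exact: measurable_preimage_affine.
by apply/seteqP; split => x /=; rewrite mul1r.
Qed.

Lemma measurable_preimage_half (A : set R) : measurable A ->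
  measurable ((fun x => x / 2)%R @^-1` A).
Proof.
move=> mA; rewrite (_ : _ @^-1` A = (fun x => 2^-1 * x + 0)%R @^-1` A).
  exact: measurable_preimage_affine.
by apply/seteqP; split => x /=; rewrite addr0 mulrC.
Qed.

(* Translating A by an almost minimal point of B and B by an almost maximal
   point of A gives two almost disjoint subsets of A + B. *)
Lemma brunn_minkowski_bounded (A B T : set R) (M : R) :
  measurable A -> measurable B -> measurable T ->
  A !=set0 -> B !=set0 ->
  (forall x, A x -> x <= M)%R -> (forall x, B x -> - M <= x)%R ->
  (forall x y, A x -> B y -> T (x + y)%R) ->
  mu A + mu B <= mu T.
Proof.
move=> mA mB mT A0 B0 AM BM ABT.
apply/lee_addgt0Pr => e e0.
have e4 : (0 < e / 4)%R by rewrite divr_gt0.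
have supA : has_sup A by split => //; exists M.
have infB : has_inf B by split => //; exists (- M)%R.
have [a Aa ha] := sup_adherent e4 supA.
have [b Bb hb] := inf_adherent e4 infB.
have {ha} ha x : A x -> (x <= a + e / 4)%R.
  move=> Ax; have := sup_upper_bound supA Ax; lra.
have {hb} hb x : B x -> (b - e / 4 <= x)%R.
  move=> Bx; have := ge_inf infB.2 Bx; lra.
rewrite -(lebesgue_measure_shift (- b) mA) -(lebesgue_measure_shift (- a) mB).
set A1 := _ @^-1` A; set B1 := _ @^-1` B.
have mA1 : measurable A1 by exact: measurable_preimage_shift.
have mB1 : measurable B1 by exact: measurable_preimage_shift.
(* [A1] is [A + b], below [a + b + e / 4], and [B1] is [B + a], above [a + b - e / 4], so they
   overlap only inside [I]. *)
pose I := `[(a + b - e / 4)%R, (a + b + e / 4)%R]%classic : set R.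
have mI : measurable I by exact: measurable_itv.
have muI : mu I = (e / 2)%:E.
  rewrite /I lebesgue_measure_itv/= lte_fin ifT; last lra.
  by rewrite -EFinB; congr EFin; field.
have A1D : A1 `<=` (A1 `\` I) `|` I.
  by move=> x A1x; have [Ix|Ix] := pselect (I x); [right|left].
have h1 : mu A1 <= mu (A1 `\` I) + (e / 2)%:E.
  rewrite -muI; apply: (le_trans (le_measure mu _ _ A1D)).
  - by rewrite inE.
  - by rewrite inE; apply: measurableU => //; exact: measurableD.
  - by apply: measureU2 => //; exact: measurableD.
have h2 : mu (A1 `\` I) + mu B1 <= mu T.
  rewrite -measureU//; last 2 first.
  - exact: measurableD.
  - apply/seteqP; split => // x [[A1x nI] B1x]; apply: nI; rewrite /I/= in_itv/=.
    by have := ha _ A1x; have := hb _ B1x; lra.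
  apply: le_measure; rewrite ?inE//.
  - by apply: measurableU => //; exact: measurableD.
  - move=> x [[A1x _]|B1x].
      by have := ABT _ _ A1x Bb; rewrite subrK.
    by have := ABT _ _ Aa B1x; rewrite addrCA subrr addr0.
apply: (le_trans (leeD h1 (lexx (mu B1)))).
rewrite addeAC; apply: leeD => //.
by rewrite lee_fin; lra.
Qed.

(** The bounded case is applied to the parts of [A] below [n] and of [B] above [-n], which increase
    to [A] and [B]. [T] is a measurable superset of the sumset, which itself need not be
    measurable. *)
Lemma brunn_minkowski_add (A B T : set R) :
  measurable A -> measurable B -> measurable T ->
  A !=set0 -> B !=set0 ->
  (forall x y, A x -> B y -> T (x + y)%R) ->
  mu A + mu B <= mu T.
Proof.
move=> mA mB mT [a0 Aa0] [b0 Bb0] ABT.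
pose An (n : nat) := A `&` `]-oo, n%:R]%classic.
pose Bn (n : nat) := B `&` `[(- n%:R)%R, +oo[%classic.
have mAn n : measurable (An n) by exact: measurableI.
have mBn n : measurable (Bn n) by exact: measurableI.
have cA : mu \o An @ \oo --> mu A.
  rewrite [X in _ --> mu X](_ : A = \bigcup_n An n).
    apply: (@nondecreasing_cvg_mu _ _ _ mu An mAn (bigcupT_measurable _ mAn)).
    move=> m n mn; apply/subsetPset => x [Ax xm]; split => //.
    by move: xm; rewrite /= !in_itv/= => /le_trans; apply; rewrite ler_nat.
  apply/seteqP; split => [x Ax|x [n _ []]//].
  exists (Num.truncn `|x|).+1 => //; split => //=; rewrite in_itv/=.
  by rewrite (le_trans (ler_norm x))// ltW// truncnS_gt.
have cB : mu \o Bn @ \oo --> mu B.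
  rewrite [X in _ --> mu X](_ : B = \bigcup_n Bn n).
    apply: (@nondecreasing_cvg_mu _ _ _ mu Bn mBn (bigcupT_measurable _ mBn)).
    move=> m n mn; apply/subsetPset => x [Ax xm]; split => //.
    by move: xm; rewrite /= !in_itv/= !andbT; apply: le_trans; rewrite lerN2 ler_nat.
  apply/seteqP; split => [x Ax|x [n _ []]//].
  exists (Num.truncn `|x|).+1 => //; split => //=; rewrite in_itv/= andbT.
  by rewrite lerNl (le_trans (ler_norm _))// normrN ltW// truncnS_gt.
have cAB : (fun n => mu (An n) + mu (Bn n)) @ \oo --> mu A + mu B.
  by apply: cvgeD => //; apply: ge0_adde_def; rewrite inE.
apply: (cvge_to_le cAB); near=> n.
apply: (@brunn_minkowski_bounded _ _ _ n%:R) => //.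
- exists a0; split => //=; rewrite in_itv/=.
  by near: n; exact: nbhs_infty_ger.
- exists b0; split => //=; rewrite in_itv/= andbT lerNl.
  by near: n; exact: nbhs_infty_ger.
- by move=> x [_]; rewrite /= in_itv.
- by move=> x [_]; rewrite /= in_itv/= andbT.
- by move=> x y [Ax _] [By _]; exact: ABT.
Unshelve. all: by end_near.
Qed.

Lemma brunn_minkowski_midpoint (A B S : set R) :
  measurable A -> measurable B -> measurable S ->
  A !=set0 -> B !=set0 ->
  (forall x y, A x -> B y -> S ((x + y) / 2)%R) ->
  mu A + mu B <= 2%:E * mu S.
Proof.
move=> mA mB mS A0 B0 ABS; rewrite -lebesgue_measure_half//.
apply: brunn_minkowski_add => //; exact: measurable_preimage_half.
Qed.

End PrekopaLeindler.

(** * From sets to functions, and from one variable to several *)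

Section PrekopaLeindlerIntegral.
Variable R : realType.
Local Open Scope ereal_scope.
Local Notation mu := (@lebesgue_measure R).

Lemma measurable_superlevel (f : R -> \bar R) (t : \bar R) :
  measurable_fun setT f -> measurable [set x | t < f x].
Proof.
move=> mf; rewrite -[X in measurable X]setTI.
by apply: measurable_lte => //; exact: measurable_cst.
Qed.

Lemma measurable_EFin_snd :
  measurable_fun [set: R * R] (fun p => p.2%:E : \bar R).
Proof.
have : measurable_fun [set: R * R] (EFin \o snd).
  by apply/measurable_EFinP; exact: measurable_snd.
by [].
Qed.

(** Tonelli for the indicator of the region [0 <= t < f x] below the graph. The outer integral runs
    over all of [R], so negative levels get the value 0. *)
Lemma layer_cake (f : R -> \bar R) : measurable_fun setT f -> (forall x, 0 <= f x) ->
  \int[mu]_x f x =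
  \int[mu]_t (if (0 <= t)%R then mu [set x : R | (t : R)%:E < f x] else 0).
Proof.
move=> mf f0.
pose S := [set p : R * R | (0 <= p.2)%R /\ p.2%:E < f p.1].
have mS : measurable S.
  have -> : S = (setT `&` [set p : R * R | p.2%:E < f p.1]) `&`
                 (setT `&` (snd @^-1` `[0%R, +oo[%classic)).
    apply/seteqP; split => p; rewrite /S /= in_itv/= andbT; tauto.
  apply: measurableI.
    apply: measurable_lte => //.
      exact: measurable_EFin_snd.
    exact: (measurableT_comp mf measurable_fst).
  by apply: measurable_snd => //; exact: measurable_itv.
have mK : measurable_fun setT (fun p : R * R => (\1_S p : R)%:E).
  by apply/measurable_EFinP; exact: measurable_indic.
have K0 p : 0 <= (\1_S p : R)%:E by rewrite lee_fin.
transitivity (\int[mu]_x \int[mu]_t (\1_S (x, t) : R)%:E).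
  apply: eq_integral => x _.
  have -> : (fun t => (\1_S (x, t) : R)%:E) =
            (fun t => (\1_[set t : R | (0 <= t)%R /\ (t%:E < f x)%E] t)%:E).
    by apply/funext => t; rewrite !indicE; congr (((nat_of_bool _)%:R)%:E); apply/idP/idP; rewrite !inE.
  have := f0 x; case: (f x) => [r| |//] r0.
  - have -> : [set t : R | (0 <= t)%R /\ t%:E < r%:E] = `[0%R, r[%classic.
      by apply/seteqP; split => t; rewrite /= in_itv/= lte_fin => /andP.
    rewrite integral_indic//.
    rewrite setIT/= lebesgue_measure_itv/= lte_fin oppr0 adde0.
    case: ltP => // r0'; congr EFin; apply/eqP; rewrite eq_le r0' /=.
    by move: r0; rewrite lee_fin.
  - have -> : [set t : R | (0 <= t)%R /\ t%:E < +oo] = `[0%R, +oo[%classic.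
      apply/seteqP; split => t; rewrite /= in_itv/= ltry andbT //; by case.
    rewrite integral_indic//.
    by rewrite setIT/= lebesgue_measure_itv/= ltry.
rewrite (fubini_tonelli (m1 := mu) (m2 := mu) (fun p => (\1_S p : R)%:E))//.
apply: eq_integral => t _.
case: ifP => t0; last first.
  apply: integral0_eq => x _; rewrite indicE.
  by rewrite memNset//= => -[]; rewrite t0.
have -> : (fun x => (\1_S (x, t) : R)%:E) = (fun x => (\1_[set x : R | ((t : R)%:E < f x)%E] x)%:E).
  apply/funext => x; rewrite !indicE; congr (((nat_of_bool _)%:R)%:E).
  by apply/idP/idP; rewrite !inE/= ?t0//; case.
rewrite integral_indic//; last exact: measurable_superlevel.
by rewrite setIT.
Qed.

Lemma measurable_distribution (f : R -> \bar R) : measurable_fun setT f ->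
  measurable_fun setT (fun t : R => if (0 <= t)%R then mu [set x : R | (t : R)%:E < f x] else 0).
Proof.
move=> mf.
apply: measurable_fun_ifT => //.
  by apply: measurable_fun_ler => //; exact: measurable_cst.
pose S := [set p : R * R | p.2%:E < f p.1].
have mS : measurable S.
  rewrite -[S]setTI; apply: measurable_lte => //.
    exact: measurable_EFin_snd.
  exact: (measurableT_comp mf measurable_fst).
rewrite (_ : (fun t => _) = mu \o ysection S).
  exact: measurable_fun_ysection.
apply/funext => t /=; congr (mu _); apply/seteqP; split => x /=.
  by move=> h; rewrite /ysection/= inE.
by rewrite /ysection/= inE.
Qed.

(** Equal suprema make the superlevel sets of [F] and [G] nonempty at the same levels, as
    Brunn-Minkowski requires. It is applied at each level below 1, and the result is integrated over
    the levels. *)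
Lemma prekopa_leindler_sup1 (F G H : R -> \bar R) :
  measurable_fun setT F -> measurable_fun setT G -> measurable_fun setT H ->
  (forall x, 0 <= F x <= 1) -> (forall x, 0 <= G x <= 1) -> (forall x, 0 <= H x) ->
  (forall t : R, (0 <= t < 1)%R -> exists x, t%:E < F x) ->
  (forall t : R, (0 <= t < 1)%R -> exists x, t%:E < G x) ->
  (forall x y (t : R), (0 <= t)%R -> t%:E < F x -> t%:E < G y ->
     t%:E < H ((x + y) / 2)%R) ->
  \int[mu]_x F x + \int[mu]_x G x <= 2%:E * \int[mu]_x H x.
Proof.
move=> mF mG mH F01 G01 H0 F1 G1 FGH.
have F0 x : 0 <= F x by case/andP: (F01 x).
have G0 x : 0 <= G x by case/andP: (G01 x).
rewrite (layer_cake mF)// (layer_cake mG)// (layer_cake mH)//.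
have pos (f : R -> \bar R) t :
   0 <= (if (0 <= t)%R then mu [set x : R | (t : R)%:E < f x] else 0).
  by case: ifP.
rewrite -ge0_integralD//; do ?exact: measurable_distribution.
rewrite -ge0_integralZl//; last exact: measurable_distribution.
apply: ge0_le_integral => //.
- by move=> t _; exact: adde_ge0.
- by apply: emeasurable_funD; exact: measurable_distribution.
- by apply: measurable_funeM; exact: measurable_distribution.
- move=> t _; case: ifPn => [t0|_]; last by rewrite mule0 adde0.
  have [t1|t1] := ltP t 1%R.
    apply: brunn_minkowski_midpoint; try exact: measurable_superlevel.
    + by apply: F1; rewrite t0.
    + by apply: G1; rewrite t0.
    + by move=> x y /=; exact: FGH.
  (* From level 1 on, both sets on the left are empty. *)
  have E (f : R -> \bar R) : (forall x, 0 <= f x <= 1) -> [set x | t%:E < f x] = set0.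
    move=> f01; apply/seteqP; split => // x /=; case/andP: (f01 x) => _ fx1.
    by move=> /lt_le_trans /(_ fx1); rewrite lte_fin ltNge t1.
  have mu0 : mu set0 = 0 by exact: measure0.
  by rewrite (E F F01) (E G G01) mu0 adde0; exact: mule_ge0.
Qed.

Lemma mule_le_sqr_half (p q h : \bar R) : 0 <= p -> 0 <= q ->
  p + q <= 2%:E * h -> p * q <= h * h.
Proof.
case: p q h => [p| |] [q| |] [h| |] //=; rewrite ?mulyy ?leey//.
- rewrite -!EFinM -EFinD !lee_fin => p0 q0 pqh.
  have := sqr_ge0 (p - q)%R.
  have : ((p + q) ^+ 2 <= (2 * h) ^+ 2)%R.
    by rewrite ler_sqr// nnegrE; lra.
  rewrite !expr2; lra.
all: by rewrite mulrNy gtr0_sg// mul1e leeNy_eq.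
Qed.

(** Dividing [F] and [G] by their suprema [a] and [b], and [H] by the square root of [a * b],
    reduces to suprema 1. The additive inequality obtained there becomes multiplicative by the
    arithmetic-geometric mean inequality, and the factors [a * b] cancel. The bound [M] keeps the
    suprema finite. *)
Lemma prekopa_leindler_bounded (F G H : R -> \bar R) (M : R) :
  measurable_fun setT F -> measurable_fun setT G -> measurable_fun setT H ->
  (forall x, 0 <= F x <= M%:E) -> (forall x, 0 <= G x <= M%:E) -> (forall x, 0 <= H x) ->
  (forall x y, F x * G y <= H ((x + y) / 2)%R * H ((x + y) / 2)%R) ->
  (\int[mu]_x F x) * (\int[mu]_x G x) <= (\int[mu]_x H x) * (\int[mu]_x H x).
Proof.
move=> mF mG mH F0M G0M H0 FGH.
have intH0 : 0 <= \int[mu]_x H x by exact: integral_ge0.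
(* A zero supremum cannot be normalised, but then the integral is 0. *)
have sup_ex (f : R -> \bar R) : (forall x, 0 <= f x <= M%:E) ->
    (\int[mu]_x f x = 0) \/ exists2 a : R, (0 < a)%R &
    (forall x, f x <= a%:E) /\ (forall t : R, (t < a)%R -> exists x, t%:E < f x).
  move=> f0M; pose s := ereal_sup (range f).
  have fs x : f x <= s by apply: ereal_sup_ubound; exists x.
  have s0 : 0 <= s by apply: le_trans (fs 0%R); case/andP: (f0M 0%R).
  have sM : s <= M%:E by apply: ge_ereal_sup => _ [x _ <-]; case/andP: (f0M x).
  have sfin : s \is a fin_num by rewrite ge0_fin_numE// (le_lt_trans sM)// ltry.
  have sE : s = (fine s)%:E by rewrite fineK.
  have [s00|s0'] := leP s 0.
    left; apply: integral0_eq => x _; apply/eqP; rewrite eq_le.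
    by rewrite (le_trans (fs x) s00); case/andP: (f0M x).
  right; exists (fine s); first by rewrite -lte_fin -sE.
  split=> [x|t ts]; first by rewrite -sE.
  have : t%:E < s by rewrite sE lte_fin.
  by move=> /ereal_sup_gt[_ [x _ <-] tx]; exists x.
have [->|[a a0 [Fa Fsup]]] := sup_ex _ F0M; first by rewrite mul0e mule_ge0.
have [->|[b b0 [Gb Gsup]]] := sup_ex _ G0M; first by rewrite mule0 mule_ge0.
have ab0 : (0 < a * b)%R by exact: mulr_gt0.
pose r := Num.sqrt (a * b).
have r0 : (0 < r)%R by rewrite sqrtr_gt0.
have rr : (r * r = a * b)%R by rewrite -expr2 sqr_sqrtr// ltW.
have F0 x : 0 <= F x by case/andP: (F0M x).
have G0 x : 0 <= G x by case/andP: (G0M x).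
have ia0 : (0 <= a^-1)%R by rewrite invr_ge0 ltW.
have ib0 : (0 <= b^-1)%R by rewrite invr_ge0 ltW.
have ir0 : (0 <= r^-1)%R by rewrite invr_ge0 ltW.
have key : \int[mu]_x (a^-1%:E * F x) + \int[mu]_x (b^-1%:E * G x) <=
           2%:E * \int[mu]_x (r^-1%:E * H x).
  apply: prekopa_leindler_sup1; do ?exact: measurable_funeM.
  - move=> x; rewrite mule_ge0//= -(@mulVf _ a) ?gt_eqF// EFinM.
    by apply: lee_wpmul2l.
  - move=> x; rewrite mule_ge0//= -(@mulVf _ b) ?gt_eqF// EFinM.
    by apply: lee_wpmul2l.
  - by move=> x; rewrite mule_ge0.
  - move=> t /andP[t0 t1]; have [|x tx] := Fsup (t * a)%R; first by rewrite gtr_pMl.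
    by exists x; rewrite muleC lte_pdivlMr.
  - move=> t /andP[t0 t1]; have [|x tx] := Gsup (t * b)%R; first by rewrite gtr_pMl.
    by exists x; rewrite muleC lte_pdivlMr.
  - move=> x y t t0; rewrite muleC lte_pdivlMr// => tF.
    rewrite muleC lte_pdivlMr// => tG; rewrite muleC lte_pdivlMr//.
    have {FGH} := FGH x y; have := H0 ((x + y) / 2)%R.
    case: (H _) => [h| |//] h0; last by rewrite ltry.
    move: tF tG (F0 x) (G0 y) (Fa x) (Gb y).
    case: (F x) (G y) => [f| |//] [g| |//]; rewrite -?EFinM ?lee_fin ?lte_fin => //.
    move=> tf tg f0 g0 fa gb fgh.
    rewrite ltNge; apply/negP => htr.
    have h0' : (0 <= h)%R by rewrite -lee_fin.
    have hh : (h * h <= (t * r) * (t * r))%R by exact: ler_pM.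
    have fg : ((t * a) * (t * b) < f * g)%R by apply: ltr_pM => //; rewrite mulr_ge0// ltW.
    have := le_trans fgh hh.
    by rewrite mulrACA rr mulrACA leNgt fg.
rewrite !ge0_integralZl// in key; do ?exact: measurable_funTS.
have {}key := mule_le_sqr_half _ _ key.
have e0 (c : R) f : (0 <= c)%R -> (forall x, 0 <= f x) -> 0 <= c%:E * \int[mu]_x f x.
  by move=> c0 f0; rewrite mule_ge0// integral_ge0.
have {key} := key (e0 _ _ ia0 F0) (e0 _ _ ib0 G0).
rewrite muleACA [leRHS]muleACA -!EFinM -!invfM rr.
by rewrite lee_pmul2l// lte_fin invr_gt0.
Qed.

(** The product of the limits may have the form [0 * +oo], where multiplication is not continuous;
    its value 0 is covered by [0 <= K]. *)
Lemma mule_le_limit (x y : nat -> \bar R) (X Y K : \bar R) :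
  x @ \oo --> X -> y @ \oo --> Y -> 0 <= X -> 0 <= Y -> 0 <= K ->
  (forall n, x n * y n <= K) -> X * Y <= K.
Proof.
move=> cx cy X0 Y0 K0 xyK.
have [XY0|XY0] := eqVneq (X * Y) 0; first by rewrite XY0.
apply: (cvge_to_le (cvgeM (neq0_mule_def XY0) cx cy)).
by apply: nearW => n; exact: xyK.
Qed.

Lemma cvg_integral_truncation (f : R -> \bar R) :
  measurable_fun setT f -> (forall x, 0 <= f x) ->
  (fun n => \int[mu]_x mine (f x) n%:R%:E) @ \oo --> \int[mu]_x f x.
Proof.
move=> mf f0.
have cf x : (fun n => mine (f x) n%:R%:E) @ \oo --> f x.
  have := f0 x; case: (f x) => [r| |//] r0.
    apply: cvg_near_cst; near=> n; apply: min_l; rewrite lee_fin.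
    by near: n; exact: nbhs_infty_ger.
  rewrite (_ : (fun n => _) = fun n => n%:R%:E); first exact/cvgeryP/cvgr_idn.
  by apply/funext => n; apply: min_r; rewrite leey.
rewrite (_ : (fun x => f x) = fun x => limn (fun n => mine (f x) n%:R%:E)); last first.
  by apply/funext => x; apply/esym/cvg_lim.
apply: cvg_monotone_convergence => //.
- by move=> n; apply: measurable_mine => //; exact: measurable_cst.
- by move=> n x _; rewrite le_min f0 lee_fin ler0n.
- move=> x _ m n mn; rewrite le_min ge_min lexx/= ge_min lee_fin ler_nat mn orbT.
  by [].
Unshelve. all: by end_near.
Qed.

Lemma prekopa_leindler (F G H : R -> \bar R) :
  measurable_fun setT F -> measurable_fun setT G -> measurable_fun setT H ->
  (forall x, 0 <= F x) -> (forall x, 0 <= G x) -> (forall x, 0 <= H x) ->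
  (forall x y, F x * G y <= H ((x + y) / 2)%R * H ((x + y) / 2)%R) ->
  (\int[mu]_x F x) * (\int[mu]_x G x) <= (\int[mu]_x H x) * (\int[mu]_x H x).
Proof.
move=> mF mG mH F0 G0 H0 FGH.
apply: (mule_le_limit (cvg_integral_truncation mF F0) (cvg_integral_truncation mG G0)).
- exact: integral_ge0.
- exact: integral_ge0.
- by apply: mule_ge0; exact: integral_ge0.
move=> n; apply: (@prekopa_leindler_bounded _ _ _ n%:R) => //.
- by apply: measurable_mine => //; exact: measurable_cst.
- by apply: measurable_mine => //; exact: measurable_cst.
- by move=> x; rewrite le_min F0 lee_fin ler0n ge_min lexx orbT.
- by move=> x; rewrite le_min G0 lee_fin ler0n ge_min lexx orbT.
- move=> x y; apply: le_trans (FGH x y); apply: lee_pmul => //.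
  + by rewrite le_min F0 lee_fin ler0n.
  + by rewrite le_min G0 lee_fin ler0n.
  + by rewrite ge_min lexx.
  + by rewrite ge_min lexx.
Qed.

Definition midpoint (u v : seqR R) : seqR R := fun i => ((u i + v i) / 2)%R.

(** Tensorisation: for fixed first coordinates [x] and [y], the induction hypothesis on the sections
    is exactly the pointwise hypothesis of the one-dimensional inequality for the partial
    integrals. *)
Lemma prekopa_leindler_iint k (f g h : seqR R -> \bar R) :
  measurable_fun setT f -> measurable_fun setT g -> measurable_fun setT h ->
  (forall v, 0 <= f v) -> (forall v, 0 <= g v) -> (forall v, 0 <= h v) ->
  (forall u v, f u * g v <= h (midpoint u v) * h (midpoint u v)) ->
  iint k f * iint k g <= iint k h * iint k h.
Proof.
elim: k f g h => [|k IH] f g h mf mg mh f0 g0 h0 fgh.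
  have := fgh (fun=> 0%R) (fun=> 0%R).
  by rewrite (_ : midpoint _ _ = fun=> 0%R)//; apply/funext => i; rewrite /midpoint addr0 mul0r.
rewrite !iintS; apply: prekopa_leindler; do ?exact: measurable_iint_consr.
- by move=> x; exact: iint_ge0.
- by move=> x; exact: iint_ge0.
- by move=> x; exact: iint_ge0.
move=> x y; apply: IH => //; do ?exact: measurable_section.
move=> u v; have := fgh (consr x u) (consr y v).
rewrite (_ : midpoint (consr x u) _ = consr ((x + y) / 2)%R (midpoint u v))//.
by apply/funext => -[|i].
Qed.

End PrekopaLeindlerIntegral.

(** * Strong convexity along segments *)

Section StrongConvexity.
Variable R : realType.

Lemma row_continuousP n (f : 'rV[R]_n -> R) (y : 'rV[R]_n) :
  {for y, continuous f} ->
  forall e : R, 0 < e -> exists2 d : R, 0 < d &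
    forall q : 'rV[R]_n, (forall k, `|q ord0 k - y ord0 k| < d) -> `|f q - f y| < e.
Proof.
move=> /cvgrPdist_lt cf e e0.
have /nbhs_ballP[d /= d0 dP] := cf _ e0.
exists d => // q qy; rewrite distrC; apply: dP.
rewrite mx_norm_ball /ball_/= [X in X < _]mx_normrE.
apply/bigmax_ltP; split => // -[i k] _ /=.
by rewrite !mxE !ord1 distrC.
Qed.

Lemma is_derive_line n (f : 'rV[R]_n -> R) (y v : 'rV[R]_n) (t : R) :
  derivable f (y + t *: v) v ->
  is_derive t 1 (fun s => f (y + s *: v)) ('D_v f (y + t *: v)).
Proof.
move=> df.
have E : (fun h : R => h^-1 *: (((fun s => f (y + s *: v)) \o shift t) (h *: 1) -
            f (y + t *: v))) =
         (fun h : R => h^-1 *: ((f \o shift (y + t *: v)) (h *: v) - f (y + t *: v))).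
  apply/funext => h /=; congr (_ *: (f _ - _)).
  by rewrite (_ : h *: 1 = h) ?[_ *: _]mulr1// scalerDl addrCA.
by apply: DeriveDef; rewrite /derivable /derive E.
Qed.

Lemma mean_value_coord n (f : 'rV[R]_n -> R) (i : 'I_n) (y : 'rV[R]_n) (s : R) :
  (forall x, derivable f x (evec R i)) ->
  exists2 t : R, `|t| <= `|s| &
    f (y + s *: evec R i) - f y = s * partial i f (y + t *: evec R i).
Proof.
move=> df.
have dl (t : R) : is_derive t 1 (fun s => f (y + s *: evec R i)) (partial i f (y + t *: evec R i)).
  exact: is_derive_line.
have cl : continuous (fun s : R => f (y + s *: evec R i)).
  by move=> t; apply: differentiable_continuous; apply/derivable1_diffP; case: (dl t).
have [s0|s0] := leP 0 s.
  have [t] := MVT_segment s0 (fun t _ => dl t) (continuous_subspaceT cl).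
  rewrite in_itv/= => /andP[t0 ts]; rewrite scale0r addr0 subr0 => E.
  by exists t; rewrite ?ger0_norm// E mulrC.
have [t] := MVT_segment (ltW s0) (fun t _ => dl t) (continuous_subspaceT cl).
rewrite in_itv/= => /andP[t0 ts]; rewrite scale0r addr0 sub0r => E.
exists t; first by rewrite ler0_norm// ltr0_norm// lerN2.
by rewrite -opprB E mulrN opprK mulrC.
Qed.

(** The path from [y] to [y + u] changes one coordinate at a time, and each piece is a one-variable
    mean value theorem. The bound on [p i] makes the intermediate points tend to [y] with [u], which
    is what lets partial derivatives control the function. *)
Lemma mean_value_partials n (f : 'rV[R]_n -> R) (y u : 'rV[R]_n) :
  (forall i x, derivable f x (evec R i)) ->
  exists p : 'I_n -> 'rV[R]_n,
    (forall i k, `|p i ord0 k| <= `|u ord0 k|) /\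
    f (y + u) - f y = \sum_i u ord0 i * partial i f (y + p i).
Proof.
move=> df.
pose w (j : nat) : 'rV[R]_n := \row_k (if (k < j)%N then u ord0 k else 0).
have w0 : w 0%N = 0 by apply/rowP => k; rewrite !mxE.
have wn : w n = u by apply/rowP => k; rewrite !mxE ltn_ord.
have wS (i : 'I_n) : w i.+1 = w i + u ord0 i *: evec R i.
  apply/rowP => k; rewrite !mxE eqxx/= ltnS -(inj_eq val_inj)/=.
  case: ltngtP => ki /=.
  - by rewrite mulr0 addr0.
  - by rewrite mulr0 addr0.
  - by rewrite mulr1 add0r (ord_inj ki).
have H (i : 'I_n) : exists p : 'rV[R]_n, (forall k, `|p ord0 k| <= `|u ord0 k|) /\
    f (y + w i.+1) - f (y + w i) = u ord0 i * partial i f (y + p).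
  have [t tu E] := mean_value_coord (y + w i) (u ord0 i) (df i).
  exists (w i + t *: evec R i); split => [k|]; last first.
    by rewrite wS !addrA E.
  rewrite !mxE eqxx/= -(inj_eq val_inj)/=.
  case: ltngtP => ki /=.
  - by rewrite mulr0 addr0.
  - by rewrite mulr0 addr0 normr0.
  - by rewrite mulr1 add0r (ord_inj ki).
have {H} [p Hp] := choice H.
exists p; split => [i k|]; first by case: (Hp i).
rewrite -{1}wn -[in X in _ - X](addr0 y) -w0.
rewrite -(telescope_sumr (fun j => f (y + w j)))// big_mkord.
by apply: eq_bigr => i _; case: (Hp i).
Qed.

(** [C2] speaks of partial derivatives only; continuity of [V] itself is what makes the density
    measurable. *)
Lemma continuous_of_partials n (f : 'rV[R]_n -> R) :
  (forall i x, derivable f x (evec R i)) ->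
  (forall i, continuous (partial i f)) -> continuous f.
Proof.
move=> df cf y.
have [_ H0] := @cvgrPdist_lt _ _ _ (nbhs y) (nbhs_filter (y : 'rV[R]_n)) f (f y).
apply: H0 => e e0.
have H (i : 'I_n) : exists d : R, 0 < d /\
    forall q : 'rV[R]_n, (forall k, `|q ord0 k - y ord0 k| < d) ->
      `|partial i f q - partial i f y| < 1.
  by have [d d0 dP] := row_continuousP (cf i y) ltr01; exists d.
have [d Hd] := choice H.
(* Close to [y] each partial derivative is at most its modulus at [y] plus 1, so increments are at
   most [M] times the largest coordinate change. *)
pose M := \sum_i (`|partial i f y| + 1) + 1.
have M0 : 0 < M by rewrite ltr_wpDl// sumr_ge0// => i _; rewrite addr_ge0.
pose d0 := \big[Num.min/e / M]_i d i.
have d00 : 0 < d0.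
  by apply/bigmin_gtP; split=> [|i _]; [rewrite divr_gt0|case: (Hd i)].
apply/nbhs_ballP; exists d0 => //= q; rewrite mx_norm_ball /ball_/= => yq.
have {}yq k : `|q ord0 k - y ord0 k| < d0.
  apply: le_lt_trans yq; rewrite [leRHS]mx_normrE.
  by apply: le_trans (le_bigmax _ _ (ord0, k)); rewrite /= !mxE distrC.
have [p [pu E]] := mean_value_partials y (q - y) df.
rewrite [y + _]addrC subrK in E.
rewrite distrC E (le_lt_trans (ler_norm_sum _ _ _))//.
apply: (@le_lt_trans _ _ (\sum_i d0 * (`|partial i f y| + 1))).
  apply: ler_sum => i _; rewrite normrM ler_pM//.
    by have := ltW (yq i); rewrite !mxE.
  rewrite -lerBlDl (le_trans (lerB_dist _ _))//.
  apply: ltW; apply: (Hd i).2 => k.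
  rewrite !mxE addrAC subrr add0r (le_lt_trans (pu i k))// !mxE.
  apply: lt_le_trans (yq k) _; exact: bigmin_le_cond.
rewrite -mulr_sumr; apply: (@lt_le_trans _ _ (d0 * M)).
  by rewrite ltr_pM2l// ltrDl.
by rewrite -ler_pdivlMr//; exact: bigmin_le_id.
Qed.

(** The chain rule along a segment: continuity of the partial derivatives lets the intermediate
    points of [mean_value_partials] be replaced by [y]. It serves once for [V] and once for its
    partial derivatives. *)
Lemma is_derive_segment n (f : 'rV[R]_n -> R) (x u : 'rV[R]_n) (t : R) :
  (forall i x, derivable f x (evec R i)) ->
  (forall i, continuous (partial i f)) ->
  is_derive t 1 (fun s => f (x + s *: u)) (\sum_i u ord0 i * partial i f (x + t *: u)).
Proof.
move=> df cf; set y := x + t *: u; set L := \sum_i _.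
suff cvL : (fun h : R => h^-1 *: ((f \o shift y) (h *: u) - f y)) @ 0^' --> L.
  suff [d1 d2] : is_derive y u f L.
    by rewrite -d2; exact: is_derive_line.
  by apply: DeriveDef; [apply/cvg_ex; exists L|exact: cvg_lim].
apply/cvgrPdist_le => e e0.
pose M := \sum_i `|u ord0 i| + 1.
have M0 : 0 < M by rewrite ltr_wpDl// sumr_ge0.
have eM : 0 < e / M by rewrite divr_gt0.
have H (i : 'I_n) : exists d : R, 0 < d /\
    forall q : 'rV[R]_n, (forall k, `|q ord0 k - y ord0 k| < d) ->
      `|partial i f q - partial i f y| < e / M.
  by have [d d0 dP] := row_continuousP (cf i y) eM; exists d.
have [d Hd] := choice H.
pose d0 := \big[Num.min/1]_i d i.
have d00 : 0 < d0 by apply/bigmin_gtP; split=> // i _; case: (Hd i).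
near=> h.
have h0 : h != 0 by near: h; exact: nbhs_dnbhs_neq.
have hd : `|h| < d0 / M.
  near: h; apply: dnbhs0_lt; exact: divr_gt0.
have [p [pu E]] := mean_value_partials y (h *: u) df.
rewrite /= [h *: u + y]addrC E scaler_sumr -sumrB.
rewrite (le_trans (ler_norm_sum _ _ _))//.
apply: (@le_trans _ _ (\sum_i `|u ord0 i| * (e / M))).
  apply: ler_sum => i _.
  rewrite mxE /GRing.scale/= !mulrA mulVf// mul1r -mulrBr normrM -mulrA ler_wpM2l//.
  rewrite distrC; apply: ltW; apply: (Hd i).2 => k.
  rewrite [X in X - _]mxE addrAC subrr add0r (le_lt_trans (pu i k))// mxE normrM.
  apply: (@lt_le_trans _ _ d0); last exact: bigmin_le_cond.
  apply: (@le_lt_trans _ _ (`|h| * M)); last by rewrite -ltr_pdivlMr.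
  rewrite ler_wpM2l// /M (bigD1 k)//= -addrA lerDl addr_ge0// sumr_ge0//.
rewrite -mulr_suml mulrA ler_pdivrMr// mulrC ler_pM2l//.
by rewrite lerDl.
Unshelve. all: by end_near.
Qed.

(** Subtracting [k / 2 * t ^+ 2] leaves a function with nonnegative second derivative. Its
    increments over [0, 1] and [-1, 0] are values of its derivative at points [a >= b], and a third
    mean value theorem compares these values. *)
Lemma midpoint_convex_line (phi dphi ddphi : R -> R) (k : R) :
  (forall t : R, is_derive t 1 phi (dphi t)) ->
  (forall t : R, is_derive t 1 dphi (ddphi t)) ->
  (forall t, k <= ddphi t) ->
  k <= phi 1 + phi (-1) - 2 * phi 0.
Proof.
move=> d1 d2 kdd.
have cont (g dg : R -> R) : (forall t : R, is_derive t 1 g (dg t)) -> continuous g.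
  by move=> dg' t; apply: differentiable_continuous; apply/derivable1_diffP; case: (dg' t).
pose psi : R -> R := phi - (k / 2) *: ((id : R -> R) ^+ 2).
have psiE t : psi t = phi t - (k / 2) * t ^+ 2 by [].
pose dpsi : R -> R := dphi - k *: (id : R -> R).
have dpsiE t : dpsi t = dphi t - k * t by [].
have dpsiP (t : R) : is_derive t 1 psi (dpsi t).
  apply: is_derive_eq.
  by rewrite dpsiE /GRing.scale/= expr1 mulr1; field.
have ddpsiP (t : R) : is_derive t 1 dpsi (ddphi t - k).
  by apply: is_derive_eq; rewrite /GRing.scale/= mulr1.
have le01 : (0 : R) <= 1 by [].
have leN10 : (-1 : R) <= 0 by rewrite lerN10.
have [a] := MVT_segment le01 (fun t _ => dpsiP t) (continuous_subspaceT (cont _ _ dpsiP)).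
rewrite in_itv/= => /andP[a0 _] E1.
have [b] := MVT_segment leN10 (fun t _ => dpsiP t) (continuous_subspaceT (cont _ _ dpsiP)).
rewrite in_itv/= => /andP[_ b0] E2.
have [c _ E3] := MVT_segment (le_trans b0 a0) (fun t _ => ddpsiP t)
  (continuous_subspaceT (cont _ _ ddpsiP)).
have : 0 <= (ddphi c - k) * (a - b) by rewrite mulr_ge0// subr_ge0// (le_trans b0).
rewrite -E3 => ab.
move: E1 E2; rewrite !psiE subr0 sub0r opprK !mulr1 expr0n/= mulr0 sqrrN expr1n => E1 E2.
lra.
Qed.

Definition sqnorm n (u : 'rV[R]_n) : R := \sum_i u ord0 i ^+ 2.

Lemma hess_lower_bound_sum n (V : 'rV[R]_n -> R) (C : R) (x u : 'rV[R]_n) :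
  hess_lower_bound V C ->
  C^-1 * sqnorm u <= \sum_i u ord0 i * \sum_j u ord0 j * partial j (partial i V) x.
Proof.
move=> /(_ x u); rewrite mulmxBr mulmxBl mxE [X in _ + X]mxE subr_ge0.
set a := (X in X <= _ -> _); set b := (X in _ <= X -> _).
have -> : a = C^-1 * sqnorm u.
  rewrite /a mul_mx_scalar -scalemxAl mxE; congr (_ * _).
  by rewrite mxE; apply: eq_bigr => i _; rewrite mxE expr2.
have -> : b = \sum_i u ord0 i * \sum_j u ord0 j * partial j (partial i V) x.
  rewrite /b mxE; apply: eq_bigr => i _; rewrite !mxE mulrC; congr (_ * _).
  by apply: eq_bigr => j _; rewrite !mxE.
by [].
Qed.

(** On the segment with centre [z] and ends [z + u = x], [z - u = y], the second derivative of [V]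
    is at least [C^-1 * sqnorm u], and [sqnorm u] is a quarter of [sqnorm (x - y)]. *)
Lemma strong_midpoint_convexity n (V : 'rV[R]_n -> R) (C : R) (x y : 'rV[R]_n) :
  C2 V -> hess_lower_bound V C ->
  2 * V (2^-1 *: (x + y)) + C^-1 / 4 * sqnorm (x - y) <= V x + V y.
Proof.
move=> [dV ddV cV ccV] HV.
pose z := 2^-1 *: (x + y); pose u := 2^-1 *: (x - y).
have D1 (t : R) := is_derive_segment z u t dV cV.
have D2 (t : R) : is_derive t 1 (fun t => \sum_i u ord0 i * partial i V (z + t *: u))
    (\sum_i u ord0 i * \sum_j u ord0 j * partial j (partial i V) (z + t *: u)).
  have D i : is_derive t 1 (fun t => u ord0 i * partial i V (z + t *: u))
      (u ord0 i * \sum_j u ord0 j * partial j (partial i V) (z + t *: u)).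
    apply: (@is_deriveZ _ _ _ _ (u ord0 i)).
    exact: (is_derive_segment _ _ _ (fun k x => ddV k i x) (fun k => ccV k i)).
  have := is_derive_sum (fun i => D i).
  rewrite (_ : (fun s : R => _) = \sum_i (fun s : R => u ord0 i * partial i V (z + s *: u)))//.
  by apply/funext => s; rewrite fct_sumE.
have := midpoint_convex_line D1 D2 (fun t => hess_lower_bound_sum (z + t *: u) u HV).
have -> : z + 1 *: u = x.
  by apply/rowP => i; rewrite /z /u !mxE; field.
have -> : z + -1 *: u = y.
  by apply/rowP => i; rewrite /z /u !mxE; field.
rewrite scale0r addr0.
have -> : sqnorm u = 4^-1 * sqnorm (x - y).
  by rewrite /sqnorm mulr_sumr; apply: eq_bigr => i _; rewrite /u !mxE; field.
rewrite -/z; lra.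
Qed.

End StrongConvexity.

(** * Measurability and signed integrals *)

Section MeasurabilityIntegrability.
Variable R : realType.

(* A continuous function of finitely many measurable variables is the limit of
   its values at the points rounded to the grid of mesh 1/(N+1), which take
   countably many values. *)
Lemma measurable_continuous_row d (T : measurableType d) n (f : 'rV[R]_n -> R)
    (X : 'I_n -> T -> R) :
  continuous f -> (forall i, measurable_fun [set: T] (X i)) ->
  measurable_fun [set: T] (fun t => f (\row_i X i t)).
Proof.
move=> cf mX.
pose fl (N : nat) (x : R) : int := Num.floor (N.+1%:R * x).
pose rd (N : nat) (c : 'rV[int]_n) : 'rV[R]_n := \row_i ((c ord0 i)%:~R / N.+1%:R).
apply: (@measurable_fun_cvg _ _ _ _ (fun N t => f (rd N (\row_i fl N (X i t))))).
  move=> N _ B mB; rewrite setTI.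
  pose E (c : 'rV[int]_n) : set T := if `[< B (f (rd N c)) >] then
     \bigcap_(i in [set: 'I_n]) [set t | fl N (X i t) = c ord0 i] else set0.
  rewrite (_ : _ @^-1` B = \bigcup_c E c).
    apply: countable_bigcupT_measurable => // c; rewrite /E; case: ifP => // _.
    apply: fin_bigcap_measurable => // i _.
    rewrite (_ : [set t | _] = X i @^-1` `[((c ord0 i)%:~R / N.+1%:R),
                                  ((c ord0 i + 1)%:~R / N.+1%:R)[%classic).
      by rewrite -[X in measurable X]setTI; apply: mX => //; exact: measurable_itv.
    apply/seteqP; split => t /=; rewrite in_itv/= ler_pdivrMr// ltr_pdivlMr//.
      by move=> <-; rewrite /fl mulrC; exact: floor_itv.
    by move=> h; apply: floor_def; rewrite mulrC.
  apply/seteqP; split => t /=.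
    move=> Bt; exists (\row_i fl N (X i t)) => //; rewrite /E; case: asboolP => //.
    by move=> _ i _ /=; rewrite mxE.
  move=> [c _]; rewrite /E; case: asboolP => // Bc H.
  suff -> : \row_i fl N (X i t) = c by [].
  by apply/rowP => i; rewrite mxE; exact: H.
move=> t _; apply/cvgrPdist_lt => e e0.
have [d0 d00 H] := row_continuousP (cf (\row_i X i t)) e0.
near=> N; rewrite distrC; apply: H => k; rewrite !mxE /fl.
have N0 : 0 < N.+1%:R :> R by [].
have /andP[] := floor_itv (N.+1%:R * X k t).
set F := Num.floor _; rewrite intrD => h1 h2.
have -> : F%:~R / N.+1%:R - X k t = (F%:~R - N.+1%:R * X k t) / N.+1%:R.
  by rewrite mulrBl [in RHS]mulrAC mulfV ?mul1r// gt_eqF.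
rewrite normrM normfV (ger0_norm (ltW N0)) ltr_pdivrMr//.
have h3 : `|F%:~R - N.+1%:R * X k t| <= 1 by rewrite ler_norml; lra.
apply: le_lt_trans h3 _; rewrite mulrC -ltr_pdivrMr// div1r.
apply: (@lt_trans _ _ N%:R); last by rewrite ltr_nat.
by near: N; exact: nbhs_infty_gtr.
Unshelve. all: by end_near.
Qed.

Local Open Scope ereal_scope.
Local Notation mu := (@lebesgue_measure R).

(** The integral is the difference of the integrals of the positive and negative parts even when
    these are infinite, so measurability in the parameter does not depend on integrability. *)
Lemma measurable_iint_signed k d (T : measurableType d) (f : T -> seqR R -> \bar R) :
  measurable_fun [set: T * seqR R] (fun p => f p.1 p.2) ->
  measurable_fun [set: T] (fun t => iint k (f t)).
Proof.
elim: k d T f => [|k IH] d T f mf.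
  apply: (measurableT_comp mf (_ : measurable_fun _ (fun t => (t, (fun=> 0%R) : seqR R)))).
  exact: measurable_fun_pair.
have mg : measurable_fun [set: T * measurableTypeR R]
    (fun p => iint k (fun v => f p.1 (consr p.2 v))).
  apply: (IH _ _ (fun p v => f p.1 (consr p.2 v))).
  apply: (measurableT_comp mf
    (_ : measurable_fun _ (fun q : (T * measurableTypeR R) * seqR R =>
                             (q.1.1, consr q.1.2 q.2)))).
  apply: measurable_fun_pair => /=.
    exact: measurableT_comp measurable_fst measurable_fst.
  apply: measurable_consr; last exact: measurable_snd.
  exact: measurableT_comp measurable_snd measurable_fst.
rewrite (_ : (fun t => _) =
  (fun t => \int[mu]_x (fun p => iint k (fun v => f p.1 (consr p.2 v)))^\+ (t, x)) \-
  (fun t => \int[mu]_x (fun p => iint k (fun v => f p.1 (consr p.2 v)))^\- (t, x))).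
  apply: emeasurable_funB.
    by apply: (measurable_fun_fubini_tonelli_F (m2 := mu)) => //; exact: measurable_funepos.
  by apply: (measurable_fun_fubini_tonelli_F (m2 := mu)) => //; exact: measurable_funeneg.
apply/funext => t /=; rewrite integralE.
by congr (_ - _); apply: eq_integral => x _; rewrite ?funeposE ?funenegE.
Qed.

(** Finite total integrals give finite inner integrals only for almost every value of the outer
    variable. The induction hypothesis holds there, and equality almost everywhere is enough. *)
Lemma iintB k (f g : seqR R -> R) :
  measurable_fun setT f -> measurable_fun setT g ->
  (forall v, (0 <= f v)%R) -> (forall v, (0 <= g v)%R) ->
  iint k (EFin \o f) < +oo -> iint k (EFin \o g) < +oo ->
  iint k (fun v => (f v - g v)%:E) = iint k (EFin \o f) - iint k (EFin \o g).
Proof.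
elim: k f g => [//|k IH] f g mf mg f0 g0 foo goo.
have mF (h : seqR R -> R) : measurable_fun setT h -> (forall v, (0 <= h v)%R) ->
    measurable_fun setT (fun x : R => iint k (fun v => (h (consr x v))%:E)).
  move=> mh h0; apply: (@measurable_iint_consr _ _ (EFin \o h)).
    exact/measurable_EFinP.
  by move=> v; rewrite lee_fin.
have intF (h : seqR R -> R) : measurable_fun setT h -> (forall v, (0 <= h v)%R) ->
    iint k.+1 (EFin \o h) < +oo ->
    mu.-integrable setT (fun x : R => iint k (fun v => (h (consr x v))%:E)).
  move=> mh h0 hoo; apply/integrableP; split; first exact: mF.
  apply: le_lt_trans hoo; rewrite iintS le_eqVlt; apply/orP; left; apply/eqP.
  by apply: eq_integral => x _; rewrite gee0_abs// iint_ge0// => v; rewrite lee_fin.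
have If := intF f mf f0 foo; have Ig := intF g mg g0 goo.
rewrite !iintS -integralB//.
apply: ae_eq_integral => //.
- apply: (@measurable_iint_signed k _ R (fun x v => (f (consr x v) - g (consr x v))%:E)).
  apply/measurable_EFinP; apply: measurable_funB.
    by apply: (measurableT_comp mf); apply: measurable_consr; [exact: measurable_fst|exact: measurable_snd].
  by apply: (measurableT_comp mg); apply: measurable_consr; [exact: measurable_fst|exact: measurable_snd].
- by apply: emeasurable_funB; exact: mF.
have mS (h : seqR R -> R) x : measurable_fun setT h -> measurable_fun setT (fun v => h (consr x v)).
  move=> mh; apply: (measurableT_comp mh).
  exact: (@measurable_consr _ _ (seqR R) (fun=> x) id).
have := integrable_ae measurableT If; have := integrable_ae measurableT Ig.
apply: filterS2 => x gx fx _ /=; rewrite IH//; do ?exact: mS.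
- by have := fx I; rewrite ge0_fin_numE// iint_ge0// => v; rewrite lee_fin.
- by have := gx I; rewrite ge0_fin_numE// iint_ge0// => v; rewrite lee_fin.
Qed.

End MeasurabilityIntegrability.

(** * Concentration of Lipschitz functions *)

Section Expectation.
Variables (R : realType) (n : nat) (V : 'rV[R]_n -> R).

Definition rowOf (v : seqR R) : 'rV[R]_n := \row_i v i.
(** Measurability is read on sequences, where [iint] integrates, so row vectors need no
    sigma-algebra of their own. *)
Definition rmeasurable (f : 'rV[R]_n -> R) :=
  measurable_fun [set: seqR R] (fun v => f (rowOf v)).

Lemma continuous_rmeasurable (f : 'rV[R]_n -> R) : continuous f -> rmeasurable f.
Proof.
move=> cf; apply: (@measurable_continuous_row _ _ (seqR R) n f (fun i v => v i)) => // i.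
exact: measurable_coord.
Qed.

Lemma rmeasurableM (f g : 'rV[R]_n -> R) :
  rmeasurable f -> rmeasurable g -> rmeasurable (fun x => f x * g x).
Proof. by move=> mf mg; exact: measurable_funM. Qed.

Lemma rmeasurableD (f g : 'rV[R]_n -> R) :
  rmeasurable f -> rmeasurable g -> rmeasurable (fun x => f x + g x).
Proof. by move=> mf mg; exact: measurable_funD. Qed.

Lemma rmeasurableB (f g : 'rV[R]_n -> R) :
  rmeasurable f -> rmeasurable g -> rmeasurable (fun x => f x - g x).
Proof. by move=> mf mg; exact: measurable_funB. Qed.

Lemma rmeasurable_cst (c : R) : rmeasurable (fun=> c).
Proof. exact: measurable_cst. Qed.

Lemma rmeasurableX (f : 'rV[R]_n -> R) k :
  rmeasurable f -> rmeasurable (fun x => f x ^+ k).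
Proof. by move=> mf; exact: measurable_funX. Qed.

Lemma rmeasurable_expR (f : 'rV[R]_n -> R) :
  rmeasurable f -> rmeasurable (fun x => expR (f x)).
Proof. by move=> mf; exact: (measurableT_comp (@measurable_expR R) mf). Qed.

Lemma rmeasurable_coord (i : 'I_n) : rmeasurable (fun x => x ord0 i).
Proof.
rewrite /rmeasurable (_ : (fun v => _) = fun v : seqR R => v i).
  exact: measurable_coord.
by apply/funext => v; rewrite mxE.
Qed.

Lemma rmeasurable_sum (I : Type) (s : seq I) (f : I -> 'rV[R]_n -> R) :
  (forall i, rmeasurable (f i)) -> rmeasurable (fun x => \sum_(i <- s) f i x).
Proof. by move=> mf; exact: measurable_sum. Qed.

Hypothesis mV : rmeasurable V.
Hypothesis Z_gt0 : (0 < normconst V < +oo)%E.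

Lemma normconstE : normconst V = (fine (normconst V))%:E.
Proof. by case/andP: Z_gt0 => Z0 Zoo; rewrite fineK// ge0_fin_numE// ltW. Qed.

Lemma fine_normconst_gt0 : 0 < fine (normconst V).
Proof. by case/andP: Z_gt0 => Z0 Zoo; rewrite fine_gt0// Z0. Qed.

Lemma dens_ge0 x : 0 <= dens V x.
Proof. by rewrite divr_ge0 ?expR_ge0// ltW// fine_normconst_gt0. Qed.

Lemma rmeasurable_dens : rmeasurable (dens V).
Proof.
apply: rmeasurableM; last exact: rmeasurable_cst.
by apply: rmeasurable_expR; exact: measurableT_comp mV.
Qed.

Local Lemma measurable_fdens (f : 'rV[R]_n -> R) : rmeasurable f ->
  measurable_fun [set: seqR R] (fun v => (f (rowOf v) * dens V (rowOf v))%:E).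
Proof.
by move=> mf; apply/measurable_EFinP; apply: rmeasurableM => //; exact: rmeasurable_dens.
Qed.

Lemma Exp_ge0 (f : 'rV[R]_n -> R) : (forall x, 0 <= f x) -> (0 <= Exp V f)%E.
Proof.
by move=> f0; apply: iint_ge0 => v; rewrite lee_fin mulr_ge0// dens_ge0.
Qed.

Lemma le_Exp (f g : 'rV[R]_n -> R) : rmeasurable f -> rmeasurable g ->
  (forall x, 0 <= f x) -> (forall x, f x <= g x) -> (Exp V f <= Exp V g)%E.
Proof.
move=> mf mg f0 fg; apply: le_iint; try exact: measurable_fdens.
- by move=> v; rewrite lee_fin mulr_ge0// dens_ge0.
- by move=> v; rewrite lee_fin ler_wpM2r// dens_ge0.
Qed.

Lemma ExpD (f g : 'rV[R]_n -> R) : rmeasurable f -> rmeasurable g ->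
  (forall x, 0 <= f x) -> (forall x, 0 <= g x) ->
  (Exp V (fun x => f x + g x)%R = Exp V f + Exp V g)%E.
Proof.
move=> mf mg f0 g0; rewrite -iintD; try exact: measurable_fdens.
- by apply: eq_iint => v; rewrite mulrDl EFinD.
- by move=> v; rewrite lee_fin mulr_ge0// dens_ge0.
- by move=> v; rewrite lee_fin mulr_ge0// dens_ge0.
Qed.

Lemma ExpZl (c : R) (f : 'rV[R]_n -> R) : rmeasurable f -> (forall x, 0 <= f x) ->
  0 <= c -> (Exp V (fun x => c * f x)%R = c%:E * Exp V f)%E.
Proof.
move=> mf f0 c0; rewrite -iintZl ?lee_fin//; try exact: measurable_fdens.
- by apply: eq_iint => v; rewrite -mulrA EFinM.
- by move=> v; rewrite lee_fin mulr_ge0// dens_ge0.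
Qed.

Lemma Exp_sum (I : Type) (s : seq I) (f : I -> 'rV[R]_n -> R) :
  (forall i, rmeasurable (f i)) -> (forall i x, 0 <= f i x) ->
  (Exp V (fun x => \sum_(i <- s) f i x)%R = \sum_(i <- s) Exp V (f i))%E.
Proof.
move=> mf f0; rewrite -iint_sum; try by move=> i; exact: measurable_fdens.
- by apply: eq_iint => v; rewrite mulr_suml sumEFin.
- by move=> i v; rewrite lee_fin mulr_ge0// dens_ge0.
Qed.

Lemma eq_Exp (f g : 'rV[R]_n -> R) : f =1 g -> Exp V f = Exp V g.
Proof. by move=> /funext ->. Qed.

Lemma Exp_normconst (f : 'rV[R]_n -> R) : rmeasurable f -> (forall x, 0 <= f x) ->
  intRn (fun x => (f x * expR (- V x))%:E) = (normconst V * Exp V f)%E.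
Proof.
move=> mf f0; rewrite normconstE -iintZl; last 3 first.
- exact: measurable_fdens.
- by move=> v; rewrite lee_fin mulr_ge0// dens_ge0.
- by rewrite lee_fin ltW// fine_normconst_gt0.
apply: eq_iint => v; rewrite -EFinM /dens; congr EFin.
by field; rewrite gt_eqF// fine_normconst_gt0.
Qed.

(** [Z * Exp 1 = Z] with [Z] finite and positive, so the total mass is 1; an infinite [Exp 1] would
    make the product infinite. *)
Lemma Exp_cst (c : R) : 0 <= c -> Exp V (fun=> c) = c%:E.
Proof.
move=> c0; rewrite (@eq_Exp _ (fun x => c * 1)%R); last by move=> x; rewrite mulr1.
rewrite ExpZl//; last exact: rmeasurable_cst.
have := @Exp_normconst (fun=> 1) (rmeasurable_cst 1) (fun=> ler01).
rewrite (_ : intRn _ = normconst V); last by apply: eq_iint => v; rewrite mul1r.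
rewrite normconstE; case: (Exp V (fun=> 1)) => [r| |].
- rewrite -EFinM => -[/esym/eqP]; rewrite -subr_eq0 -[X in _ - X]mulr1 -mulrBr.
  rewrite mulf_eq0 gt_eqF ?fine_normconst_gt0//= subr_eq0 => /eqP ->.
  by rewrite mule1.
- by rewrite mulry gtr0_sg ?fine_normconst_gt0// mul1e.
- by rewrite mulrNy gtr0_sg ?fine_normconst_gt0// mul1e.
Qed.

Lemma Exp_decomp (f g h : 'rV[R]_n -> R) :
  rmeasurable f -> rmeasurable g -> rmeasurable h ->
  (forall x, 0 <= f x) -> (forall x, 0 <= g x) -> (forall x, h x = f x - g x) ->
  (Exp V f < +oo)%E -> (Exp V g < +oo)%E ->
  (Exp V h = Exp V f - Exp V g)%E.
Proof.
move=> mf mg mh f0 g0 hfg foo goo.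
have m (k : 'rV[R]_n -> R) : rmeasurable k -> rmeasurable (fun x => k x * dens V x).
  by move=> mk; apply: rmeasurableM => //; exact: rmeasurable_dens.
have := @iintB R n _ _ (m _ mf) (m _ mg).
rewrite /Exp /intRn => <-//.
- by apply: eq_iint => v; rewrite hfg mulrBl.
- by move=> v; rewrite mulr_ge0// dens_ge0.
- by move=> v; rewrite mulr_ge0// dens_ge0.
Qed.

End Expectation.

(** * Exponential moments under strong convexity *)

Section Concentration.
Variables (R : realType) (n : nat) (V : 'rV[R]_n -> R) (C : R).
Hypothesis C0 : 0 < C.
Hypothesis C2V : C2 V.
Hypothesis HV : hess_lower_bound V C.
Hypothesis Z_gt0 : (0 < normconst V < +oo)%E.

Lemma rmeasurable_potential : rmeasurable V.
Proof.
by case: C2V => dV _ cV _; apply: continuous_rmeasurable; exact: continuous_of_partials.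
Qed.
Let mV := rmeasurable_potential.

(* Maurey's argument: the inf-convolution of h with |.|^2/(4C) is at least h - C L,
   and this loss is absorbed by the strong convexity of V in Prekopa-Leindler. *)
Lemma exp_moment_product (h : 'rV[R]_n -> R) (L : R) : rmeasurable h ->
  (forall x y, h x - h y <= C * L + sqnorm (x - y) / (4 * C)) ->
  (Exp V (fun x => expR (h x)) * Exp V (fun x => expR (- h x)) <= (expR (C * L))%:E)%E.
Proof.
move=> mh hL.
have me (g : 'rV[R]_n -> R) : rmeasurable g -> rmeasurable (fun x => expR (g x)).
  by move=> mg; exact: rmeasurable_expR.
have mNh : rmeasurable (fun x => - h x) by exact: measurableT_comp mh.
have mNV : rmeasurable (fun x => - V x) by exact: measurableT_comp mV.
have mVe (g : 'rV[R]_n -> R) : rmeasurable g -> measurable_fun [set: seqR R]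
    (fun v => (expR (g (rowOf n v)) * expR (- V (rowOf n v)))%:E).
  move=> mg; apply/measurable_EFinP.
  by apply: (@rmeasurableM _ _ (fun x => expR (g x)) (fun x => expR (- V x))); exact: me.
(* The three functions are exp(h - V), exp(-h - V) and exp(C L / 2 - V). For a Lipschitz [h] the
   number [L] is the square of the Lipschitz constant l, because l d <= C l^2 + d^2 / (4 C). *)
have PL := @prekopa_leindler_iint R n
  (fun v => (expR (h (rowOf n v)) * expR (- V (rowOf n v)))%:E)
  (fun v => (expR (- h (rowOf n v)) * expR (- V (rowOf n v)))%:E)
  (fun v => (expR (C * L / 2) * expR (- V (rowOf n v)))%:E)
  (mVe _ mh) (mVe _ mNh) (mVe _ (rmeasurable_cst n (C * L / 2))).
have e0 (a b : R) : (0 <= (expR a * expR b)%:E)%E by rewrite lee_fin mulr_ge0 ?expR_ge0.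
have {PL} := PL (fun=> e0 _ _) (fun=> e0 _ _) (fun=> e0 _ _).
have E (g : 'rV[R]_n -> R) : rmeasurable g ->
    iint n (fun v => (expR (g (rowOf n v)) * expR (- V (rowOf n v)))%:E) =
    (normconst V * Exp V (fun x => expR (g x)))%E.
  by move=> mg; rewrite -Exp_normconst//; try (by move=> x; exact: expR_ge0); exact: me.
rewrite (E _ mh) (E _ mNh) (E (fun=> C * L / 2) (rmeasurable_cst _ _)).
rewrite Exp_cst ?expR_ge0//.
have hz : forall u v : seqR R,
  ((expR (h (rowOf n u)) * expR (- V (rowOf n u)))%:E *
   (expR (- h (rowOf n v)) * expR (- V (rowOf n v)))%:E <=
   (expR (C * L / 2) * expR (- V (rowOf n (midpoint u v))))%:E *
   (expR (C * L / 2) * expR (- V (rowOf n (midpoint u v))))%:E)%E.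
  move=> u v; set x := rowOf n u; set y := rowOf n v.
  have -> : rowOf n (midpoint u v) = 2^-1 *: (x + y).
    by apply/rowP => i; rewrite !mxE mulrC.
  rewrite -!EFinM -!expRD lee_fin ler_expR.
  have := strong_midpoint_convexity x y C2V HV; have := hL x y.
  have -> : sqnorm (x - y) / (4 * C) = C^-1 / 4 * sqnorm (x - y).
    by field; rewrite gt_eqF.
  set s := _ * sqnorm _; lra.
move=> /(_ hz).
rewrite muleACA [leRHS]muleACA -EFinM -expRD -splitr.
rewrite lee_pmul2l//.
- by rewrite normconstE// -EFinM.
- by rewrite normconstE// -EFinM lte_fin mulr_gt0// fine_normconst_gt0.
Qed.

(** For [u >= 0] this is the square of [u / 2 <= expR (u / 2)]; the second exponential covers
    negative [u]. The constant 256 of [pow4_le_expR] is the fourth power of 4 for the same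
    reason. *)
Lemma sqr_le_expR (u : R) : u ^+ 2 <= 4 * (expR u + expR (- u)).
Proof.
have H (w : R) : 0 <= w -> w ^+ 2 <= 4 * expR w.
  move=> w0; have : w / 2 <= expR (w / 2).
    by apply: le_trans (expR_ge1Dx _); rewrite lerDr.
  move=> h; rewrite [w in expR w](splitr w) expRD.
  have : (w / 2) * (w / 2) <= expR (w / 2) * expR (w / 2) by apply: ler_pM; rewrite ?divr_ge0.
  by rewrite expr2; lra.
have [u0|u0] := leP 0 u.
  by apply: le_trans (H _ u0) _; rewrite ler_pM2l// lerDl expR_ge0.
have := H (- u); rewrite sqrrN oppr_ge0 => /(_ (ltW u0)) h.
by apply: le_trans h _; rewrite ler_pM2l// lerDr expR_ge0.
Qed.

Lemma pow4_le_expR (u : R) : u ^+ 4 <= 256 * (expR u + expR (- u)).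
Proof.
have H (w : R) : 0 <= w -> w ^+ 4 <= 256 * expR w.
  move=> w0; have : w / 4 <= expR (w / 4).
    by apply: le_trans (expR_ge1Dx _); rewrite lerDr.
  move=> h; have -> : expR w = expR (w / 4) ^+ 4.
    by rewrite -expRM_natl; congr expR; field.
  have : (w / 4) ^+ 4 <= expR (w / 4) ^+ 4 by rewrite ler_pXn2r// nnegrE ?expR_ge0// divr_ge0.
  by rewrite exprMn exprVn; lra.
have [u0|u0] := leP 0 u.
  by apply: le_trans (H _ u0) _; rewrite ler_pM2l ?ltr0n// lerDl expR_ge0.
have := H (- u); rewrite exprNn -signr_odd expr0 mul1r oppr_ge0 => /(_ (ltW u0)) h.
by apply: le_trans h _; rewrite ler_pM2l ?ltr0n// lerDr expR_ge0.
Qed.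

(** By Jensen both centred exponential moments are at least 1, and their product is at most exp(C
    L), so each is at most exp(C L). Jensen is obtained by integrating 1 + u <= exp u, with negative
    terms moved across so that only nonnegative functions are integrated. *)
Lemma exp_moment_centered (h : 'rV[R]_n -> R) (L a : R) :
  rmeasurable h -> (forall x, 0 <= h x) -> Exp V h = a%:E -> 
  (forall x y, h x - h y <= C * L + sqnorm (x - y) / (4 * C)) ->
  (Exp V (fun x => expR (h x - a) + expR (- (h x - a)))%R <= (2 * expR (C * L))%:E)%E.
Proof.
move=> mh h0 Ea hL.
have a0 : 0 <= a by rewrite -lee_fin -Ea; exact: Exp_ge0.
have P := exp_moment_product mh hL.
have mc : rmeasurable (fun x => h x - a) by exact: (rmeasurableB mh (rmeasurable_cst n a)).
have mNc : rmeasurable (fun x => - (h x - a)) by exact: measurableT_comp mc.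
have me1 := rmeasurable_expR mc; have me2 := rmeasurable_expR mNc.
have mNh : rmeasurable (fun x => - h x) by exact: measurableT_comp mh.
(* Jensen's inequality for both factors *)
have J1 : (1 <= Exp V (fun x => expR (h x - a)))%E.
  have : (Exp V (fun x => 1 + h x)%R <= Exp V (fun x => expR (h x - a) + a)%R)%E.
    apply: le_Exp => //.
    - by apply: rmeasurableD => //; exact: rmeasurable_cst.
    - by apply: rmeasurableD => //; exact: rmeasurable_cst.
    - by move=> x; rewrite addr_ge0.
    - move=> x; have := expR_ge1Dx (h x - a); lra.
  rewrite !ExpD ?Exp_cst ?Ea//; try exact: rmeasurable_cst;
    try by move=> x; exact: expR_ge0.
  by rewrite leeD2rE.
have J2 : (1 <= Exp V (fun x => expR (- (h x - a))))%E.
  have : (Exp V (fun=> 1 + a)%R <= Exp V (fun x => expR (- (h x - a)) + h x)%R)%E.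
    apply: le_Exp => //.
    - exact: rmeasurable_cst.
    - by apply: rmeasurableD.
    - by move=> x; rewrite addr_ge0.
    - move=> x; have := expR_ge1Dx (- (h x - a)); lra.
  rewrite Exp_cst ?addr_ge0// ExpD ?Ea//; try (by move=> x; exact: expR_ge0).
  by rewrite EFinD leeD2rE.
have E1 : Exp V (fun x => expR (h x)) = ((expR a)%:E * Exp V (fun x => expR (h x - a)))%E.
  rewrite -ExpZl ?expR_ge0//; try by move=> x; exact: expR_ge0.
  by apply: eq_Exp => x; rewrite -expRD addrC subrK.
have E2 : Exp V (fun x => expR (- h x)) =
    ((expR (- a))%:E * Exp V (fun x => expR (- (h x - a))))%E.
  rewrite -ExpZl ?expR_ge0//; try by move=> x; exact: expR_ge0.
  by apply: eq_Exp => x; rewrite -expRD opprB addrA addNr sub0r.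
move: P; rewrite E1 E2 muleACA -EFinM -expRD subrr expR0 mul1e => P.
rewrite ExpD//; try by move=> x; exact: expR_ge0.
rewrite mulr2n mulrDl mul1r EFinD; apply: leeD.
  apply: le_trans P; rewrite -[leLHS]mule1; apply: lee_pmul => //.
  exact: le_trans J1.
apply: le_trans P; rewrite -[leLHS]mul1e; apply: lee_pmul => //.
exact: le_trans J2.
Qed.

End Concentration.

(** * Concentration of quadratic forms *)

Section QuadraticForms.
Variables (R : realType) (n : nat).
Implicit Types (A B : 'M[R]_n) (x y u : 'rV[R]_n).

Definition bform B x y : R := (x *m B *m y^T) ord0 ord0.
Definition qform B x : R := bform B x x.

Lemma bformE B x y : bform B x y = \sum_i \sum_j B i j * (x ord0 i * y ord0 j).
Proof.
rewrite /bform mxE exchange_big/=; apply: eq_bigr => j _.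
rewrite !mxE big_distrl/=; apply: eq_bigr => i _.
by rewrite mulrAC mulrC mulrCA.
Qed.

Lemma bformC B x y : B^T = B -> bform B x y = bform B y x.
Proof.
move=> BT; rewrite !bformE exchange_big/=; apply: eq_bigr => i _; apply: eq_bigr => j _.
by rewrite -{1}BT mxE [x _ _ * _]mulrC.
Qed.

Lemma bformDl B x y u : bform B (x + y) u = bform B x u + bform B y u.
Proof. by rewrite /bform !mulmxDl mxE. Qed.

Lemma bformZl B (a : R) x y : bform B (a *: x) y = a * bform B x y.
Proof. by rewrite /bform -!scalemxAl mxE. Qed.

Lemma qformB B x y (s r : R) : B^T = B ->
  qform B (s *: x - r *: y) = s ^+ 2 * qform B x - 2 * s * r * bform B x y + r ^+ 2 * qform B y.
Proof.
move=> BT; rewrite /qform -scaleNr bformDl !bformZl ![bform B _ (_ + _)]bformC// !bformDl !bformZl.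
by rewrite (bformC y x BT); ring.
Qed.

(** With [p] and [q] the two seminorms and b the bilinear value, positivity of the form at
    [q *: x - p *: y] reads 2 p q (p q - b) >= 0. The form may degenerate: when [p * q = 0], an
    inequality affine in a free parameter forces b <= 0. *)
Lemma bform_cauchy_schwarz B x y : B^T = B -> (forall u, 0 <= qform B u) ->
  bform B x y <= Num.sqrt (qform B x) * Num.sqrt (qform B y).
Proof.
move=> BT B0; set p := Num.sqrt (qform B x); set q := Num.sqrt (qform B y).
have p2 : qform B x = p ^+ 2 by rewrite sqr_sqrtr.
have q2 : qform B y = q ^+ 2 by rewrite sqr_sqrtr.
have p0 : 0 <= p by exact: sqrtr_ge0.
have q0 : 0 <= q by exact: sqrtr_ge0.
have H s r : 0 <= s ^+ 2 * p ^+ 2 - 2 * s * r * bform B x y + r ^+ 2 * q ^+ 2.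
  by rewrite -p2 -q2 -qformB.
have aux (P Q : R) (b : R) : 0 <= Q -> (forall s, 0 <= Q ^+ 2 - 2 * s * b) -> b <= 0.
  move=> Q0 Hs; rewrite leNgt; apply/negP => b0.
  have := Hs ((Q ^+ 2 + 1) / (2 * b)).
  have -> : 2 * ((Q ^+ 2 + 1) / (2 * b)) * b = Q ^+ 2 + 1 by field; rewrite gt_eqF.
  lra.
have [pq0|pq0] := eqVneq (p * q) 0; last first.
  have pq : 0 < p * q by rewrite lt0r pq0 mulr_ge0.
  have := H q p; rewrite (_ : _ + _ = 2 * (p * q) * (p * q - bform B x y)); last by ring.
  by rewrite pmulr_rge0 ?subr_ge0// mulr_gt0.
rewrite pq0; move/eqP: pq0; rewrite mulf_eq0 => /orP[] /eqP E0.
  apply: (aux q q _ q0) => s; have := H s 1.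
  by rewrite E0 expr0n/= mulr0 sub0r mulr1 expr1n mul1r addrC.
apply: (aux p p _ p0) => s; have := H 1 s.
by rewrite E0 expr0n/= mulr0 addr0 mulr1 expr1n mul1r.
Qed.

(** Reverse triangle inequality for the seminorm attached to [B], a consequence of
    Cauchy-Schwarz. *)
Lemma sqrt_qform_lipschitz B x y : B^T = B -> (forall u, 0 <= qform B u) ->
  (Num.sqrt (qform B x) - Num.sqrt (qform B y)) ^+ 2 <= qform B (x - y).
Proof.
move=> BT B0; have := bform_cauchy_schwarz x y BT B0.
have := qformB x y 1 1 BT; rewrite !scale1r => ->.
have := sqr_sqrtr (B0 x); have := sqr_sqrtr (B0 y).
set p := Num.sqrt _; set q := Num.sqrt _ => <- <-; rewrite !expr2; lra.
Qed.

Lemma sqnorm_ge0 x : 0 <= sqnorm x.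
Proof. by apply: sumr_ge0 => i _; exact: sqr_ge0. Qed.

Lemma qform_scalar (k : R) x : qform k%:M x = k * sqnorm x.
Proof.
rewrite /qform /bform mul_mx_scalar -scalemxAl mxE; congr (_ * _).
by rewrite mxE; apply: eq_bigr => i _; rewrite mxE expr2.
Qed.

Lemma qformD A B x : qform (A + B) x = qform A x + qform B x.
Proof. by rewrite /qform /bform mulmxDr mulmxDl mxE. Qed.

Lemma qform_delta B (i : 'I_n) : qform B (delta_mx ord0 i) = B i i.
Proof. by rewrite /qform /bform -rowE trmx_delta -colE !mxE. Qed.

Lemma sqnorm_delta (i : 'I_n) : sqnorm (delta_mx ord0 i : 'rV[R]_n) = 1.
Proof.
rewrite /sqnorm (bigD1 i)//= big1 => [|j ji]; rewrite !mxE !eqxx/= ?addr0 ?expr1n//.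
by rewrite (negbTE ji) expr0n.
Qed.

Lemma mxtrace_le B (K : R) : (forall u, qform B u <= K * sqnorm u) -> \tr B <= K * n%:R.
Proof.
move=> BK; rewrite /mxtrace.
apply: (@le_trans _ _ (\sum_(i < n) K)); last by rewrite sumr_const card_ord mulr_natr.
by apply: ler_sum => i _; have := BK (delta_mx ord0 i); rewrite qform_delta sqnorm_delta mulr1.
Qed.

Lemma rmeasurable_qform B : rmeasurable (qform B).
Proof.
rewrite (_ : qform B = fun x => \sum_i \sum_j B i j * (x ord0 i * x ord0 j)); last first.
  by apply/funext => x; rewrite /qform bformE.
apply: rmeasurable_sum => i; apply: rmeasurable_sum => j.
apply: rmeasurableM; first exact: rmeasurable_cst.
by apply: rmeasurableM; exact: rmeasurable_coord.
Qed.

End QuadraticForms.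

Section QuadraticConcentration.
Variables (R : realType) (n : nat) (V : 'rV[R]_n -> R) (C : R).
Hypothesis C0 : 0 < C.
Hypothesis C2V : C2 V.
Hypothesis HV : hess_lower_bound V C.
Hypothesis Z_gt0 : (0 < normconst V < +oo)%E.
Let mV := rmeasurable_potential C2V.

Lemma rmeasurable_sqrt (f : 'rV[R]_n -> R) :
  rmeasurable f -> rmeasurable (fun x => Num.sqrt (f x)).
Proof.
move=> mf; apply: (measurableT_comp _ mf).
by apply: continuous_measurable_fun => x; exact: sqrt_continuous.
Qed.

(* The larger of the two constants 2 * 4 and 2 * 256 that come from sqr_le_expR
   and pow4_le_expR. *)
Definition moment_cst : R := locked (512 * expR 1).

Lemma moment_cst_gt0 : 0 < moment_cst.
Proof. by rewrite /moment_cst -lock; apply: mulr_gt0; [rewrite ltr0n|exact: expR_gt0]. Qed.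

Lemma lipschitz_moments (h : 'rV[R]_n -> R) (L a : R) :
  rmeasurable h -> (forall x, 0 <= h x) -> Exp V h = a%:E -> 0 < L ->
  (forall x y, (h x - h y) ^+ 2 <= L * sqnorm (x - y)) ->
  (Exp V (fun x => (h x - a) ^+ 2)%R <= (moment_cst * (C * L))%:E)%E /\
  (Exp V (fun x => (h x - a) ^+ 4)%R <= (moment_cst * (C * L) ^+ 2)%:E)%E.
Proof.
move=> mh h0 Ea L0 hL.
have CL : 0 < C * L by exact: mulr_gt0.
(* This scaling makes the exponent [C * (t ^+ 2 * L)] equal to 1, so the exponential moments of
   [t * h] are at most [2 * expR 1] whatever [C] and [L]. The powers of [t] come back as [C * L] and
   its square. *)
pose t := Num.sqrt (C * L)^-1.
have t0 : 0 < t by rewrite sqrtr_gt0 invr_gt0.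
have t2 : t ^+ 2 = (C * L)^-1 by rewrite sqr_sqrtr// invr_ge0 ltW.
have mth : rmeasurable (fun x => t * h x).
  by apply: rmeasurableM => //; exact: rmeasurable_cst.
have M : (Exp V (fun x => expR (t * h x - t * a) + expR (- (t * h x - t * a)))%R
    <= (2 * expR 1)%:E)%E.
  have -> : expR 1 = expR (C * (t ^+ 2 * L)).
    by congr expR; rewrite t2; field; rewrite !gt_eqF.
  apply: exp_moment_centered => //.
  - by move=> x; rewrite mulr_ge0// ltW.
  - by rewrite ExpZl// ?Ea// ltW.
  - move=> x y; rewrite -mulrBr.
    have -> : C * (t ^+ 2 * L) = 1 by rewrite t2; field; rewrite !gt_eqF.
    apply: (@le_trans _ _ (1 + (t * (h x - h y)) ^+ 2 / 4)).
      by have := sqr_ge0 (t * (h x - h y) / 2 - 1); rewrite !expr2; lra.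
    rewrite lerD2l exprMn t2.
    rewrite ler_pdivrMr// mulrC ler_pdivrMr//; apply: le_trans (hL x y) _.
    by rewrite le_eqVlt; apply/orP; left; apply/eqP; field; rewrite gt_eqF.
have mc : rmeasurable (fun x => t * h x - t * a).
  by apply: rmeasurableB => //; exact: rmeasurable_cst.
have mcc : rmeasurable (fun x => h x - a) by exact: (rmeasurableB mh (rmeasurable_cst n a)).
have mNc : rmeasurable (fun x => - (t * h x - t * a)) by exact: measurableT_comp mc.
pose G x := expR (t * h x - t * a) + expR (- (t * h x - t * a)).
have mG : rmeasurable G by apply: rmeasurableD; exact: rmeasurable_expR.
have G0 x : 0 <= G x by rewrite addr_ge0// expR_ge0.
have bound (k : R) (f : 'rV[R]_n -> R) : 0 <= k -> rmeasurable f -> (forall x, 0 <= f x) ->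
    (forall x, f x <= k * G x) -> (Exp V f <= (k * (2 * expR 1))%:E)%E.
  move=> k0 mf f0 fG.
  apply: (@le_trans _ _ (Exp V (fun x => k * G x)%R)).
    by apply: le_Exp => //; apply: rmeasurableM => //; exact: rmeasurable_cst.
  by rewrite ExpZl// EFinM; apply: lee_wpmul2l.
split.
- apply: (@le_trans _ _ (4 * (C * L) * (2 * expR 1))%:E); last first.
    rewrite lee_fin (_ : _ * _ * _ = 8 * expR 1 * (C * L)); last by ring.
    by rewrite /moment_cst -lock ler_pM2r// ler_pM2r ?expR_gt0// ler_nat.
  apply: bound.
  + by rewrite mulr_ge0// ltW.
  + exact: rmeasurableX.
  + by move=> x; rewrite sqr_ge0.
  + move=> x; have := sqr_le_expR (t * h x - t * a).
    rewrite -mulrBr exprMn t2 ler_pdivrMl// => H.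
    by apply: le_trans H _; rewrite /G -mulrBr le_eqVlt; apply/orP; left; apply/eqP; ring.
- rewrite (_ : moment_cst * _ = 256 * (C * L) ^+ 2 * (2 * expR 1)); last first.
    by rewrite /moment_cst -lock; ring.
  apply: bound.
  + by apply: mulr_ge0; [rewrite ler0n|rewrite exprn_ge0// ltW].
  + exact: rmeasurableX.
  + by move=> x; rewrite exprn_even_ge0.
  + move=> x; have := pow4_le_expR (t * h x - t * a).
    rewrite -mulrBr exprMn (_ : t ^+ 4 = ((C * L) ^+ 2)^-1); last first.
      by rewrite (exprM t 2 2) t2 exprVn.
    rewrite ler_pdivrMl ?exprn_gt0// => H.
    by apply: le_trans H _; rewrite /G -mulrBr le_eqVlt; apply/orP; left; apply/eqP; ring.
Qed.

Hypothesis isotropic : forall i j, Exp V (fun x => x ord0 i * x ord0 j) =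
                 (if i == j then 1 else 0)%:E.

(** [ExpD] and [ExpZl] concern nonnegative functions, while the products of coordinates and the
    entries of [B] have signs. Splitting both and moving the negative products across gives
    [qform B + N = P]; as [N] has finite expectation, it can be subtracted again. *)
Lemma Exp_qform (B : 'M[R]_n) : (forall x, 0 <= qform B x) ->
  Exp V (qform B) = (\tr B)%:E.
Proof.
move=> B0.
pose f i j (x : 'rV[R]_n) := Num.max (x ord0 i * x ord0 j) 0.
pose g i j (x : 'rV[R]_n) := Num.max (- (x ord0 i * x ord0 j)) 0.
have fg i j (x : 'rV[R]_n) : x ord0 i * x ord0 j = f i j x - g i j x.
  by rewrite /f /g; case: leP => h1; case: leP => h2; lra.
have f0 i j x : 0 <= f i j x by rewrite le_max lexx orbT.
have g0 i j x : 0 <= g i j x by rewrite le_max lexx orbT.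
have mc i j : rmeasurable (fun x : 'rV[R]_n => x ord0 i * x ord0 j).
  by apply: rmeasurableM; exact: rmeasurable_coord.
have mf i j : rmeasurable (f i j).
  by apply: measurable_maxr; [exact: mc|exact: measurable_cst].
have mg i j : rmeasurable (g i j).
  apply: measurable_maxr; last exact: measurable_cst.
  exact: measurableT_comp (mc i j).
have fin (k : 'rV[R]_n -> R) i j : rmeasurable k -> (forall x, 0 <= k x) ->
    (forall x, k x <= x ord0 i * x ord0 i + x ord0 j * x ord0 j) -> (Exp V k < +oo)%E.
  move=> mk k0 kij.
  apply: (@le_lt_trans _ _ (Exp V (fun x => x ord0 i * x ord0 i + x ord0 j * x ord0 j)%R)).
    by apply: le_Exp => //; exact: rmeasurableD.
  rewrite ExpD//; try by move=> x; rewrite -expr2 sqr_ge0.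
  by rewrite !isotropic !eqxx -EFinD ltry.
(* The dominating function has expectation 2 by isotropy, which makes both parts of the product
   integrable. *)
have dom (x : 'rV[R]_n) i j : `|x ord0 i * x ord0 j| <= x ord0 i * x ord0 i + x ord0 j * x ord0 j.
  have := sqr_ge0 (x ord0 i - x ord0 j); have := sqr_ge0 (x ord0 i + x ord0 j).
  have := sqr_ge0 (x ord0 i); have := sqr_ge0 (x ord0 j).
  rewrite !expr2 ler_norml => *; apply/andP; split; lra.
have foo i j : (Exp V (f i j) < +oo)%E.
  apply: (fin _ i j) => // x; rewrite ge_max (le_trans (ler_norm _) (dom x i j))/=.
  by rewrite addr_ge0// -expr2 sqr_ge0.
have goo i j : (Exp V (g i j) < +oo)%E.
  apply: (fin _ i j) => // x; rewrite ge_max addr_ge0 -?expr2 ?sqr_ge0// andbT.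
  by rewrite (le_trans (ler_norm _))// normrN dom.
have fE i j : Exp V (f i j) = (fine (Exp V (f i j)))%:E.
  by rewrite fineK// ge0_fin_numE// Exp_ge0.
have gE i j : Exp V (g i j) = (fine (Exp V (g i j)))%:E.
  by rewrite fineK// ge0_fin_numE// Exp_ge0.
have fgE i j : fine (Exp V (f i j)) - fine (Exp V (g i j)) = (i == j)%:R.
  have := Exp_decomp mV Z_gt0 (mf i j) (mg i j) (mc i j) (f0 i j) (g0 i j) (fg i j) (foo i j) (goo i j).
  by rewrite isotropic fE gE -EFinB => -[<-]; case: eqP.
pose bp i j := Num.max (B i j) 0; pose bm i j := Num.max (- B i j) 0.
have bpm i j : B i j = bp i j - bm i j.
  by rewrite /bp /bm; case: leP => h1; case: leP => h2; lra.
have bp0 i j : 0 <= bp i j by rewrite le_max lexx orbT.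
have bm0 i j : 0 <= bm i j by rewrite le_max lexx orbT.
pose P (x : 'rV[R]_n) := \sum_i \sum_j (bp i j * f i j x + bm i j * g i j x).
pose N (x : 'rV[R]_n) := \sum_i \sum_j (bp i j * g i j x + bm i j * f i j x).
have QNP x : qform B x + N x = P x.
  rewrite /qform bformE /N /P -big_split/=; apply: eq_bigr => i _.
  rewrite -big_split/=; apply: eq_bigr => j _; rewrite bpm fg; ring.
have mlin (k l : R) (u v : 'rV[R]_n -> R) : rmeasurable u -> rmeasurable v ->
    rmeasurable (fun x => k * u x + l * v x).
  by move=> mu mv; apply: rmeasurableD; apply: rmeasurableM => //; exact: rmeasurable_cst.
have Esum (u v : 'I_n -> 'I_n -> 'rV[R]_n -> R) :
    (forall i j, rmeasurable (u i j)) -> (forall i j, rmeasurable (v i j)) ->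
    (forall i j x, 0 <= u i j x) -> (forall i j x, 0 <= v i j x) ->
    (forall i j, Exp V (u i j) = (fine (Exp V (u i j)))%:E) ->
    (forall i j, Exp V (v i j) = (fine (Exp V (v i j)))%:E) ->
    Exp V (fun x => \sum_i \sum_j (bp i j * u i j x + bm i j * v i j x)) =
    (\sum_i \sum_j (bp i j * fine (Exp V (u i j)) + bm i j * fine (Exp V (v i j))))%:E.
  move=> mu mv u0 v0 uE vE.
  rewrite Exp_sum//; last 2 first.
  - by move=> i; apply: rmeasurable_sum => j; exact: mlin.
  - by move=> i x; apply: sumr_ge0 => j _; rewrite addr_ge0// mulr_ge0.
  rewrite -sumEFin; apply: eq_bigr => i _.
  rewrite Exp_sum//; last 2 first.
  - by move=> j; exact: mlin.
  - by move=> j x; rewrite addr_ge0// mulr_ge0.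
  rewrite -sumEFin; apply: eq_bigr => j _.
  rewrite ExpD//.
  - by rewrite !ExpZl// uE vE -!EFinM -EFinD.
  - by apply: rmeasurableM => //; exact: rmeasurable_cst.
  - by apply: rmeasurableM => //; exact: rmeasurable_cst.
  - by move=> x; rewrite mulr_ge0.
  - by move=> x; rewrite mulr_ge0.
have EP := Esum f g mf mg f0 g0 fE gE; have EN := Esum g f mg mf g0 f0 gE fE.
have N0 x : 0 <= N x.
  by apply: sumr_ge0 => i _; apply: sumr_ge0 => j _; rewrite addr_ge0// mulr_ge0.
have mN : rmeasurable N.
  by apply: rmeasurable_sum => i; apply: rmeasurable_sum => j; exact: mlin.
have := eq_Exp V QNP; rewrite ExpD//; last exact: rmeasurable_qform.
rewrite EP EN; case: (Exp V (qform B)) => [q| |]//; rewrite -EFinD => -[E].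
congr EFin; apply/eqP; rewrite -(subr_eq0 q); apply/eqP.
have -> : q = \sum_i \sum_j (bp i j - bm i j) * (fine (Exp V (f i j)) - fine (Exp V (g i j))).
  apply: (@addIr _ (\sum_i \sum_j (bp i j * fine (Exp V (g i j)) + bm i j * fine (Exp V (f i j))))).
  rewrite E -big_split/=; apply: eq_bigr => i _; rewrite -big_split/=.
  by apply: eq_bigr => j _; ring.
apply/eqP; rewrite subr_eq0; apply/eqP; apply: eq_bigr => i _.
rewrite (bigD1 i)//= big1 ?addr0; first by rewrite fgE eqxx mulr1 -bpm.
by move=> j ji; rewrite fgE eq_sym (negbTE ji) mulr0.
Qed.

End QuadraticConcentration.

(** * Variance of quadratic forms *)

Section QuadraticVariance.
Variables (R : realType) (n : nat) (V : 'rV[R]_n -> R) (C : R).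
Hypothesis C0 : 0 < C.
Hypothesis C2V : C2 V.
Hypothesis HV : hess_lower_bound V C.
Hypothesis Z_gt0 : (0 < normconst V < +oo)%E.
Hypothesis isotropic : forall i j, Exp V (fun x => x ord0 i * x ord0 j) =
                 (if i == j then 1 else 0)%:E.
Let mV := rmeasurable_potential C2V.
Local Notation E := (moment_cst R).

(** Let h be the square root of the form, Lipschitz with squared constant [K], a = E h and d = h -
    a. Then q - a^2 = d (d + 2 a), so its second moment follows from those of d^2 and d, with a^2 <=
    tr B <= K n. Recentring from a^2 to the trace costs at most the same bound [M], whence the final
    [4 * M]. *)
Lemma psd_qform_variance (B : 'M[R]_n) (K : R) : 0 < K -> B^T = B ->
  (forall x, 0 <= qform B x) -> (forall x, qform B x <= K * sqnorm x) ->
  (Exp V (fun x => (qform B x - \tr B) ^+ 2)%R <=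
   (4 * (2 * E * (C * K) ^+ 2 + 8 * E * (C * K) * (K * n%:R)))%:E)%E.
Proof.
move=> K0 BT B0 BK; set M := 2 * _ * _ + _.
have e0 := moment_cst_gt0 R.
have CK : 0 < C * K by exact: mulr_gt0.
have M0 : 0 < M.
  by rewrite ltr_pwDl// ?mulr_gt0 ?exprn_gt0// !mulr_ge0// ltW.
pose h x := Num.sqrt (qform B x).
have mB := rmeasurable_qform B.
have mh : rmeasurable h by exact: rmeasurable_sqrt.
have h0 x : 0 <= h x by exact: sqrtr_ge0.
have h2 x : h x ^+ 2 = qform B x by exact: sqr_sqrtr.
have mcst c : rmeasurable (fun _ : 'rV[R]_n => c) by exact: rmeasurable_cst.
have EB := Exp_qform C2V Z_gt0 isotropic B0.
set T := \tr B in EB *.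
have hoo : (Exp V h < +oo)%E.
  apply: (@le_lt_trans _ _ (Exp V (fun x => 1 + qform B x))).
    apply: le_Exp => //; first exact: rmeasurableD.
    by move=> x; rewrite -h2; have := sqr_ge0 (h x - 1); rewrite !expr2; have := h0 x; nra.
  by rewrite ExpD// Exp_cst// EB -EFinD ltry.
have [a Ea] : exists a : R, Exp V h = a%:E.
  by exists (fine (Exp V h)); rewrite fineK// ge0_fin_numE// Exp_ge0.
have a0 : 0 <= a by rewrite -lee_fin -Ea; exact: Exp_ge0.
have aT : a ^+ 2 <= T.
  have : (Exp V (fun x => (2 * a) * h x)%R <= Exp V (fun x => qform B x + a ^+ 2)%R)%E.
    apply: le_Exp => //.
    - exact: rmeasurableM.
    - exact: rmeasurableD.
    - by move=> x; rewrite !mulr_ge0.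
    - by move=> x; rewrite -h2; have := sqr_ge0 (h x - a); rewrite !expr2; lra.
  rewrite ExpZl// ?mulr_ge0// ExpD// ?Exp_cst// ?sqr_ge0//; try by move=> _; exact: sqr_ge0.
  by rewrite Ea EB -EFinM -EFinD lee_fin expr2; lra.
have TK : T <= K * n%:R by exact: mxtrace_le.
have lip x y : (h x - h y) ^+ 2 <= K * sqnorm (x - y).
  by apply: le_trans (BK _); exact: sqrt_qform_lipschitz.
have [m2 m4] := lipschitz_moments C0 C2V HV Z_gt0 mh h0 Ea K0 lip.
have mha : rmeasurable (fun x => h x - a) by exact: rmeasurableB.
have mha2 : rmeasurable (fun x => (h x - a) ^+ 2) by exact: rmeasurableX.
have mha4 : rmeasurable (fun x => (h x - a) ^+ 4) by exact: rmeasurableX.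
have ge4 x : 0 <= (h x - a) ^+ 4 by rewrite exprn_even_ge0.
have mBa : rmeasurable (fun x => (qform B x - a ^+ 2) ^+ 2).
  by apply: rmeasurableX; exact: rmeasurableB.
have mBT : rmeasurable (fun x => (qform B x - T) ^+ 2).
  by apply: rmeasurableX; exact: rmeasurableB.
have EM : (Exp V (fun x => (qform B x - a ^+ 2) ^+ 2)%R <= M%:E)%E.
  apply: (@le_trans _ _ (Exp V (fun x => 2 * (h x - a) ^+ 4 + 8 * a ^+ 2 * (h x - a) ^+ 2))).
    apply: le_Exp => //.
    - by apply: rmeasurableD; exact: rmeasurableM.
    - by move=> x; exact: sqr_ge0.
    - move=> x; rewrite -h2.
      have -> : h x ^+ 2 - a ^+ 2 = (h x - a) * ((h x - a) + 2 * a) by ring.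
      set d := h x - a; rewrite exprMn.
      have -> : 2 * d ^+ 4 + 8 * a ^+ 2 * d ^+ 2 = d ^+ 2 * (2 * d ^+ 2 + 8 * a ^+ 2) by ring.
      apply: ler_wpM2l; first exact: sqr_ge0.
      by have := sqr_ge0 (d - 2 * a); rewrite !expr2; lra.
  rewrite ExpD//; last 4 first.
  - exact: rmeasurableM.
  - exact: rmeasurableM.
  - by move=> x; rewrite mulr_ge0.
  - by move=> x; apply: mulr_ge0; [apply: mulr_ge0 => //; exact: sqr_ge0|exact: sqr_ge0].
  rewrite !ExpZl//; last 2 first.
  - by move=> x; exact: sqr_ge0.
  - by rewrite mulr_ge0// sqr_ge0.
  apply: (@le_trans _ _ (2%:E * (E * (C * K) ^+ 2)%:E +
     (8 * a ^+ 2)%:E * (E * (C * K))%:E)%E).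
    apply: leeD; apply: lee_wpmul2l => //.
    by rewrite lee_fin mulr_ge0// sqr_ge0.
  rewrite -!EFinM -EFinD lee_fin /M.
  have -> : 2 * (E * (C * K) ^+ 2) = 2 * E * (C * K) ^+ 2 by rewrite mulrA.
  rewrite lerD2l.
  have -> : 8 * a ^+ 2 * (E * (C * K)) = 8 * E * (C * K) * a ^+ 2 by ring.
  apply: ler_wpM2l; last exact: le_trans aT TK.
  by rewrite !mulr_ge0// ltW.
pose s := Num.sqrt M.
have s0 : 0 < s by rewrite sqrtr_gt0.
have s2 : s ^+ 2 = M by rewrite sqr_sqrtr// ltW.
(* The mean of q - a^2 is bounded through q <= a^2 + s / 2 + (q - a^2)^2 / (2 s); the choice of [s]
   as the square root of [M] balances the two terms. *)
have Tas : T <= a ^+ 2 + s.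
  have : (Exp V (qform B) <=
     Exp V (fun x => (a ^+ 2 + s / 2) + (2 * s)^-1 * (qform B x - a ^+ 2) ^+ 2)%R)%E.
    apply: le_Exp => //.
    - by apply: rmeasurableD => //; exact: rmeasurableM.
    - move=> x; set q := qform B x.
      have : 0 <= (2 * s)^-1 * (q - a ^+ 2 - s) ^+ 2.
        by rewrite mulr_ge0 ?sqr_ge0// invr_ge0 mulr_ge0// ltW.
      have -> : (2 * s)^-1 * (q - a ^+ 2 - s) ^+ 2 =
          (2 * s)^-1 * (q - a ^+ 2) ^+ 2 - (q - a ^+ 2) + s / 2.
        by field; rewrite gt_eqF.
      lra.
  have c0 : 0 <= a ^+ 2 + s / 2 by rewrite addr_ge0 ?sqr_ge0// divr_ge0// ltW.
  have d0 : 0 <= (2 * s)^-1 by rewrite invr_ge0 mulr_ge0// ltW.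
  rewrite EB ExpD//; last 2 first.
  - exact: rmeasurableM.
  - by move=> x; rewrite mulr_ge0// sqr_ge0.
  rewrite Exp_cst// ExpZl//; last by move=> x; exact: sqr_ge0.
  move=> H; have : (T%:E <= (a ^+ 2 + s / 2)%:E + (2 * s)^-1%:E * M%:E)%E.
    by apply: le_trans H _; apply: leeD => //; apply: lee_wpmul2l.
  rewrite -EFinM -EFinD lee_fin -s2.
  by rewrite (_ : (2 * s)^-1 * s ^+ 2 = s / 2); [lra|field; rewrite gt_eqF].
have TaM : (T - a ^+ 2) ^+ 2 <= M.
  by rewrite -s2 ler_sqr ?nnegrE ?subr_ge0// ?(ltW s0)// lerBlDl.
apply: (@le_trans _ _ (Exp V (fun x => 2 * (qform B x - a ^+ 2) ^+ 2 + 2 * (T - a ^+ 2) ^+ 2))).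
  apply: le_Exp => //.
  - by apply: rmeasurableD => //; exact: rmeasurableM.
  - by move=> x; exact: sqr_ge0.
  - move=> x; have := sqr_ge0 ((qform B x - a ^+ 2) + (T - a ^+ 2)); rewrite !expr2; lra.
rewrite ExpD//; last 3 first.
- exact: rmeasurableM.
- by move=> x; rewrite mulr_ge0// sqr_ge0.
- by move=> x; rewrite mulr_ge0// sqr_ge0.
have c0 : 0 <= 2 * (T - a ^+ 2) ^+ 2 by rewrite mulr_ge0// sqr_ge0.
rewrite (Exp_cst mV Z_gt0 c0) ExpZl//; last by move=> x; exact: sqr_ge0.
apply: (@le_trans _ _ (2%:E * M%:E + (2 * M)%:E)%E).
  apply: leeD; first exact: lee_wpmul2l.
  by rewrite lee_fin ler_wpM2l.
by rewrite -EFinM -EFinD lee_fin; lra.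
Qed.

(** [400 = 2 * 160 + 2 * 40]: the form of [A + K], bounded by [2 * K], contributes 160, the form
    [K |x|^2] contributes 40, and the square of a difference doubles both. [C ^+ 2] and [C] stem
    from the fourth and second moments of the square root. *)
Definition kappa : R := 400 * E * (C ^+ 2 + C).

Lemma kappa_ge0 : 0 <= kappa.
Proof.
apply: mulr_ge0; last by rewrite addr_ge0 ?sqr_ge0// ltW.
by apply: mulr_ge0; [rewrite ler0n|exact/ltW/moment_cst_gt0].
Qed.

(* x A x^T = x (A + K) x^T - K |x|^2 is a difference of two positive forms. *)
Lemma qform_variance (A : 'M[R]_n) (K : R) : 0 < K -> A^T = A -> (0 < n)%N ->
  (forall x, `|qform A x| <= K * sqnorm x) ->
  (Exp V (fun x => (qform A x - \tr A) ^+ 2)%R <= (kappa * K ^+ 2 * n%:R)%:E)%E.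
Proof.
move=> K0 AT n0 AK.
have mcst c : rmeasurable (fun _ : 'rV[R]_n => c) by exact: rmeasurable_cst.
have mv (B : 'M[R]_n) : rmeasurable (fun x => (qform B x - \tr B) ^+ 2).
  by apply: rmeasurableX; apply: rmeasurableB => //; exact: rmeasurable_qform.
pose B1 : 'M[R]_n := A + K%:M; pose B2 : 'M[R]_n := K%:M.
have v1 := @psd_qform_variance B1 (2 * K).
have v2 := @psd_qform_variance B2 K.
have {}v1 : (Exp V (fun x => (qform B1 x - \tr B1) ^+ 2)%R <=
   (160 * E * (C ^+ 2 + C) * K ^+ 2 * n%:R)%:E)%E.
  apply: le_trans (v1 _ _ _ _) _.
  - by rewrite mulr_gt0.
  - by rewrite /B1 linearD/= AT tr_scalar_mx.
  - move=> x; rewrite qformD qform_scalar; have := AK x; rewrite ler_norml; lra.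
  - move=> x; rewrite qformD qform_scalar; have := AK x; rewrite ler_norml; lra.
  rewrite lee_fin.
  (* The dimension-free term is absorbed by the factor [n >= 1]. *)
  have n1 : (C * (2 * K)) ^+ 2 * 1 <= (C * (2 * K)) ^+ 2 * n%:R.
    by rewrite ler_wpM2l ?sqr_ge0// ler1n.
  have e0 := moment_cst_gt0 R.
  have n2 : E * ((C * (2 * K)) ^+ 2 * 1) <= E * ((C * (2 * K)) ^+ 2 * n%:R).
    by rewrite ler_pM2l.
  have p1 : 0 <= E * (C * K ^+ 2 * n%:R).
    by rewrite !mulr_ge0 ?sqr_ge0// ltW.
  have p2 : 0 <= E * (C ^+ 2 * K ^+ 2 * n%:R).
    by rewrite !mulr_ge0 ?sqr_ge0// ltW.
  lra.
have {}v2 : (Exp V (fun x => (qform B2 x - \tr B2) ^+ 2)%R <=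
   (40 * E * (C ^+ 2 + C) * K ^+ 2 * n%:R)%:E)%E.
  apply: le_trans (v2 _ _ _ _) _ => //.
  - by rewrite tr_scalar_mx.
  - by move=> x; rewrite qform_scalar mulr_ge0 ?sqnorm_ge0// ltW.
  - by move=> x; rewrite qform_scalar.
  rewrite lee_fin.
  have n1 : (C * K) ^+ 2 * 1 <= (C * K) ^+ 2 * n%:R.
    by rewrite ler_wpM2l ?sqr_ge0// ler1n.
  have e0 := moment_cst_gt0 R.
  have n2 : E * ((C * K) ^+ 2 * 1) <= E * ((C * K) ^+ 2 * n%:R).
    by rewrite ler_pM2l.
  have p1 : 0 <= E * (C * K ^+ 2 * n%:R).
    by rewrite !mulr_ge0 ?sqr_ge0// ltW.
  have p2 : 0 <= E * (C ^+ 2 * K ^+ 2 * n%:R).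
    by rewrite !mulr_ge0 ?sqr_ge0// ltW.
  lra.
apply: (@le_trans _ _ (Exp V (fun x => 2 * (qform B1 x - \tr B1) ^+ 2 +
                                       2 * (qform B2 x - \tr B2) ^+ 2))).
  apply: le_Exp => //.
  - by apply: rmeasurableD; exact: rmeasurableM.
  - by move=> x; exact: sqr_ge0.
  - move=> x; rewrite /B1 qformD mxtraceD -/B2.
    have := sqr_ge0 ((qform A x + qform B2 x - (\tr A + \tr B2)) + (qform B2 x - \tr B2)).
    by rewrite !expr2; lra.
rewrite ExpD//; last 4 first.
- exact: rmeasurableM.
- exact: rmeasurableM.
- by move=> x; rewrite mulr_ge0// sqr_ge0.
- by move=> x; rewrite mulr_ge0// sqr_ge0.
rewrite !ExpZl//; try by move=> x; exact: sqr_ge0.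
apply: le_trans (leeD (lee_wpmul2l _ v1) (lee_wpmul2l _ v2)) _ => //.
by rewrite -!EFinM -EFinD lee_fin /kappa; lra.
Qed.

End QuadraticVariance.

(** * Resolvents and leave-one-out identities *)

Section ComplexModulus.
Variable R : realType.
Local Open Scope complex_scope.
Local Notation C := R[i].
Local Notation Re := complex.Re.
Local Notation Im := complex.Im.
Local Notation normc := Normc.normc.

Definition nsq (x : C) : R := Re x ^+ 2 + Im x ^+ 2.

Lemma Re_add (x y : C) : Re (x + y) = Re x + Re y. Proof. by case: x; case: y. Qed.
Lemma Im_add (x y : C) : Im (x + y) = Im x + Im y. Proof. by case: x; case: y. Qed.
Lemma Re_opp (x : C) : Re (- x) = - Re x. Proof. by case: x. Qed.
Lemma Im_opp (x : C) : Im (- x) = - Im x. Proof. by case: x. Qed.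
Lemma Re_mul (x y : C) : Re (x * y) = Re x * Re y - Im x * Im y.
Proof. by case: x; case: y. Qed.
Lemma Im_mul (x y : C) : Im (x * y) = Re x * Im y + Im x * Re y.
Proof. by case: x => a b; case: y => c d. Qed.
Lemma Re_conj (x : C) : Re (x^*) = Re x. Proof. by case: x. Qed.
Lemma Im_conj (x : C) : Im (x^*) = - Im x. Proof. by case: x. Qed.
Lemma Re_sum (I : Type) (s : seq I) (P : pred I) (f : I -> C) :
  Re (\sum_(i <- s | P i) f i) = \sum_(i <- s | P i) Re (f i).
Proof. by elim/big_rec2: _ => // i y x _ <-; rewrite Re_add. Qed.
Lemma Im_sum (I : Type) (s : seq I) (P : pred I) (f : I -> C) :
  Im (\sum_(i <- s | P i) f i) = \sum_(i <- s | P i) Im (f i).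
Proof. by elim/big_rec2: _ => // i y x _ <-; rewrite Im_add. Qed.

Lemma complex_ext (x y : C) : Re x = Re y -> Im x = Im y -> x = y.
Proof. by case: x => a b; case: y => c d /= -> ->. Qed.

Lemma nsq_ge0 (x : C) : 0 <= nsq x.
Proof. by rewrite addr_ge0 ?sqr_ge0. Qed.

Lemma nsq_eq0 (x : C) : nsq x = 0 -> x = 0.
Proof.
move/eqP; rewrite paddr_eq0 ?sqr_ge0// !sqrf_eq0 => /andP[/eqP a /eqP b].
exact: complex_ext.
Qed.

Lemma normc_sqr (x : C) : normc x ^+ 2 = nsq x.
Proof. by case: x => a b; rewrite /= sqr_sqrtr// addr_ge0 ?sqr_ge0. Qed.

Lemma normc_ge0 (x : C) : 0 <= normc x.
Proof. by case: x => a b; exact: sqrtr_ge0. Qed.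

Lemma ler_abs_of_sqr (a b : R) : 0 <= b -> a ^+ 2 <= b ^+ 2 -> `|a| <= b.
Proof. by move=> b0 ab; rewrite -(ler_pXn2r (ltn0Sn 1)) ?nnegrE// real_normK ?num_real. Qed.

Lemma normc_geRe (x : C) : `|Re x| <= normc x.
Proof.
apply: ler_abs_of_sqr; first exact: normc_ge0.
by rewrite normc_sqr lerDl sqr_ge0.
Qed.

Lemma normc_geIm (x : C) : `|Im x| <= normc x.
Proof.
apply: ler_abs_of_sqr; first exact: normc_ge0.
by rewrite normc_sqr lerDr sqr_ge0.
Qed.

Lemma normcD (x y : C) : normc (x + y) <= normc x + normc y.
Proof. exact: (le_normcD x y). Qed.

Lemma normc_opp (x : C) : normc (- x) = normc x.
Proof. by case: x => a b; rewrite /= !sqrrN. Qed.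

Lemma normc_mul (x y : C) : normc (x * y) = normc x * normc y.
Proof. exact: Normc.normcM. Qed.

Lemma normc_inv (x : C) : normc x^-1 = (normc x)^-1.
Proof. exact: Normc.normcV. Qed.

Lemma normc_eq0 (x : C) : (normc x == 0) = (x == 0).
Proof.
by apply/eqP/eqP => [/Normc.eq0_normc//|->]; exact: Normc.normc0.
Qed.

Lemma normc_sum (I : Type) (s : seq I) (P : pred I) (f : I -> C) :
  normc (\sum_(i <- s | P i) f i) <= \sum_(i <- s | P i) normc (f i).
Proof.
elim/big_rec2: _ => [|i y x _ h]; first by rewrite Normc.normc0.
by apply: le_trans (normcD _ _) _; rewrite lerD2l.
Qed.

Lemma normc_real (a : R) : normc (a%:C) = `|a|.
Proof. by rewrite /= expr0n/= addr0 sqrtr_sqr. Qed.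

End ComplexModulus.

(** * Resolvents of real symmetric matrices *)

Section Resolvent.
Variables (R : realType) (N : nat).
Local Open Scope complex_scope.
Local Notation C := R[i].
Local Notation Re := complex.Re.
Local Notation Im := complex.Im.
Local Notation normc := Normc.normc.
Implicit Types (W : 'M[R]_N) (z : C).

Definition cmx (m n : nat) (A : 'M[R]_(m, n)) : 'M[C]_(m, n) := map_mx (fun r : R => r%:C) A.

Definition shifted W z : 'M[C]_N := cmx W - z%:M.
Definition resolvent W z : 'M[C]_N := invmx (shifted W z).

(** The Hermitian form of a real symmetric matrix takes real values, so only the shift contributes.
    Invertibility and the bounds on the resolvent rest on this identity. *)
Lemma shifted_energy W z (y : 'cV[C]_N) : W^T = W ->
  Im (\sum_k (y k ord0)^* * (shifted W z *m y) k ord0) =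
  - (Im z * \sum_k nsq (y k ord0)).
Proof.
move=> WT.
have E k : (shifted W z *m y) k ord0 = \sum_l (W k l)%:C * y l ord0 - z * y k ord0.
  rewrite mulmxBl mul_scalar_mx !mxE; congr (_ - _).
  by apply: eq_bigr => l _; rewrite !mxE.
rewrite Im_sum mulr_sumr -sumrN.
have -> : \sum_k Im ((y k ord0)^* * (shifted W z *m y) k ord0) =
   \sum_k (\sum_l W k l * (Re (y k ord0) * Im (y l ord0) - Im (y k ord0) * Re (y l ord0)))
   + \sum_k - (Im z * nsq (y k ord0)).
  rewrite -big_split/=; apply: eq_bigr => k _.
  rewrite E mulrBr Im_add Im_opp mulr_sumr Im_sum; congr (_ + _).
    apply: eq_bigr => l _; rewrite !Im_mul !Re_mul Re_conj Im_conj /=; ring.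
  by rewrite Im_mul !Re_mul !Im_mul Re_conj Im_conj /nsq; ring.
rewrite [X in X + _](_ : _ = 0) ?add0r//.
set S := (X in X = 0).
(* The summand changes sign when [k] and [l] are exchanged, by symmetry of [W]. *)
have : S = - S.
  rewrite {1}/S exchange_big/= /S -sumrN; apply: eq_bigr => k _.
  rewrite -sumrN; apply: eq_bigr => l _.
  by rewrite -{1}WT mxE; ring.
by move=> h; lra.
Qed.

Lemma shifted_sym W z : W^T = W -> (shifted W z)^T = shifted W z.
Proof. by move=> WT; rewrite /shifted linearB/= tr_scalar_mx /cmx map_trmx WT. Qed.

Lemma shifted_unit W z : W^T = W -> Im z != 0 -> shifted W z \in unitmx.
Proof.
move=> WT z0; rewrite unitmxE unitfE; apply/negP => /det0P[v v0 vM].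
have Mv : shifted W z *m v^T = 0.
  by apply: trmx_inj; rewrite trmx_mul trmxK shifted_sym// vM trmx0.
have := shifted_energy z v^T WT; rewrite Mv.
rewrite big1 => [/esym/eqP|k _]; last by rewrite !mxE mulr0.
rewrite oppr_eq0 mulf_eq0 (negbTE z0)/= => /eqP S0.
move/negP: v0; apply; apply/eqP/rowP => k; rewrite [RHS]mxE.
have := psumr_eq0P (fun k _ => nsq_ge0 (v^T k ord0)) S0 (i := k) isT.
by rewrite mxE; exact: nsq_eq0.
Qed.

Section Fixed.
Variables (W : 'M[R]_N) (z : C).
Hypotheses (WT : W^T = W) (z0 : Im z != 0).
Local Notation G := (resolvent W z).
Local Notation v := (Im z).

Lemma mul_shifted_resolvent : shifted W z *m G = 1%:M.
Proof. by rewrite mulmxV// shifted_unit. Qed.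

Lemma mul_resolvent_shifted : G *m shifted W z = 1%:M.
Proof. by rewrite mulVmx// shifted_unit. Qed.

Lemma resolvent_sym : G^T = G.
Proof. by rewrite /resolvent trmx_inv shifted_sym. Qed.

Definition rquad (x : 'cV[R]_N) : C := ((cmx x)^T *m G *m cmx x) ord0 ord0.

(** [shifted_energy] at [G x], which [W - z] maps back to the real vector [x]. In particular the
    imaginary part of the form lies on the side of Im z. *)
Lemma Im_rquad (x : 'cV[R]_N) :
  Im (rquad x) = v * \sum_k nsq ((G *m cmx x) k ord0).
Proof.
have := shifted_energy z (G *m cmx x) WT.
rewrite mulmxA mul_shifted_resolvent mul1mx => /(congr1 -%R); rewrite opprK => <-.
rewrite /rquad -mulmxA mxE !Im_sum -sumrN; apply: eq_bigr => k _.
by rewrite !mxE !Im_mul Re_conj Im_conj /=; ring.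
Qed.

(** In place of an operator norm: |x^T G x| <= |x|^2 / (2 |v|) + |v| |G x|^2 / 2, and by [Im_rquad]
    the last term is at most half of the left side, which absorbs it. *)
Lemma normc_rquad (x : 'cV[R]_N) :
  normc (rquad x) <= (\sum_k x k ord0 ^+ 2) / `|v|.
Proof.
have v0 : 0 < `|v| by rewrite normr_gt0.
set S := \sum_k _.
have h1 : normc (rquad x) <= 2^-1 * (S / `|v|) + 2^-1 * (`|v| * \sum_k nsq ((G *m cmx x) k ord0)).
  rewrite {1}/rquad -mulmxA mxE; apply: le_trans (normc_sum _ _ _) _.
  rewrite /S mulr_suml [in X in _ + X]mulr_sumr !mulr_sumr -big_split/=.
  apply: ler_sum => k _; rewrite [(cmx x)^T _ _]mxE [cmx x _ _]mxE normc_mul normc_real.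
  rewrite -normc_sqr; set a := normc _.
  have := sqr_ge0 (`|x k ord0| / `|v| - a).
  move=> h; have : 0 <= `|v| * (`|x k ord0| / `|v| - a) ^+ 2 by rewrite mulr_ge0.
  rewrite -[x k ord0 ^+ 2]real_normK ?num_real//.
  have -> : `|v| * (`|x k ord0| / `|v| - a) ^+ 2 =
     `|x k ord0| ^+ 2 / `|v| - 2 * (`|x k ord0| * a) + `|v| * a ^+ 2.
    by field; rewrite gt_eqF.
  lra.
have h2 : `|v| * \sum_k nsq ((G *m cmx x) k ord0) <= normc (rquad x).
  apply: le_trans (normc_geIm _); rewrite Im_rquad normrM ler_wpM2l//.
  exact: ler_norm.
lra.
Qed.

Lemma rquad_delta (k : 'I_N) : rquad (delta_mx k ord0) = G k k.
Proof.
have E : cmx (delta_mx k ord0 : 'cV[R]_N) = delta_mx k ord0.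
  by apply/matrixP => i j; rewrite !mxE; case: (_ && _).
by rewrite /rquad E trmx_delta -rowE -colE !mxE.
Qed.

Lemma sum_sqr_delta (k : 'I_N) : \sum_l (delta_mx k ord0 : 'cV[R]_N) l ord0 ^+ 2 = 1.
Proof.
rewrite (bigD1 k)//= big1 => [|l lk]; rewrite !mxE eqxx/= ?andbT ?eqxx ?addr0 ?expr1n//.
by rewrite (negbTE lk) expr0n.
Qed.

Lemma normc_resolvent_diag (k : 'I_N) : normc (G k k) <= `|v|^-1.
Proof. by rewrite -rquad_delta; apply: le_trans (normc_rquad _) _; rewrite sum_sqr_delta mul1r. Qed.

Lemma Im_resolvent_diag (k : 'I_N) : 0 <= v * Im (G k k).
Proof.
rewrite -rquad_delta Im_rquad mulrA -expr2 mulr_ge0 ?sqr_ge0//.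
by apply: sumr_ge0 => l _; exact: nsq_ge0.
Qed.

End Fixed.

(* W0 is W with the row and column of index j erased, and y is that column. *)
Section LeaveOneOut.
Variables (W W0 : 'M[R]_N) (z : C) (j : 'I_N) (y : 'cV[R]_N).
Hypotheses (WT : W^T = W) (W0T : W0^T = W0) (z0 : Im z != 0).
Let e : 'cV[R]_N := delta_mx j ord0.
Hypothesis WE : W = W0 + e *m y^T + y *m e^T.
Hypothesis yj : y j ord0 = 0.
Hypothesis W0e : W0 *m e = 0.
Local Notation G := (resolvent W z).
Local Notation G0 := (resolvent W0 z).
Local Notation v := (Im z).
Let q := rquad W0 z y.

Let z_neq0 : z != 0.
Proof. by apply: contraNneq z0 => ->. Qed.

Let ce : cmx e = delta_mx j ord0.
Proof. by apply/matrixP => k l; rewrite !mxE; case: (_ && _). Qed.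

Let G0e : G0 *m cmx e = - z^-1 *: cmx e.
Proof.
have h : shifted W0 z *m cmx e = - z *: cmx e.
  rewrite mulmxBl mul_scalar_mx -map_mxM W0e.
  by rewrite (_ : map_mx _ 0 = 0) ?sub0r ?scaleNr//; apply/matrixP => k l; rewrite !mxE.
have := congr1 (mulmx G0) h; rewrite mulmxA mul_resolvent_shifted// mul1mx -scalemxAr => h'.
by rewrite [in RHS]h' scalerA mulNr mulrN opprK mulVf// scale1r.
Qed.

Let ety : (cmx e)^T *m cmx y = 0.
Proof. by rewrite ce trmx_delta -rowE; apply/matrixP => k l; rewrite !mxE ord1 yj. Qed.

Let etG0 : (cmx e)^T *m G0 = - z^-1 *: (cmx e)^T.
Proof. by apply: trmx_inj; rewrite trmx_mul trmxK resolvent_sym// G0e linearZ/= trmxK. Qed.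

Let etG0y : (cmx e)^T *m G0 *m cmx y = 0.
Proof. by rewrite etG0 -scalemxAl ety scaler0. Qed.

Let shiftedE : shifted W z = shifted W0 z + (cmx e *m (cmx y)^T + cmx y *m (cmx e)^T).
Proof.
rewrite /shifted addrAC WE /cmx !map_mxD !map_mxM !map_trmx.
by rewrite addrA.
Qed.

Let p := G *m cmx e.
Let s := ((cmx y)^T *m p) ord0 ord0.
Let pj := G j j.

Let pjE : ((cmx e)^T *m p) ord0 ord0 = pj.
Proof. by rewrite /p ce trmx_delta -rowE -colE !mxE. Qed.

Let mx11 (A : 'M[C]_1) : A = (A ord0 ord0)%:M.
Proof. exact: mx11_scalar. Qed.

(** [p] is column [j] of [G]. Multiplying (W - z) p = e by [G0] expresses it through [G0 e] and
    [G0 y], because [W - W0] is built from [e] and [y] alone; [G0 e] is explicit since [e] is in the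
    kernel of [W0]. *)
Let p_eq : p = (- z^-1 * (1 - s)) *: cmx e - pj *: (G0 *m cmx y).
Proof.
have h : shifted W z *m p = cmx e by rewrite /p mulmxA mul_shifted_resolvent// mul1mx.
have := congr1 (mulmx G0) h.
rewrite shiftedE mulmxDl mulmxDr mulmxA mul_resolvent_shifted// mul1mx.
rewrite mulmxDl -!mulmxA (mx11 ((cmx y)^T *m p)) (mx11 ((cmx e)^T *m p)) pjE -/s.
rewrite !mul_mx_scalar mulmxDr -!scalemxAr G0e => /eqP.
rewrite -subr_eq0 => /eqP E; apply/eqP; rewrite -subr_eq0; apply/eqP; rewrite -[RHS]E.
rewrite mulrBr mulr1 scalerBl !scalerA mulrC opprB opprD opprK.
by rewrite [s * _]mulrC; apply/matrixP => k l; rewrite !mxE; ring.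
Qed.

(** Pairing [p_eq] with [e] and with [y] gives G_jj = -(1 - s) / z and s = -G_jj q; then [s] is
    eliminated. *)
Lemma resolvent_diag_schur : G j j * (z + q) = -1.
Proof.
have h1 : pj = - z^-1 * (1 - s).
  rewrite -[LHS]pjE p_eq mulmxBr -!scalemxAr mulmxA etG0y scaler0 subr0 mxE.
  by rewrite ce trmx_delta -rowE !mxE !eqxx mulr1.
have h2 : s = - (pj * q).
  rewrite {1}/s p_eq mulmxBr -!scalemxAr.
  have -> : (cmx y)^T *m cmx e = 0 by apply: trmx_inj; rewrite trmx_mul trmxK ety trmx0.
  by rewrite scaler0 sub0r [LHS]mxE [X in - X]mxE mulmxA.
have : z * pj = -1 * (1 - s) by rewrite {1}h1 mulrA mulrN mulfV.
rewrite h2 opprK => E1.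
by rewrite -/pj mulrDr [pj * z]mulrC E1; ring.
Qed.

(** Im z and Im q do not have opposite signs, so |Im (z + q)| dominates each of them. *)
Lemma leave_one_out_modulus : `|v| <= normc (z + q) /\ `|Im q| <= normc (z + q).
Proof.
have vI : v * Im q = v ^+ 2 * \sum_k nsq ((G0 *m cmx y) k ord0).
  by rewrite /q Im_rquad// expr2 mulrA.
have S0 : 0 <= v * Im q.
  by rewrite vI mulr_ge0 ?sqr_ge0// sumr_ge0// => k _; exact: nsq_ge0.
have h : Im (z + q) ^+ 2 = v ^+ 2 + 2 * (v * Im q) + Im q ^+ 2 by rewrite Im_add; ring.
have b (a : R) : a ^+ 2 <= Im (z + q) ^+ 2 -> `|a| <= normc (z + q).
  move=> ha; apply: le_trans (normc_geIm _); apply: ler_abs_of_sqr => //.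
  by rewrite real_normK ?num_real.
split; apply: b; rewrite h.
- have := sqr_ge0 (Im q); lra.
- have := sqr_ge0 v; lra.
Qed.

(** The difference equals 1/z + G_jj + G_jj w^T w with w = G0 y, and each term is at most 1/|v|. For
    the last, |w|^2 = |Im q| / |v| <= |z + q| / |v| while G_jj (z + q) = -1; this is why the size of
    [y] does not appear. *)
Lemma resolvent_trace_diff : normc (\tr G - \tr G0) <= 3 / `|v|.
Proof.
have v0 : 0 < `|v| by rewrite normr_gt0.
pose w := G0 *m cmx y.
have E : \tr G - \tr G0 = z^-1 + pj + pj * (w^T *m w) ord0 ord0.
  have hG : G - G0 = - (G0 *m (cmx e *m (cmx y)^T + cmx y *m (cmx e)^T) *m G).
    have -> : cmx e *m (cmx y)^T + cmx y *m (cmx e)^T = shifted W z - shifted W0 z.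
      by rewrite shiftedE [RHS]addrAC subrr add0r.
    rewrite mulmxBr mulmxBl mul_resolvent_shifted// mul1mx -mulmxA.
    by rewrite mul_shifted_resolvent// mulmx1 opprB.
  have tr11 (A : 'M[C]_1) : \tr A = A ord0 ord0 by rewrite {1}(mx11 A) mxtrace_scalar mulr1n.
  have T1 : \tr (G0 *m (cmx e *m (cmx y)^T) *m G) = - z^-1 * s.
    rewrite mulmxA G0e -!scalemxAl linearZ/=; congr (_ * _).
    by rewrite -mulmxA mxtrace_mulC -mulmxA tr11.
  have T2 : \tr (G0 *m (cmx y *m (cmx e)^T) *m G) = - (pj * (w^T *m w) ord0 ord0).
    rewrite mulmxA -/w -mulmxA mxtrace_mulC tr11.
    have -> : (cmx e)^T *m G = p^T by rewrite /p trmx_mul resolvent_sym.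
    have -> : p^T = (- z^-1 * (1 - s)) *: (cmx e)^T - pj *: w^T.
      by rewrite {1}p_eq; apply/matrixP => k l; rewrite !mxE.
    rewrite mulmxBl -!scalemxAl.
    have -> : (cmx e)^T *m w = 0 by rewrite /w mulmxA etG0y.
    by rewrite scaler0 sub0r [LHS]mxE [X in - X]mxE.
  have sE : s = 1 + z * pj.
    have h1 : pj = - z^-1 * (1 - s).
      rewrite -[LHS]pjE p_eq mulmxBr -!scalemxAr mulmxA etG0y scaler0 subr0 mxE.
      by rewrite ce trmx_delta -rowE !mxE !eqxx mulr1.
    by rewrite {1}h1 mulrA mulrN mulfV// mulN1r opprB addrCA subrr addr0.
  rewrite -linearB/= hG linearN/= mulmxDr mulmxDl linearD/= T1 T2 sE.
  by field.
rewrite E; apply: le_trans (normcD _ _) _.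
have z1 : normc z^-1 <= `|v|^-1.
  rewrite normc_inv lef_pV2 ?posrE//; first exact: normc_geIm.
  by apply: lt_le_trans v0 _; exact: normc_geIm.
have z2 : normc pj <= `|v|^-1 by exact: normc_resolvent_diag.
have z3 : normc (pj * (w^T *m w) ord0 ord0) <= `|v|^-1.
  have hw : normc ((w^T *m w) ord0 ord0) <= `|Im q| / `|v|.
    rewrite ler_pdivlMr// /q Im_rquad// normrM mulrC ler_wpM2l//.
    apply: le_trans (ler_norm _); rewrite mxE; apply: le_trans (normc_sum _ _ _) _.
    by apply: ler_sum => k _; rewrite mxE normc_mul -expr2 normc_sqr.
  rewrite normc_mul; apply: (@le_trans _ _ (normc pj * (normc (z + q) / `|v|))).
    rewrite ler_wpM2l ?normc_ge0//; apply: le_trans hw _.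
    by rewrite ler_pM2r ?invr_gt0//; exact: leave_one_out_modulus.2.
  rewrite mulrA -normc_mul resolvent_diag_schur normc_opp.
  by rewrite Normc.normc1 mul1r.
have := normcD z^-1 pj.
set a := normc _; set b := normc z^-1 in z1 *; set c := normc pj in z2 *.
rewrite -/b -/c; set i := `|v|^-1 in z1 z2 z3 *.
move: z3; set d := normc _; lra.
Qed.

End LeaveOneOut.

End Resolvent.

(** * The block structure of the bipartite matrix *)

Section BlockResolvent.
Variables (R : realType) (n m : nat).
Local Open Scope complex_scope.
Local Notation C := R[i].
Local Notation Re := complex.Re.
Local Notation Im := complex.Im.
Local Notation normc := Normc.normc.
Implicit Types (Y : 'M[R]_(n, m)) (z : C).

Definition zero_col (j : 'I_m) Y : 'M[R]_(n, m) :=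
  \matrix_(i, k) (if k == j then 0 else Y i k).

Lemma Wmx_sym Y : (Wmx Y)^T = Wmx Y.
Proof. by rewrite /Wmx tr_block_mx trmxK !trmx0. Qed.

Definition col_vec (j : 'I_m) Y : 'cV[R]_(m + n) := col_mx 0 (col j Y).

Lemma Wmx_zero_col (j : 'I_m) Y :
  let e : 'cV[R]_(m + n) := delta_mx (lshift n j) ord0 in
  Wmx Y = Wmx (zero_col j Y) + e *m (col_vec j Y)^T + col_vec j Y *m e^T.
Proof.
move=> e.
have -> : e = col_mx (delta_mx j ord0) 0.
  apply/matrixP => i k; rewrite !mxE; case: splitP => l il; rewrite !mxE -(inj_eq val_inj)/= il//.
  by rewrite gtn_eqF// (leq_trans (ltn_ord j)) ?leq_addr.
rewrite /col_vec !tr_col_mx !mul_col_row /Wmx !trmx0 !mul0mx !mulmx0 !add_block_mx.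
rewrite ?addr0 ?add0r; congr block_mx.
- apply/matrixP => i k; rewrite !mxE big_ord1 !mxE.
  by case: eqP => [->|]; rewrite ?eqxx/= ?mul1r ?add0r// mul0r addr0.
- apply/matrixP => i k; rewrite !mxE big_ord1 !mxE.
  by case: eqP => [->|]; rewrite ?eqxx/= ?mulr1 ?add0r// mulr0 addr0.
Qed.

Lemma Wmx_zero_col_delta (j : 'I_m) Y :
  Wmx (zero_col j Y) *m (delta_mx (lshift n j) ord0 : 'cV[R]_(m + n)) = 0.
Proof.
rewrite -colE; apply/matrixP => i k; rewrite !mxE.
case: splitP => l il; rewrite mxE; case: splitP => l' /= il'; rewrite !mxE//.
  by have := ltn_ord j; rewrite il' ltnNge leq_addr.
by rewrite (ord_inj il') eqxx.
Qed.

Lemma col_vec_lshift (j : 'I_m) Y : col_vec j Y (lshift n j) ord0 = 0.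
Proof. by rewrite col_mxEu mxE. Qed.

(** Traces of the two diagonal blocks of (W - z) G = 1. The contributions Y^T G21 and Y G12 have the
    same trace because [G] is symmetric. *)
Lemma resolvent_block_trace Y z : Im z != 0 ->
  let G := resolvent (Wmx Y) z in
  m%:R + z * \tr (ulsubmx G) = n%:R + z * \tr (drsubmx G).
Proof.
move=> z0 G.
have GT : G^T = G by rewrite resolvent_sym// Wmx_sym.
have E : shifted (Wmx Y) z = block_mx (- z%:M) (cmx Y^T) (cmx Y) (- z%:M).
  rewrite /shifted /cmx /Wmx map_block_mx !map_mx0 (scalar_mx_block m n) opp_block_mx.
  by rewrite add_block_mx !sub0r !oppr0 !addr0.
have := mul_shifted_resolvent (Wmx_sym Y) z0.
rewrite E -/G -{1}(submxK G) mulmx_block (scalar_mx_block m n) => /eq_block_mx[h11 _ _ h22].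
have t1 := congr1 mxtrace h11; have t2 := congr1 mxtrace h22.
move: t1 t2; rewrite !mxtraceD !mxtrace_scalar !mulNmx !mul_scalar_mx !linearN/= !linearZ/=.
have -> : \tr (cmx Y *m ursubmx G) = \tr (cmx Y^T *m dlsubmx G).
  rewrite -mxtrace_tr trmx_mul trmx_ursub GT mxtrace_mulC; congr (\tr (_ *m _)).
  by rewrite /cmx map_trmx.
move=> t1 t2; rewrite -t1 -t2 ![_ *: - _]mulrN; ring.
Qed.

Lemma mxtrace_ul_dr (G : 'M[C]_(m + n)) : \tr G = \tr (ulsubmx G) + \tr (drsubmx G).
Proof. by rewrite -{1}(submxK G) mxtrace_block. Qed.

Lemma resolvent_trace Y z : Im z != 0 ->
  let G := resolvent (Wmx Y) z in
  \tr G = 2 * \tr (drsubmx G) + (n%:R - m%:R) / z.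
Proof.
move=> z0 G; have zn0 : z != 0 by apply: contraNneq z0 => ->.
have h := resolvent_block_trace Y z0.
have h' : \tr (ulsubmx G) = \tr (drsubmx G) + (n%:R - m%:R) / z.
  apply: (mulfI zn0); rewrite mulrDr mulrCA mulfV// mulr1.
  by apply: (@addrI _ m%:R); rewrite h -/G; ring.
by rewrite mxtrace_ul_dr h'; ring.
Qed.

Lemma normc_nat (k : nat) : normc (k%:R : C) = k%:R.
Proof. by rewrite -(rmorph_nat (real_complex R)) normc_real normr_nat. Qed.

(** By [resolvent_trace] the full trace varies twice as much as the lower right one, which turns 3
    into [3 / 2]. *)
Lemma dr_trace_diff (j : 'I_m) Y z : Im z != 0 ->
  normc (\tr (drsubmx (resolvent (Wmx Y) z)) -
         \tr (drsubmx (resolvent (Wmx (zero_col j Y)) z))) <= 3 / 2 / `|Im z|.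
Proof.
move=> z0.
have := resolvent_trace_diff (Wmx_sym Y) (Wmx_sym (zero_col j Y)) z0 (Wmx_zero_col j Y)
  (col_vec_lshift j Y) (Wmx_zero_col_delta j Y).
rewrite !resolvent_trace//.
set a := \tr _; set b := \tr _; set d := _ / z.
rewrite (_ : _ - _ = 2 * (a - b)); last by ring.
rewrite normc_mul (normc_nat 2); lra.
Qed.

Lemma sum_resolvent_diag (G : 'M[C]_(m + n)) :
  \tr (ulsubmx G) = \sum_j G (lshift n j) (lshift n j).
Proof. by apply: eq_bigr => j _; rewrite !mxE. Qed.

Lemma normc_dr_trace Y z : Im z != 0 ->
  normc (\tr (drsubmx (resolvent (Wmx Y) z))) <= n%:R / `|Im z|.
Proof.
move=> z0; apply: le_trans (normc_sum _ _ _) _.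
apply: (@le_trans _ _ (\sum_(i < n) `|Im z|^-1)); last first.
  by rewrite sumr_const card_ord mulr_natl.
by apply: ler_sum => i _; rewrite !mxE; apply: normc_resolvent_diag; rewrite ?Wmx_sym.
Qed.

Lemma Im_dr_trace Y z : Im z != 0 ->
  0 <= Im z * Im (\tr (drsubmx (resolvent (Wmx Y) z))).
Proof.
move=> z0; rewrite /mxtrace Im_sum mulr_sumr; apply: sumr_ge0 => i _.
by rewrite !mxE; apply: Im_resolvent_diag; rewrite ?Wmx_sym.
Qed.

Definition real_part (k : nat) (A : 'M[C]_k) : 'M[R]_k := map_mx (@complex.Re R) A.
Definition imag_part (k : nat) (A : 'M[C]_k) : 'M[R]_k := map_mx (@complex.Im R) A.

(** As [x] is real, the complex form splits into two real quadratic forms, to which the variance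
    bound applies separately. *)
Lemma rquad_dr (W : 'M[R]_(m + n)) z (x : 'cV[R]_n) :
  let G := drsubmx (resolvent W z) in
  rquad W z (col_mx 0 x) = (qform (real_part G) x^T) +i* (qform (imag_part G) x^T).
Proof.
move=> G.
have -> : rquad W z (col_mx 0 x) = ((cmx x)^T *m G *m cmx x) ord0 ord0.
  rewrite /rquad /cmx map_col_mx map_mx0 tr_col_mx trmx0.
  rewrite -[resolvent W z]submxK mul_row_block !mul0mx !add0r mul_row_col mulmx0 add0r.
  by rewrite -/G.
have -> : ((cmx x)^T *m G *m cmx x) ord0 ord0 =
    \sum_i \sum_j G i j * ((x i ord0 * x j ord0)%:C).
  rewrite mxE exchange_big/=; apply: eq_bigr => j _.
  rewrite mxE big_distrl/=; apply: eq_bigr => i _.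
  by rewrite !mxE rmorphM/= mulrAC mulrC.
rewrite /qform !bformE; apply: complex_ext.
  rewrite Re_sum; apply: eq_bigr => i _; rewrite Re_sum; apply: eq_bigr => j _.
  by rewrite Re_mul/= mulr0 subr0 [real_part _ _ _]mxE !mxE.
rewrite Im_sum; apply: eq_bigr => i _; rewrite Im_sum; apply: eq_bigr => j _.
by rewrite Im_mul/= mulr0 add0r [imag_part _ _ _]mxE !mxE.
Qed.

Lemma real_part_sym (k : nat) (A : 'M[C]_k) : A^T = A -> (real_part A)^T = real_part A.
Proof. by move=> AT; rewrite /real_part map_trmx AT. Qed.

Lemma imag_part_sym (k : nat) (A : 'M[C]_k) : A^T = A -> (imag_part A)^T = imag_part A.
Proof. by move=> AT; rewrite /imag_part map_trmx AT. Qed.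

Lemma mxtrace_parts (k : nat) (A : 'M[C]_k) :
  \tr A = \tr (real_part A) +i* \tr (imag_part A).
Proof.
apply: complex_ext; rewrite /mxtrace ?Re_sum ?Im_sum; apply: eq_bigr => i _; by rewrite mxE.
Qed.

Lemma qform_resolvent_bound (W : 'M[R]_(m + n)) z (x : 'rV[R]_n) : W^T = W -> Im z != 0 ->
  let G := drsubmx (resolvent W z) in
  `|qform (real_part G) x| <= `|Im z|^-1 * sqnorm x /\
  `|qform (imag_part G) x| <= `|Im z|^-1 * sqnorm x.
Proof.
move=> WT z0 G.
have H := normc_rquad WT z0 (col_mx (0 : 'cV[R]_m) x^T).
have S : \sum_k (col_mx (0 : 'cV[R]_m) x^T) k ord0 ^+ 2 = sqnorm x.
  rewrite big_split_ord/= big1 ?add0r => [|i _]; last by rewrite col_mxEu mxE expr0n.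
  by apply: eq_bigr => i _; rewrite col_mxEd mxE.
rewrite S rquad_dr trmxK mulrC in H.
split; apply: le_trans H; first exact: (normc_geRe (_ +i* _)).
exact: (normc_geIm (_ +i* _)).
Qed.

Lemma dr_resolvent_sym (W : 'M[R]_(m + n)) z : W^T = W ->
  (drsubmx (resolvent W z))^T = drsubmx (resolvent W z).
Proof. by move=> WT; rewrite trmx_drsub resolvent_sym. Qed.

End BlockResolvent.

(** * The self-consistent equation *)

Section LimitRoots.
Variable R : realType.
Local Open Scope complex_scope.
Local Notation C := R[i].
Local Notation Re := complex.Re.
Local Notation Im := complex.Im.
Local Notation normc := Normc.normc.

(** Inversion exchanges the two half planes; the weight [nsq p] avoids a division. *)
Lemma Im_inverse_sign (p q : C) : p * q = 1 -> nsq p * Im q = - Im p.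
Proof.
move=> pq; have := congr1 (@complex.Re R) pq; have := congr1 (@complex.Im R) pq.
rewrite Re_mul Im_mul /nsq /= => h1 h2.
have -> : (Re p ^+ 2 + Im p ^+ 2) * Im q =
  Re p * (Re p * Im q + Im p * Re q) - Im p * (Re p * Re q - Im p * Im q) by ring.
by rewrite h1 h2 mulr0 mulr1 sub0r.
Qed.

Lemma nsq_gt0 (z : C) : z != 0 -> 0 < nsq z.
Proof.
by move=> z0; rewrite lt_neqAle nsq_ge0 andbT eq_sym; apply: contra z0 => /eqP/nsq_eq0/eqP.
Qed.

Lemma Im_inv (z : C) : z != 0 -> Im z^-1 = - (Im z / nsq z).
Proof.
move=> z0; have zz : z * z^-1 = 1 by rewrite mulfV.
have := Im_inverse_sign zz => h; have nz := nsq_gt0 z0.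
by apply: (mulfI (lt0r_neq0 nz)); rewrite h; field; rewrite gt_eqF.
Qed.

(* s_lim is an affine image of one root of z x^2 + (z^2 + 1 - c) x + z; the other
   root lies in the opposite half plane, at distance at least |Im z| from the axis. *)
Lemma s_lim_roots (c : R) (z : C) : 1 <= c -> Im z != 0 ->
  exists x y : C,
    [/\ s_lim c z = (1 + c%:C)^-1 * (2 * x - (c%:C - 1) / z),
        x * y = 1, x + y = - (z ^+ 2 + 1 - c%:C) / z &
        Im z * Im y <= - Im z ^+ 2].
Proof.
move=> c1 v0; have z0 : z != 0 by apply: contraNneq v0 => ->.
rewrite /s_lim; set D := _ ^+ 2 - _; set w := sqrtc D.
have wD : w ^+ 2 = D by exact: sqr_sqrtc.
pose P := (- (z ^+ 2 + 1 - c%:C) + w) / (2 * z).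
pose Q := (- (z ^+ 2 + 1 - c%:C) - w) / (2 * z).
have PQ1 : P * Q = 1.
  rewrite /P /Q mulf_div.
  have -> : (- (z ^+ 2 + 1 - c%:C) + w) * (- (z ^+ 2 + 1 - c%:C) - w) =
    (z ^+ 2 + 1 - c%:C) ^+ 2 - w ^+ 2 by ring.
  by rewrite wD /D; field.
have PQs : P + Q = - (z ^+ 2 + 1 - c%:C) / z by rewrite /P /Q; field.
have aE : - (1 + c%:C)^-1 * (z - w / z) = (1 + c%:C)^-1 * (2 * P - (c%:C - 1) / z).
  by rewrite mulNr -mulrN; congr (_ * _); rewrite /P; field.
have bE : - (1 + c%:C)^-1 * (z + w / z) = (1 + c%:C)^-1 * (2 * Q - (c%:C - 1) / z).
  by rewrite mulNr -mulrN; congr (_ * _); rewrite /Q; field.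
(* [v * Im (P + Q)] is [- (v ^+ 2 + k)] and [v * Im (P - Q)] is [v * o]; [k] is nonnegative because
   [1 <= c]. *)
pose o := Im (w / z); pose v := Im z; pose k := (c - 1) * v ^+ 2 / nsq z.
have v2 : 0 < v ^+ 2 by rewrite exprn_even_gt0.
have k0 : 0 <= k by rewrite divr_ge0 ?nsq_ge0// mulr_ge0 ?subr_ge0// ltW.
have half (x : C) : Im (x / 2) = Im x / 2.
  have -> : x / 2 = x * (2^-1)%:C by rewrite fmorphV/= (rmorph_nat (real_complex R)).
  by rewrite Im_mul/= mulr0 add0r.
have czE : Im ((c%:C - 1) / z) = - ((c - 1) * (v / nsq z)).
  have -> : c%:C - 1 = (c - 1)%:C by rewrite rmorphB/= rmorph1.
  by rewrite Im_mul/= mul0r addr0 Im_inv// mulrN.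
have vP : v * Im P = - (v ^+ 2 + k) / 2 + v * o / 2.
  have -> : P = ((c%:C - 1) / z - z + w / z) / 2 by rewrite /P; field.
  rewrite half !Im_add Im_opp czE -/o -/v /k; field.
  by rewrite gt_eqF// nsq_gt0.
have vQ : v * Im Q = - (v ^+ 2 + k) / 2 - v * o / 2.
  have -> : Q = ((c%:C - 1) / z - z - w / z) / 2 by rewrite /Q; field.
  rewrite half !Im_add !Im_opp czE -/o -/v /k; field.
  by rewrite gt_eqF// nsq_gt0.
have c0 : 0 < (1 + c)^-1 by rewrite invr_gt0; lra.
have aI : Im (- (1 + c%:C)^-1 * (z - w / z)) = (1 + c)^-1 * (o - v).
  have -> : - (1 + c%:C)^-1 * (z - w / z) = ((1 + c)^-1)%:C * (w / z - z).
    by rewrite fmorphV/= rmorphD/= rmorph1 mulNr -mulrN opprB.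
  by rewrite Im_mul/= mul0r addr0 Im_add Im_opp.
(* The branch test of [s_lim] amounts to [v * o > v ^+ 2], and then [vQ] bounds [Q] at once. *)
case: ifPn => [|]; rewrite aI -/v -mulrA pmulr_rgt0// [(o - v) * v]mulrBl => h.
- exists P, Q; split => //; rewrite vQ; rewrite -expr2 in h; lra.
- exists Q, P; split => //; first by rewrite mulrC.
    by rewrite addrC.
  (* Now [v * Im P <= 0], so its inverse [Q] satisfies [v * Im Q >= 0]. By [vQ] this forces
     [v * o <= - (v ^+ 2 + k)], and [P] is the far root. *)
  rewrite -leNgt -expr2 in h; rewrite vP.
  have hP : v * Im P <= 0 by rewrite vP; lra.
  have : nsq P * (v * Im Q) = - (v * Im P) by rewrite mulrCA Im_inverse_sign// mulrN.
  have P0 : P != 0 by apply: contra_eq_neq PQ1 => ->; rewrite mul0r eq_sym oner_eq0.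
  move=> E; have : 0 <= nsq P * (v * Im Q) by rewrite E; lra.
  rewrite pmulr_rge0 ?nsq_gt0// vQ; lra.
Qed.

Lemma normc_gap (v : R) (x y : C) : v != 0 -> 0 <= v * Im x -> v * Im y <= - v ^+ 2 ->
  `|v| <= normc (x - y).
Proof.
move=> v0 hx hy; apply: le_trans (normc_geIm _).
have v0' : 0 < `|v| by rewrite normr_gt0.
rewrite -(ler_pM2l v0') -!normrM -expr2 ger0_norm ?sqr_ge0//.
by apply: le_trans (ler_norm _); rewrite Im_add Im_opp; lra.
Qed.

Lemma sqr_sum_le (I : finType) (a : I -> R) :
  (\sum_i a i) ^+ 2 <= #|I|%:R * \sum_i a i ^+ 2.
Proof.
rewrite expr2 big_distrlr/=.
apply: (@le_trans _ _ (\sum_i \sum_j (a i ^+ 2 + a j ^+ 2) / 2)).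
  apply: ler_sum => i _; apply: ler_sum => j _.
  by have := sqr_ge0 (a i - a j); rewrite !expr2; lra.
rewrite le_eqVlt; apply/orP; left; apply/eqP.
set S := (X in _ = _ * X).
have E i : \sum_j (a i ^+ 2 + a j ^+ 2) / 2 = (#|I|%:R * a i ^+ 2 + S) / 2.
  by rewrite -mulr_suml big_split/= sumr_const mulr_natl.
under eq_bigr => i _ do rewrite E.
by rewrite -mulr_suml big_split/= -mulr_sumr -/S sumr_const -[S *+ _]mulr_natl; field.
Qed.

End LimitRoots.

(** * The perturbed quadratic equation for the normalised trace *)

Section SelfConsistency.
Variables (R : realType) (n m : nat).
Local Open Scope complex_scope.
Local Notation C := R[i].
Local Notation Re := complex.Re.
Local Notation Im := complex.Im.
Local Notation normc := Normc.normc.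
Variables (Y : 'M[R]_(n, m)) (z : C).
Hypothesis z0 : Im z != 0.
Hypothesis n0 : (0 < n)%N.

Definition loo_resolvent (j : 'I_m) : 'M[C]_n := drsubmx (resolvent (Wmx (zero_col j Y)) z).
Definition loo_quad (j : 'I_m) : C := rquad (Wmx (zero_col j Y)) z (col_vec j Y).
Definition loo_dev (j : 'I_m) : C := loo_quad j - n%:R^-1 * \tr (loo_resolvent j).

Local Notation G := (resolvent (Wmx Y) z).
Let g : C := n%:R^-1 * \tr (drsubmx G).
Let p j := G (lshift n j) (lshift n j).

Let nC : (n%:R : C) != 0.
Proof. by rewrite pnatr_eq0 -lt0n. Qed.

Let nR : 0 < n%:R :> R.
Proof. by rewrite ltr0n. Qed.

(** An exact identity: p_j (z + q_j) = -1 turns the sum of p_j (g - q_j) into (z + g) times the sum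
    of p_j, plus m, and the block trace identity removes the sum of p_j. The last term measures how
    far [m] is from [c * n]. *)
Lemma self_consistent (c : R) :
  n%:R * (z * g ^+ 2 + (z ^+ 2 + 1 - c%:C) * g + z) =
  z * \sum_j p j * (g - loo_quad j) + (m%:R - n%:R * c%:C) * g.
Proof.
have tE := resolvent_block_trace Y z0; cbv zeta in tE; rewrite sum_resolvent_diag in tE.
have gE : \tr (drsubmx G) = n%:R * g by rewrite /g mulrA mulfV// mul1r.
rewrite gE in tE.
have S : \sum_j p j * (g - loo_quad j) = (z + g) * (\sum_j p j) + m%:R.
  rewrite mulr_sumr -[m in m%:R]card_ord -sumr_const -big_split/=.
  apply: eq_bigr => j _.
  have := resolvent_diag_schur (Wmx_sym Y) (Wmx_sym (zero_col j Y)) z0 (Wmx_zero_col j Y)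
    (col_vec_lshift j Y) (Wmx_zero_col_delta j Y).
  rewrite -/(loo_quad j) -/(p j) => E.
  have -> : 1 = - (p j * (z + loo_quad j)) by rewrite E opprK.
  ring.
rewrite S.
have -> : z * ((z + g) * (\sum_j p j) + m%:R) = (z + g) * (m%:R + z * \sum_j p j) - g * m%:R.
  by ring.
rewrite tE; ring.
Qed.

Let v := `|Im z|.
Let v0 : 0 < v. Proof. by rewrite normr_gt0. Qed.

Lemma normc_g : normc g <= v^-1.
Proof.
rewrite /g normc_mul normc_inv normc_nat mulrC ler_pdivrMr//.
by apply: le_trans (normc_dr_trace _ _) _ => //; rewrite mulrC.
Qed.

Lemma loo_dist (j : 'I_m) :
  normc (g - loo_quad j) <= normc (loo_dev j) + 3 / 2 / v / n%:R.
Proof.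
have -> : g - loo_quad j = - loo_dev j +
   n%:R^-1 * (\tr (drsubmx G) - \tr (loo_resolvent j)).
  by rewrite /g /loo_dev; ring.
apply: le_trans (normcD _ _) _; rewrite normc_opp lerD2l normc_mul normc_inv normc_nat.
by rewrite mulrC ler_pM2r ?invr_gt0//; exact: dr_trace_diff.
Qed.

(** The polynomial factors as z (g - x) (g - y). One factor [v^-1] comes from the bound on p_j,
    another from |g - y| >= v; |z| cancels in the main term, and |z| >= v treats the term in [K]. *)
Lemma distance_to_root (c K : R) (x y : C) :
  x * y = 1 -> x + y = - (z ^+ 2 + 1 - c%:C) / z -> Im z * Im y <= - Im z ^+ 2 ->
  `|c * n%:R - m%:R| <= K ->
  n%:R * normc (g - x) <=
    v^-1 ^+ 2 * ((\sum_j normc (loo_dev j)) + (3 / 2 * (m%:R / n%:R) + K) * v^-1).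
Proof.
move=> xy xpy yI cK.
have zn0 : z != 0 by apply: contraNneq z0 => ->.
have fact : z * g ^+ 2 + (z ^+ 2 + 1 - c%:C) * g + z = z * ((g - x) * (g - y)).
  have -> : z ^+ 2 + 1 - c%:C = - (z * (x + y)).
    by rewrite xpy; field.
  have -> : z * ((g - x) * (g - y)) = z * g ^+ 2 - z * (x + y) * g + z * (x * y) by ring.
  by rewrite xy; ring.
have E := self_consistent c; rewrite fact in E.
have gy : v <= normc (g - y).
  apply: normc_gap => //; rewrite /g.
  have -> : Im (n%:R^-1 * \tr (drsubmx G)) = n%:R^-1 * Im (\tr (drsubmx G)).
    have -> : (n%:R^-1 : C) = (n%:R^-1)%:C by rewrite fmorphV/= (rmorph_nat (real_complex R)).
    by rewrite Im_mul/= mul0r addr0.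
  rewrite mulrCA mulr_ge0 ?invr_ge0//; exact: Im_dr_trace.
have zv : v <= normc z by exact: normc_geIm.
have zp : 0 < normc z by exact: lt_le_trans zv.
have S0 : 0 <= K by exact: le_trans cK.
have up : normc (n%:R * (z * ((g - x) * (g - y)))) <=
   normc z * (v^-1 * \sum_j normc (g - loo_quad j)) + K * v^-1.
  rewrite E; apply: le_trans (normcD _ _) _; apply: lerD.
    rewrite normc_mul ler_wpM2l ?normc_ge0//.
    apply: le_trans (normc_sum _ _ _) _; rewrite mulr_sumr; apply: ler_sum => j _.
    rewrite normc_mul ler_wpM2r ?normc_ge0//.
    by apply: normc_resolvent_diag => //; exact: Wmx_sym.
  rewrite normc_mul; apply: ler_pM; rewrite ?normc_ge0//; last exact: normc_g.
  have -> : (m%:R - n%:R * c%:C : C) = (m%:R - n%:R * c)%:C.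
    by rewrite rmorphB rmorphM/= !(rmorph_nat (real_complex R)).
  by rewrite normc_real distrC mulrC.
rewrite !normc_mul normc_nat in up.
have lo : n%:R * (normc z * (normc (g - x) * v)) <=
          n%:R * (normc z * (normc (g - x) * normc (g - y))).
  by rewrite ler_pM2l// ler_pM2l// ler_wpM2l// normc_ge0.
have {up lo} up := le_trans lo up.
have sumle : \sum_j normc (g - loo_quad j) <=
   \sum_j normc (loo_dev j) + 3 / 2 * (m%:R / n%:R) * v^-1.
  apply: (@le_trans _ _ (\sum_j (normc (loo_dev j) + 3 / 2 / v / n%:R))).
    by apply: ler_sum => j _; exact: loo_dist.
  rewrite big_split/= lerD2l sumr_const card_ord -[X in X <= _]mulr_natl.
  by rewrite le_eqVlt; apply/orP; left; apply/eqP; field; rewrite !gt_eqF.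
have h1 : n%:R * normc (g - x) * v <=
   v^-1 * (\sum_j normc (g - loo_quad j)) + K * v^-1 * v^-1.
  rewrite -(ler_pM2l zp) mulrDr.
  apply: le_trans (_ : _ <= normc z * (v^-1 * \sum_j normc (g - loo_quad j)) + K * v^-1) _.
    by apply: le_trans up; rewrite le_eqVlt; apply/orP; left; apply/eqP; ring.
  rewrite lerD2l mulrCA ler_peMr//.
    by rewrite mulr_ge0// invr_ge0 ltW.
  by rewrite ler_pdivlMr ?mul1r.
have vi : 0 < v^-1 by rewrite invr_gt0.
rewrite -(ler_pM2r v0); apply: le_trans h1 _.
have -> : v^-1 ^+ 2 * (\sum_j normc (loo_dev j) + (3 / 2 * (m%:R / n%:R) + K) * v^-1) * v =
  v^-1 * (\sum_j normc (loo_dev j) + 3 / 2 * (m%:R / n%:R) * v^-1) + K * v^-1 * v^-1.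
  by field; rewrite !gt_eqF.
by rewrite lerD2r ler_pM2l.
Qed.

End SelfConsistency.

(** * Deterministic error bounds *)

Section ErrorBound.
Variables (R : realType) (n m : nat).
Local Open Scope complex_scope.
Local Notation C := R[i].
Local Notation Re := complex.Re.
Local Notation Im := complex.Im.
Local Notation normc := Normc.normc.

(** [snm] and [s_lim] are the same affine expressions in [g] and [x], with weights n / (n + m) and 1
    / (1 + c) whose difference [d] is at most K / n. The constant [3 * c + 9 * K] is twice
    [3 / 2 * c + 5 / 2 * K], which uses m / n <= c + K, plus [4 * K] from the two terms in [d]. *)
Lemma snm_dist_le (Xs : 'M[R]_(n, m)) (z : C) (c K eta : R) :
  (0 < n)%N -> 1 <= c -> 0 < eta <= 1 -> eta <= `|Im z| -> `|c * n%:R - m%:R| <= K ->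
  normc (snm Xs z - s_lim c z) <=
    2 * eta^-1 ^+ 2 / n%:R * (\sum_j normc (loo_dev (Ymx Xs) z j)) +
    (3 * c + 9 * K) * eta^-1 ^+ 3 / n%:R.
Proof.
move=> n0 c1 /andP[e0 e1] ev cK.
have v0' : 0 < `|Im z| by exact: lt_le_trans ev.
have z0 : Im z != 0 by rewrite -normr_gt0.
have zn0 : z != 0 by apply: contraNneq z0 => ->.
have nR : 0 < n%:R :> R by rewrite ltr0n.
have K0 : 0 <= K by exact: le_trans cK.
have [x [y [sE xy xpy yI]]] := s_lim_roots c1 z0.
set Y := Ymx Xs.
have D := @distance_to_root R n m Y z z0 n0 c K x y xy xpy yI cK.
set g := n%:R^-1 * _ in D; set S := \sum_j _ in D *.
have S0 : 0 <= S by apply: sumr_ge0 => j _; exact: normc_ge0.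
pose i := eta^-1.
have i0 : 0 < i by rewrite invr_gt0.
have i1 : 1 <= i by rewrite invf_ge1.
have vi : `|Im z|^-1 <= i by rewrite lef_pV2 ?posrE.
have vi0 : 0 < `|Im z|^-1 by rewrite invr_gt0.
have mn : m%:R / n%:R <= c + K.
  have : K * 1 <= K * n%:R by rewrite ler_wpM2l// ler1n.
  move: cK; rewrite ler_pdivrMr// ler_norml; lra.
have mn0 : 0 <= m%:R / n%:R :> R by rewrite divr_ge0.
have gx : normc (g - x) <= i ^+ 2 / n%:R * S + (3 / 2 * c + 5 / 2 * K) * i ^+ 3 / n%:R.
  rewrite -(ler_pM2l nR); apply: le_trans D _.
  have -> : n%:R * (i ^+ 2 / n%:R * S + (3 / 2 * c + 5 / 2 * K) * i ^+ 3 / n%:R) =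
    i ^+ 2 * (S + (3 / 2 * c + 5 / 2 * K) * i) by field; rewrite gt_eqF.
  apply: ler_pM.
  - by rewrite exprn_ge0// ltW.
  - by rewrite addr_ge0// mulr_ge0// ?(ltW vi0)// addr_ge0// mulr_ge0.
  - by rewrite ler_pXn2r// ?nnegrE ltW.
  - rewrite lerD2l; apply: ler_pM => //; first by rewrite addr_ge0// mulr_ge0.
    lra.
pose d : R := n%:R / (n%:R + m%:R) - (1 + c)^-1.
have nm0 : 0 < n%:R + m%:R :> R by rewrite ltr_pwDl.
have c10 : 0 < 1 + c by lra.
have dK : `|d| <= K / n%:R.
  have -> : d = (c * n%:R - m%:R) / ((n%:R + m%:R) * (1 + c)).
    by rewrite /d; field; rewrite !gt_eqF.
  rewrite normrM normfV (gtr0_norm (mulr_gt0 nm0 c10)) ler_pM//.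
    by rewrite invr_ge0 mulr_ge0 ?ltW.
  rewrite lef_pV2 ?posrE ?mulr_gt0//.
  apply: (@le_trans _ _ (n%:R * 1)); first by rewrite mulr1.
  by apply: ler_pM => //; [rewrite lerDl|lra].
have rc (a : R) : (a^-1)%:C = (a%:C)^-1 by rewrite fmorphV.
have rn k : (k%:R : R)%:C = k%:R by rewrite (rmorph_nat (real_complex R)).
have nmC : (n%:R + m%:R : C) != 0 by rewrite -natrD pnatr_eq0 -lt0n addn_gt0 n0.
have nC : (n%:R : C) != 0 by rewrite pnatr_eq0 -lt0n.
have c1C : 1 + c%:C != 0.
  rewrite -(rmorph1 (real_complex R)) -rmorphD/= -normc_eq0 normc_real gtr0_norm//.
  by rewrite gt_eqF.
have E : snm Xs z - s_lim c z =
    2 * (n%:R / (n%:R + m%:R)) * (g - x) + 2 * d%:C * x + 2 * d%:C / z.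
  rewrite sE /d rmorphB rmorphM/= !rc rmorphD/= rmorphD/= !rn rmorph1.
  have -> : snm Xs z = (n%:R + m%:R)^-1 * (2 * (n%:R * g) + (n%:R - m%:R) / z).
    have -> : n%:R * g = \tr (drsubmx (resolvent (Wmx Y) z)) by rewrite /g mulrA mulfV// mul1r.
    by rewrite -natrD -resolvent_trace.
  by field; rewrite ?nmC ?c1C ?zn0.
(* Since x y = 1, the lower bound on |Im y| is an upper bound on |x|. *)
have xn : normc x <= i.
  have yv : `|Im z| <= normc y.
    apply: le_trans (normc_geIm y).
    rewrite -(ler_pM2l v0') -!normrM -expr2 ger0_norm ?sqr_ge0//.
    by rewrite -normrN; apply: le_trans (ler_norm _); rewrite lerNr.
  have y0 : 0 < normc y by exact: lt_le_trans yv.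
  have -> : normc x = (normc y)^-1.
    apply: (mulIf (lt0r_neq0 y0)); rewrite -normc_mul xy Normc.normc1 mulVf// gt_eqF//.
  by apply: le_trans vi; rewrite lef_pV2 ?posrE.
have zi : normc z^-1 <= i.
  rewrite normc_inv; apply: le_trans vi; rewrite lef_pV2 ?posrE//.
    exact: normc_geIm.
  exact: lt_le_trans (normc_geIm z).
have ratio : normc (n%:R / (n%:R + m%:R) : C) <= 1.
  rewrite normc_mul normc_inv -natrD !normc_nat ler_pdivrMr ?mul1r ?ler_nat ?leq_addr//.
  by rewrite ltr0n addn_gt0 n0.
have i3 : i <= i ^+ 3.
  by rewrite -[leLHS]expr1 ler_weXn2l.
have Kn0 : 0 <= K / n%:R by rewrite divr_ge0.
have t1 : normc (2 * (n%:R / (n%:R + m%:R)) * (g - x)) <= 2 * normc (g - x).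
  rewrite !normc_mul (normc_nat R 2) -normc_mul ler_wpM2r ?normc_ge0//.
  by rewrite -[leRHS]mulr1 ler_wpM2l.
have t2 : normc (2 * d%:C * x) <= 2 * (K / n%:R * i ^+ 3).
  rewrite !normc_mul (normc_nat R 2) normc_real -mulrA ler_wpM2l// ler_pM//.
    exact: normc_ge0.
  exact: le_trans i3.
have t3 : normc (2 * d%:C / z) <= 2 * (K / n%:R * i ^+ 3).
  rewrite !normc_mul (normc_nat R 2) normc_real -mulrA ler_wpM2l// ler_pM//.
    exact: normc_ge0.
  exact: le_trans i3.
rewrite E; apply: le_trans (normcD _ _) _; apply: le_trans (lerD (normcD _ _) (lexx _)) _.
apply: le_trans (lerD (lerD t1 t2) t3) _.
rewrite -/i -/S.
have -> : 2 * i ^+ 2 / n%:R * S + (3 * c + 9 * K) * i ^+ 3 / n%:R =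
  2 * (i ^+ 2 / n%:R * S + (3 / 2 * c + 5 / 2 * K) * i ^+ 3 / n%:R) +
  2 * (K / n%:R * i ^+ 3) + 2 * (K / n%:R * i ^+ 3) by field; rewrite gt_eqF.
by rewrite !lerD2r ler_pM2l.
Qed.

(** Cauchy-Schwarz over the columns gives the factor [m]; 8 is the 2 of (a + b)^2 <= 2 a^2 + 2 b^2
    times the square of the 2 in [snm_dist_le]. *)
Lemma snm_dist_sqr_le (Xs : 'M[R]_(n, m)) (z : C) (c K eta : R) :
  (0 < n)%N -> 1 <= c -> 0 < eta <= 1 -> eta <= `|Im z| -> `|c * n%:R - m%:R| <= K ->
  normc (snm Xs z - s_lim c z) ^+ 2 <=
    8 * eta^-1 ^+ 4 * m%:R / n%:R ^+ 2 * (\sum_j nsq (loo_dev (Ymx Xs) z j)) +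
    2 * (3 * c + 9 * K) ^+ 2 * eta^-1 ^+ 6 / n%:R ^+ 2.
Proof.
move=> n0 c1 e01 ev cK.
have H := snm_dist_le Xs n0 c1 e01 ev cK.
case/andP: e01 => e0 e1.
have nR : 0 < n%:R :> R by rewrite ltr0n.
have K0 : 0 <= K by exact: le_trans cK.
have i0 : 0 < eta^-1 by rewrite invr_gt0.
set S := \sum_j _ in H; set T := \sum_j _.
have ST : S ^+ 2 <= m%:R * T.
  have := sqr_sum_le (fun j => normc (loo_dev (Ymx Xs) z j)).
  by rewrite card_ord; under [in leRHS]eq_bigr do rewrite normc_sqr.
set a := 2 * _ / _ * S in H; set b := _ / n%:R in H.
have a0 : 0 <= a.
  rewrite /a mulr_ge0//; last by apply: sumr_ge0 => j _; exact: normc_ge0.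
  by rewrite divr_ge0// mulr_ge0// exprn_ge0// ltW.
have b0 : 0 <= b.
  rewrite /b divr_ge0// mulr_ge0//; last by rewrite exprn_ge0// ltW.
  by rewrite addr_ge0// mulr_ge0//; lra.
have : normc (snm Xs z - s_lim c z) ^+ 2 <= (a + b) ^+ 2.
  by rewrite ler_pXn2r// nnegrE ?normc_ge0// addr_ge0.
move=> /le_trans; apply.
have : (a + b) ^+ 2 <= 2 * a ^+ 2 + 2 * b ^+ 2.
  by have := sqr_ge0 (a - b); rewrite !expr2; lra.
move=> /le_trans; apply; apply: lerD; last first.
  by rewrite le_eqVlt; apply/orP; left; apply/eqP; rewrite /b; field; rewrite !gt_eqF.
have -> : 2 * a ^+ 2 = 8 * eta^-1 ^+ 4 / n%:R ^+ 2 * S ^+ 2.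
  by rewrite /a; field; rewrite !gt_eqF.
have -> : 8 * eta^-1 ^+ 4 * m%:R / n%:R ^+ 2 * T = 8 * eta^-1 ^+ 4 / n%:R ^+ 2 * (m%:R * T).
  by field; rewrite !gt_eqF.
rewrite ler_wpM2l// divr_ge0 ?exprn_ge0// mulr_ge0// exprn_ge0// ltW//.
Qed.

Lemma nsq_loo_dev (Xs : 'M[R]_(n, m)) (z : C) (j : 'I_m) : (0 < n)%N ->
  let A := loo_resolvent (Ymx Xs) z j in
  nsq (loo_dev (Ymx Xs) z j) = n%:R^-1 ^+ 2 *
   ((qform (real_part A) (col j Xs)^T - \tr (real_part A)) ^+ 2 +
    (qform (imag_part A) (col j Xs)^T - \tr (imag_part A)) ^+ 2).
Proof.
move=> n0 A.
have nR : 0 < n%:R :> R by rewrite ltr0n.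
have qs (B : 'M[R]_n) : qform B (col j (Ymx Xs))^T = n%:R^-1 * qform B (col j Xs)^T.
  have -> : (col j (Ymx Xs))^T = (Num.sqrt n%:R)^-1 *: (col j Xs)^T.
    by apply/rowP => i; rewrite !mxE.
  rewrite /qform !bformE mulr_sumr; apply: eq_bigr => i _; rewrite mulr_sumr.
  apply: eq_bigr => k _; rewrite !mxE.
  set u := Xs i j; set w := Xs k j.
  have -> : (n%:R : R)^-1 = (Num.sqrt n%:R)^-1 * (Num.sqrt n%:R)^-1.
    by rewrite -invfM -expr2 sqr_sqrtr.
  ring.
rewrite /loo_dev /loo_quad /col_vec rquad_dr -/(loo_resolvent (Ymx Xs) z j) -/A !qs.
rewrite (mxtrace_parts A).
have -> : (n%:R^-1 : C) = (n%:R^-1)%:C by rewrite fmorphV/= (rmorph_nat (real_complex R)).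
rewrite /nsq Re_add Im_add Re_opp Im_opp Re_mul Im_mul/= !mul0r subr0 addr0.
ring.
Qed.

End ErrorBound.

(** * Measurability of the resolvent *)

Section ComplexMeasurability.
Variable R : realType.
Local Open Scope complex_scope.
Local Notation C := R[i].
Local Notation Re := complex.Re.
Local Notation Im := complex.Im.

(** The inverse is continuous off 0; the point 0, where it is 0 by convention, is treated apart. *)
Lemma measurable_inv : measurable_fun [set: R] (fun x : R => x^-1).
Proof.
have -> : [set: R] = ~` [set 0] `|` [set 0] by rewrite setUC setUv.
apply/measurable_funU => //.
  exact: measurableC.
split; last exact: measurable_fun_set1.
apply: open_continuous_measurable_fun.
  by apply: closed_openC; exact: closed_eq.
move=> x; rewrite inE /= => /eqP x0; exact: inv_continuous.
Qed.

Variables (d : measure_display) (T : measurableType d).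

Definition cmeasurable (f : T -> C) :=
  measurable_fun [set: T] (fun t => Re (f t)) /\ measurable_fun [set: T] (fun t => Im (f t)).

Lemma cmeasurable_real (f : T -> R) : measurable_fun [set: T] f ->
  cmeasurable (fun t => (f t)%:C).
Proof. by move=> mf; split => //=; exact: measurable_cst. Qed.

Lemma cmeasurable_cst (c : C) : cmeasurable (fun=> c).
Proof. by split; exact: measurable_cst. Qed.

Lemma cmeasurableD (f g : T -> C) : cmeasurable f -> cmeasurable g ->
  cmeasurable (fun t => f t + g t).
Proof.
move=> [f1 f2] [g1 g2]; split.
  by under eq_fun do rewrite Re_add; exact: measurable_funD.
by under eq_fun do rewrite Im_add; exact: measurable_funD.
Qed.

Lemma cmeasurableM (f g : T -> C) : cmeasurable f -> cmeasurable g ->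
  cmeasurable (fun t => f t * g t).
Proof.
move=> [f1 f2] [g1 g2]; split.
  by under eq_fun do rewrite Re_mul; apply: measurable_funB; exact: measurable_funM.
by under eq_fun do rewrite Im_mul; apply: measurable_funD; exact: measurable_funM.
Qed.

Lemma cmeasurableB (f g : T -> C) : cmeasurable f -> cmeasurable g ->
  cmeasurable (fun t => f t - g t).
Proof.
move=> mf mg; have := cmeasurableD mf (cmeasurableM (cmeasurable_cst (-1)) mg).
by under eq_fun do rewrite mulN1r.
Qed.

Lemma cmeasurable_sum (I : Type) (s : seq I) (f : I -> T -> C) :
  (forall i, cmeasurable (f i)) -> cmeasurable (fun t => \sum_(i <- s) f i t).
Proof.
move=> mf; elim: s => [|i s IH].
  by under eq_fun do rewrite big_nil; exact: cmeasurable_cst.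
by under eq_fun do rewrite big_cons; exact: cmeasurableD.
Qed.

Lemma cmeasurable_prod (I : Type) (s : seq I) (f : I -> T -> C) :
  (forall i, cmeasurable (f i)) -> cmeasurable (fun t => \prod_(i <- s) f i t).
Proof.
move=> mf; elim: s => [|i s IH].
  by under eq_fun do rewrite big_nil; exact: cmeasurable_cst.
by under eq_fun do rewrite big_cons; exact: cmeasurableM.
Qed.

Lemma measurable_nsq (f : T -> C) : cmeasurable f ->
  measurable_fun [set: T] (fun t => nsq (f t)).
Proof.
by move=> [f1 f2]; apply: measurable_funD; exact: measurable_funX.
Qed.

Lemma complex_invE (x : C) : x^-1 = (Re x / nsq x) -i* (Im x / nsq x).
Proof. by case: x. Qed.

Lemma cmeasurableV (f : T -> C) : cmeasurable f -> cmeasurable (fun t => (f t)^-1).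
Proof.
move=> mf; have mi : measurable_fun [set: T] (fun t => (nsq (f t))^-1).
  exact: (measurableT_comp measurable_inv (measurable_nsq mf)).
case: mf => f1 f2; split.
  by under eq_fun do rewrite complex_invE/=; exact: measurable_funM.
under eq_fun do rewrite complex_invE/= -mulNr.
by apply: measurable_funM => //; exact: measurableT_comp f2.
Qed.

Definition mx_measurable k l (A : T -> 'M[C]_(k, l)) :=
  forall i j, cmeasurable (fun t => A t i j).

Lemma cmeasurable_det k (A : T -> 'M[C]_k) :
  mx_measurable A -> cmeasurable (fun t => \det (A t)).
Proof.
move=> mA; apply: cmeasurable_sum => s; apply: cmeasurableM; first exact: cmeasurable_cst.
by apply: cmeasurable_prod => i; exact: mA.
Qed.

(** Cramer's rule: the entries are rational in those of [A]. Invertibility at every [t] matters, as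
    [invmx] returns a singular matrix unchanged. *)
Lemma mx_measurable_invmx k (A : T -> 'M[C]_k) : (forall t, A t \in unitmx) ->
  mx_measurable A -> mx_measurable (fun t => invmx (A t)).
Proof.
move=> uA mA i j.
rewrite (_ : (fun t => _) = (fun t => (\det (A t))^-1 *
    ((-1) ^+ (j + i) * \det (row' j (col' i (A t)))))).
  apply: cmeasurableM; first by apply: cmeasurableV; exact: cmeasurable_det.
  apply: cmeasurableM; first exact: cmeasurable_cst.
  apply: cmeasurable_det => a b; under eq_fun do rewrite !mxE; exact: mA.
by apply/funext => t; rewrite /invmx uA !mxE.
Qed.

Lemma mx_measurable_resolvent k (W : T -> 'M[R]_k) (z : C) :
  (forall t, (W t)^T = W t) -> Im z != 0 ->
  (forall i j, measurable_fun [set: T] (fun t => W t i j)) ->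
  mx_measurable (fun t => resolvent (W t) z).
Proof.
move=> WT z0 mW; apply: mx_measurable_invmx => [t|i j]; first exact: shifted_unit.
under eq_fun do rewrite mxE [X in X + _]mxE.
apply: cmeasurableD; first exact: cmeasurable_real.
exact: cmeasurable_cst.
Qed.

Lemma measurable_Wmx n m (Y : T -> 'M[R]_(n, m)) :
  (forall i j, measurable_fun [set: T] (fun t => Y t i j)) ->
  forall i j, measurable_fun [set: T] (fun t => Wmx (Y t) i j).
Proof.
move=> mY i j.
case: (split_ordP i) => a ->; case: (split_ordP j) => b ->.
- by under eq_fun do rewrite block_mxEul mxE; exact: measurable_cst.
- by under eq_fun do rewrite block_mxEur mxE; exact: mY.
- by under eq_fun do rewrite block_mxEdl; exact: mY.
- by under eq_fun do rewrite block_mxEdr mxE; exact: measurable_cst.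
Qed.

Lemma measurable_Ymx n m (X : T -> 'M[R]_(n, m)) :
  (forall i j, measurable_fun [set: T] (fun t => X t i j)) ->
  forall i j, measurable_fun [set: T] (fun t => Ymx (X t) i j).
Proof.
move=> mX i j; under eq_fun do rewrite mxE.
by apply: measurable_funM => //; exact: mX.
Qed.

Lemma measurable_snm_dist n m (X : T -> 'M[R]_(n, m)) (z s : C) : Im z != 0 ->
  (forall i j, measurable_fun [set: T] (fun t => X t i j)) ->
  measurable_fun [set: T] (fun t => Normc.normc (snm (X t) z - s) ^+ 2).
Proof.
move=> z0 mX; under eq_fun do rewrite normc_sqr.
apply: measurable_nsq; apply: cmeasurableB; last exact: cmeasurable_cst.
apply: cmeasurableM; first exact: cmeasurable_cst.
apply: cmeasurable_sum => i; apply: mx_measurable_resolvent => // [t|k l].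
  exact: Wmx_sym.
by apply: measurable_Wmx; exact: measurable_Ymx.
Qed.

Lemma measurable_nsq_loo_dev n m (X : T -> 'M[R]_(n, m)) (z : C) (j : 'I_m) : Im z != 0 ->
  (forall i j, measurable_fun [set: T] (fun t => X t i j)) ->
  measurable_fun [set: T] (fun t => nsq (loo_dev (Ymx (X t)) z j)).
Proof.
move=> z0 mX; have mY := measurable_Ymx mX.
have mW : mx_measurable (fun t => resolvent (Wmx (zero_col j (Ymx (X t)))) z).
  apply: mx_measurable_resolvent => // [t|]; first exact: Wmx_sym.
  apply: measurable_Wmx => k l; under eq_fun do rewrite mxE.
  by case: (l == j); [exact: measurable_cst|exact: mY].
have mc i : cmeasurable (fun t => cmx (col_vec j (Ymx (X t))) i ord0).
  under eq_fun do rewrite mxE; apply: cmeasurable_real.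
  case: (split_ordP i) => a ->.
    by under eq_fun do rewrite col_mxEu mxE; exact: measurable_cst.
  by under eq_fun do rewrite col_mxEd mxE; exact: mY.
apply: measurable_nsq; apply: cmeasurableB; last first.
  apply: cmeasurableM; first exact: cmeasurable_cst.
  by apply: cmeasurable_sum => i; under eq_fun do rewrite !mxE; exact: mW.
under eq_fun do rewrite /loo_quad /rquad mxE.
apply: cmeasurable_sum => k; apply: cmeasurableM; last exact: mc.
under eq_fun do rewrite mxE.
by apply: cmeasurable_sum => l; apply: cmeasurableM; [under eq_fun do rewrite mxE; exact: mc|exact: mW].
Qed.

End ComplexMeasurability.

(** * Integration over one column *)

Section ColumnIntegration.
Variables (R : realType) (n : nat) (V : 'rV[R]_n -> R).
Hypothesis mV : rmeasurable V.
Hypothesis Z_gt0 : (0 < normconst V < +oo)%E.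

Definition block (k : nat) (v : seqR R) : 'rV[R]_n := \row_i v (k * n + i)%N.
Definition pdens (m : nat) (v : seqR R) : R := \prod_(k < m) dens V (block k v).

Lemma pdens_ge0 m v : 0 <= pdens m v.
Proof. by apply: prodr_ge0 => k _; exact: dens_ge0. Qed.

Lemma measurable_dens_block d (T : measurableType d) (k : nat) (X : T -> seqR R) :
  measurable_fun [set: T] X -> measurable_fun [set: T] (fun t => dens V (block k (X t))).
Proof.
move=> mX.
pose Y t : seqR R := fun i => X t (k * n + i)%N.
have mY : measurable_fun [set: T] Y.
  by apply: measurable_seqR => i; exact: (measurableT_comp (measurable_coord _) mX).
exact: (measurableT_comp (rmeasurable_dens mV) mY).
Qed.

Lemma measurable_pdens d (T : measurableType d) m (X : T -> seqR R) :
  measurable_fun [set: T] X -> measurable_fun [set: T] (fun t => pdens m (X t)).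
Proof.
by move=> mX; apply: measurable_prod => k _; exact: measurable_dens_block.
Qed.

Lemma block_cat0 (u v : seqR R) : block 0 (catr n u v) = rowOf n u.
Proof. by apply/rowP => i; rewrite !mxE /catr mul0n add0n ltn_ord. Qed.

Lemma block_catS k (u v : seqR R) : block k.+1 (catr n u v) = block k v.
Proof.
apply/rowP => i; rewrite !mxE /catr mulSn -addnA.
by rewrite ltnNge leq_addr/= addKn.
Qed.

Lemma iint_dens : iint n (fun v => (dens V (rowOf n v))%:E) = 1%E.
Proof.
rewrite -(Exp_cst mV Z_gt0 ler01); apply: eq_iint => v.
by rewrite mul1r.
Qed.

Lemma measurable_id_seqR : measurable_fun [set: seqR R] (fun v : seqR R => v).
Proof. exact: measurable_id. Qed.

Lemma iint_pdens m : iint (m * n) (fun v => (pdens m v)%:E) = 1%E.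
Proof.
elim: m => [|m IH]; first by rewrite mul0n /= /pdens big_ord0.
rewrite mulSn iint_cat -iint_dens; apply: eq_iint => u.
rewrite -[RHS]mule1 -IH -iintZl.
- apply: eq_iint => v; rewrite -EFinM; congr EFin.
  rewrite /pdens big_ord_recl block_cat0; congr (_ * _).
  by apply: eq_bigr => k _; rewrite block_catS.
- by apply/measurable_EFinP; exact: (measurable_pdens m measurable_id_seqR).
- by move=> v; rewrite lee_fin pdens_ge0.
- by rewrite lee_fin dens_ge0.
Qed.

Variable m : nat.

Definition mxOf (v : seqR R) : 'M[R]_(n, m) := \matrix_(i < n, j < m) v (j * n + i)%N.
Definition set_col (j : 'I_m) (x : 'rV[R]_n) (X : 'M[R]_(n, m)) : 'M[R]_(n, m) :=
  \matrix_(i, k) (if k == j then x ord0 i else X i k).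

Lemma prod_dens_mxOf v : \prod_(j < m) dens V (col j (mxOf v))^T = pdens m v.
Proof.
apply: eq_bigr => j _; congr (dens V _).
by apply/rowP => i; rewrite !mxE.
Qed.

(* Tonelli: the j-th column, which occupies the coordinates jn, ..., jn + n - 1,
   can be integrated first. *)
Lemma intMx_column_le (j : 'I_m) (F : 'M[R]_(n, m) -> R) (B : R) :
  measurable_fun [set: seqR R] (fun v => F (mxOf v)) ->
  (forall X, 0 <= F X) -> 0 <= B ->
  (forall X, (Exp V (fun x => F (set_col j x X)) <= B%:E)%E) ->
  (intMx (fun X : 'M[R]_(n, m) => (F X * \prod_(k < m) dens V (col k X)^T)%:E) <= B%:E)%E.
Proof.
move=> mF F0 B0 FB.
(* [a] coordinates precede column [j] and [b] follow it. *)
pose a := (j * n)%N; pose b := ((m - j.+1) * n)%N.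
have mnE : (m * n = a + (n + b))%N.
  by rewrite /a /b -mulSn -mulnDl -addSnnS addnC subnK// ltn_ord.
pose cat3 (u w x : seqR R) := catr a u (catr n x w).
(* The other columns do not see [x], so they are evaluated with column [j] set to 0; this makes
   [rest] a function of [u] and [w] alone. *)
pose z0 : seqR R := fun=> 0.
pose rest (u w : seqR R) := \prod_(k < m | k != j) dens V (block k (cat3 u w z0)).
have blk (k : 'I_m) u w x : k != j -> block k (cat3 u w x) = block k (cat3 u w z0).
  move=> kj; apply/rowP => i; rewrite !mxE /cat3 /catr.
  case: ltnP => // h1; case: ltnP => // h2; exfalso.
  move: kj; rewrite -(inj_eq val_inj)/= neq_ltn => /orP[kj|jk].
    move: h1; rewrite /a leqNgt => /negP; apply.
    by apply: leq_trans (leq_mul kj (leqnn n)); rewrite mulSn addnC ltn_add2r.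
  move: h2; rewrite /a ltnNge => /negP; apply.
  rewrite leq_subRL//; apply: leq_trans (leq_addr _ _).
  by rewrite addnC -mulSn leq_mul2r jk orbT.
have blkj u w x : block j (cat3 u w x) = rowOf n x.
  apply/rowP => i; rewrite !mxE /cat3 /catr /a ltnNge leq_addr/= addKn.
  by rewrite ltn_ord.
have pdE u w x : pdens m (cat3 u w x) = dens V (rowOf n x) * rest u w.
  rewrite /pdens (bigD1 j)//= blkj; congr (_ * _).
  by apply: eq_bigr => k kj; rewrite blk.
have FE u w x : F (mxOf (cat3 u w x)) = F (set_col j (rowOf n x) (mxOf (cat3 u w z0))).
  congr (F _); apply/matrixP => i k; rewrite !mxE; case: eqP => [->|/eqP kj].
    by have /rowP/(_ i) := blkj u w x; rewrite !mxE.
  by have /rowP/(_ i) := blk k u w x kj; rewrite !mxE.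
have rest0 u w : 0 <= rest u w.
  by apply: prodr_ge0 => k _; exact: dens_ge0.
have mc d (T : measurableType d) (u w x : T -> seqR R) : measurable_fun setT u ->
    measurable_fun setT w -> measurable_fun setT x ->
    measurable_fun setT (fun t => cat3 (u t) (w t) (x t)).
  by move=> mu mw mx; apply: measurable_catr => //; exact: measurable_catr.
have decomp (H : seqR R -> \bar R) : measurable_fun setT H -> (forall v, (0 <= H v)%E) ->
    iint (m * n) H = iint a (fun u => iint b (fun w => iint n (fun x => H (cat3 u w x)))).
  move=> mH H0; rewrite mnE iint_cat; apply: eq_iint => u; rewrite iint_cat.
  rewrite (iint_swap n b (f := fun x w => H (cat3 u w x)))//.
  apply: (measurableT_comp mH).
  exact: (mc _ (seqR R * seqR R)%type (fun=> u) snd fst (measurable_cst u) measurable_snd measurable_fst).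
have mFm : measurable_fun setT (fun v => (F (mxOf v) * pdens m v)%:E).
  by apply/measurable_EFinP; apply: measurable_funM => //; exact: (measurable_pdens m measurable_id_seqR).
have mp : measurable_fun setT (fun v => (pdens m v)%:E).
  by apply/measurable_EFinP; exact: (measurable_pdens m measurable_id_seqR).
rewrite /intMx.
have -> : iint (m * n) (fun v => (F (\matrix_(i < n, j0 < m) v (j0 * n + i)%N) *
    \prod_(k < m) dens V (col k (\matrix_(i < n, j0 < m) v (j0 * n + i)%N))^T)%:E) =
    iint (m * n) (fun v => (F (mxOf v) * pdens m v)%:E).
  by apply: eq_iint => v; rewrite -/(mxOf v) prod_dens_mxOf.
(* [B] becomes [B] times the total mass 1, so that both sides are integrals over the same
   coordinates and the comparison reduces to the column [j]. *)
rewrite -[leRHS]mule1 -(iint_pdens m) -iintZl//; last first.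
  by move=> v; rewrite lee_fin pdens_ge0.
have mBp : measurable_fun setT (fun v => B%:E * (pdens m v)%:E)%E by exact: measurable_funeM.
have Fp0 v : (0 <= (F (mxOf v) * pdens m v)%:E)%E by rewrite lee_fin mulr_ge0// pdens_ge0.
have Bp0 v : (0 <= B%:E * (pdens m v)%:E)%E by rewrite mule_ge0 ?lee_fin// pdens_ge0.
rewrite !decomp//.
have msnd3 (H : seqR R -> \bar R) : measurable_fun setT H -> forall u,
    measurable_fun [set: seqR R * seqR R] (fun p => H (cat3 u p.1 p.2)).
  move=> mH u; apply: (measurableT_comp mH).
  exact: (mc _ (seqR R * seqR R)%type (fun=> u) fst snd (measurable_cst u) measurable_fst measurable_snd).
have mb (H : seqR R -> \bar R) : measurable_fun setT H -> (forall v, (0 <= H v)%E) ->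
    forall u, measurable_fun [set: seqR R] (fun w => iint n (fun x => H (cat3 u w x))).
  move=> mH H0 u; apply: (@measurable_iint R n _ (seqR R) (fun w x => H (cat3 u w x))) => //.
  exact: msnd3.
have ma (H : seqR R -> \bar R) : measurable_fun setT H -> (forall v, (0 <= H v)%E) ->
    measurable_fun [set: seqR R] (fun u => iint b (fun w => iint n (fun x => H (cat3 u w x)))).
  move=> mH H0.
  apply: (@measurable_iint R b _ (seqR R) (fun u w => iint n (fun x => H (cat3 u w x)))).
    apply: (@measurable_iint R n _ _ (fun (p : seqR R * seqR R) x => H (cat3 p.1 p.2 x))) => //.
    apply: (measurableT_comp mH).
    apply: (mc _ ((seqR R * seqR R) * seqR R)%type (fun q => q.1.1) (fun q => q.1.2) snd).
    - exact: measurableT_comp measurable_fst measurable_fst.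
    - exact: measurableT_comp measurable_snd measurable_fst.
    - exact: measurable_snd.
  by move=> u w; apply: iint_ge0 => x; exact: H0.
apply: le_iint; first exact: (ma (fun v => (F (mxOf v) * pdens m v)%:E)).
- exact: (ma (fun v => B%:E * (pdens m v)%:E)%E).
- by move=> u; apply: iint_ge0 => w; apply: iint_ge0 => x.
move=> u; apply: le_iint; first exact: (mb (fun v => (F (mxOf v) * pdens m v)%:E)).
- exact: (mb (fun v => B%:E * (pdens m v)%:E)%E).
- by move=> w; apply: iint_ge0 => x.
move=> w.
have mFx : rmeasurable (fun x => F (set_col j x (mxOf (cat3 u w z0)))).
  rewrite /rmeasurable [X in measurable_fun _ X](_ : _ = fun v => F (mxOf (cat3 u w v))).
    2: by apply/funext => v; rewrite FE.
  apply: (measurableT_comp mF).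
  exact: (mc _ (seqR R) (fun=> u) (fun=> w) id (measurable_cst u) (measurable_cst w) (@measurable_id _ _ _)).
have -> : iint n (fun x => (F (mxOf (cat3 u w x)) * pdens m (cat3 u w x))%:E) =
   ((rest u w)%:E * Exp V (fun x => F (set_col j x (mxOf (cat3 u w z0)))))%E.
  rewrite -iintZl ?lee_fin//.
  - by apply: eq_iint => x; rewrite FE pdE -EFinM; congr EFin; ring.
  - by apply/measurable_EFinP; exact: (rmeasurableM mFx (rmeasurable_dens mV)).
  - by move=> v; rewrite lee_fin mulr_ge0// dens_ge0.
have -> : iint n (fun x => B%:E * (pdens m (cat3 u w x))%:E)%E = ((rest u w)%:E * B%:E)%E.
  rewrite -[X in _ = (_ * X)%E]mule1 -iint_dens muleA -iintZl ?mule_ge0 ?lee_fin//.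
  - by apply: eq_iint => x; rewrite pdE -!EFinM; congr EFin; ring.
  - by apply/measurable_EFinP; exact: (rmeasurable_dens mV).
  - by move=> v; rewrite lee_fin dens_ge0.
by apply: lee_wpmul2l; rewrite ?lee_fin.
Qed.

End ColumnIntegration.

(** * The limit *)

Section MeanSquareError.
Variables (R : realType) (n m : nat) (V : 'rV[R]_n -> R) (mu C : R).
Local Open Scope complex_scope.
Hypothesis C0 : 0 < C.
Hypothesis n0 : (0 < n)%N.
Hypothesis H1 : Hyp1_n mu C V.

Let nR : 0 < n%:R :> R.
Proof. by rewrite ltr0n. Qed.

(** [A] does not involve column [j], so it is constant under this expectation, and [qform_variance]
    applies to its two parts with constant 1/|Im z|. The factor n^-2 against a variance of order n
    leaves 1/n. *)
Lemma Exp_nsq_loo_dev (X : 'M[R]_(n, m)) (z : R[i]) (j : 'I_m) (eta : R) :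
  0 < eta -> eta <= `|complex.Im z| ->
  (Exp V (fun x => nsq (loo_dev (Ymx (set_col j x X)) z j)) <=
    (2 * kappa C * eta^-1 ^+ 2 / n%:R)%:E)%E.
Proof.
move=> e0 ez; case: H1 => C2V [Z [_ [iso [_ [HV _]]]]].
have v0 : 0 < `|complex.Im z| by exact: lt_le_trans ez.
have z0 : complex.Im z != 0 by rewrite -normr_gt0.
pose A := loo_resolvent (Ymx X) z j.
have E x : nsq (loo_dev (Ymx (set_col j x X)) z j) = n%:R^-1 ^+ 2 *
   ((qform (real_part A) x - \tr (real_part A)) ^+ 2 +
    (qform (imag_part A) x - \tr (imag_part A)) ^+ 2).
  rewrite (nsq_loo_dev _ _ _ n0).
  have -> : loo_resolvent (Ymx (set_col j x X)) z j = A.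
    rewrite /A /loo_resolvent; congr (drsubmx (resolvent (Wmx _) z)).
    apply/matrixP => i k; rewrite !mxE; case: (k == j) => //.
  have -> : (col j (set_col j x X))^T = x by apply/rowP => i; rewrite !mxE eqxx.
  by [].
rewrite (eq_Exp V E).
have sA : A^T = A by apply: dr_resolvent_sym; exact: Wmx_sym.
have vi0 : 0 < `|complex.Im z|^-1 by rewrite invr_gt0.
have mV := rmeasurable_potential C2V.
have mq (B : 'M[R]_n) : rmeasurable (fun x => (qform B x - \tr B) ^+ 2).
  apply: rmeasurableX; apply: rmeasurableB; first exact: rmeasurable_qform.
  exact: rmeasurable_cst.
have b1 : (Exp V (fun x => (qform (real_part A) x - \tr (real_part A)) ^+ 2)%R <=
    (kappa C * `|complex.Im z|^-1 ^+ 2 * n%:R)%:E)%E.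
  exact: (qform_variance C0 C2V HV Z iso vi0 (real_part_sym sA) n0
    (fun x => (qform_resolvent_bound x (Wmx_sym _) z0).1)).
have b2 : (Exp V (fun x => (qform (imag_part A) x - \tr (imag_part A)) ^+ 2)%R <=
    (kappa C * `|complex.Im z|^-1 ^+ 2 * n%:R)%:E)%E.
  exact: (qform_variance C0 C2V HV Z iso vi0 (imag_part_sym sA) n0
    (fun x => (qform_resolvent_bound x (Wmx_sym _) z0).2)).
rewrite ExpZl//; last 2 first.
- exact: (rmeasurableD (mq _) (mq _)).
- by move=> x; rewrite addr_ge0 ?sqr_ge0.
rewrite ExpD//; try by move=> x; exact: sqr_ge0.
have c0 : (0 <= (n%:R^-1 ^+ 2 : R)%:E)%E by rewrite lee_fin exprn_ge0// invr_ge0.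
apply: le_trans (lee_wpmul2l c0 (leeD b1 b2)) _.
rewrite -EFinD -EFinM lee_fin.
have -> : n%:R^-1 ^+ 2 * (kappa C * `|complex.Im z|^-1 ^+ 2 * n%:R +
    kappa C * `|complex.Im z|^-1 ^+ 2 * n%:R) =
  2 * kappa C * `|complex.Im z|^-1 ^+ 2 / n%:R.
  by field; rewrite ?(gt_eqF nR) ?(gt_eqF v0).
rewrite ler_pM2r ?invr_gt0// ler_wpM2l//; first by rewrite mulr_ge0// kappa_ge0.
by rewrite ler_pXn2r// ?nnegrE ?invr_ge0 ?(ltW e0)// lef_pV2 ?posrE.
Qed.

(** Each column contributes at most [B], so the main term [a * (m * B)] is 16 kappa (m / n)^2 eta^-6
    / n with m / n <= c + K. The remainder [b] carries a further factor 1/n, bounded by 1. *)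
Lemma L2err_le (z : R[i]) (c K eta : R) :
  1 <= c -> 0 < eta <= 1 -> eta <= `|complex.Im z| -> `|c * n%:R - m%:R| <= K ->
  (L2err m V c z <= ((16 * kappa C * (c + K) ^+ 2 + 2 * (3 * c + 9 * K) ^+ 2) *
                     (eta^-1 ^+ 6 / n%:R))%:E)%E.
Proof.
move=> c1 e01 ez cK; case: (H1) => C2V [Z [_ [iso [_ [HV _]]]]].
have mV := rmeasurable_potential C2V.
have e0 : 0 < eta by case/andP: e01.
have v0 : 0 < `|complex.Im z| by exact: lt_le_trans ez.
have z0 : complex.Im z != 0 by rewrite -normr_gt0.
have K0 : 0 <= K by exact: le_trans cK.
have i0 : 0 < eta^-1 by rewrite invr_gt0.
pose a := 8 * eta^-1 ^+ 4 * m%:R / n%:R ^+ 2.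
pose b := 2 * (3 * c + 9 * K) ^+ 2 * eta^-1 ^+ 6 / n%:R ^+ 2.
have a0 : 0 <= a by rewrite divr_ge0 ?exprn_ge0// mulr_ge0// mulr_ge0// exprn_ge0// ltW.
have b0 : 0 <= b.
  rewrite divr_ge0 ?exprn_ge0// mulr_ge0//; first by rewrite mulr_ge0// sqr_ge0.
  by rewrite exprn_ge0// ltW.
pose N (j : 'I_m) (v : seqR R) := nsq (loo_dev (Ymx (mxOf n m v)) z j).
have mcoord (i : 'I_n) (j : 'I_m) :
    measurable_fun [set: seqR R] (fun v : seqR R => mxOf n m v i j).
  rewrite (_ : (fun v => _) = (fun v : seqR R => v (j * n + i)%N)).
    exact: measurable_coord.
  by apply/funext => v; rewrite mxE.
have mN j : measurable_fun [set: seqR R] (N j) by exact: measurable_nsq_loo_dev.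
have mp : measurable_fun [set: seqR R] (fun v : seqR R => pdens V m v).
  exact: (measurable_pdens mV m (@measurable_id_seqR R)).
have N0 j v : 0 <= N j v by exact: nsq_ge0.
have p0 v : 0 <= pdens V m v by exact: pdens_ge0.
have mNp j : measurable_fun [set: seqR R] (fun v => (N j v * pdens V m v)%:E).
  by apply/measurable_EFinP; exact: measurable_funM.
have Np0 j v : (0 <= (N j v * pdens V m v)%:E)%E by rewrite lee_fin mulr_ge0.
have mpE : measurable_fun [set: seqR R] (fun v => (pdens V m v)%:E).
  exact/measurable_EFinP.
apply: (@le_trans _ _ (iint (m * n) (fun v : seqR R =>
  a%:E * (\sum_j (N j v * pdens V m v)%:E) + b%:E * (pdens V m v)%:E)%E)).
  rewrite /L2err /intMx.
  apply: (@le_trans _ _ (iint (m * n) (fun v : seqR R =>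
     (Normc.normc (snm (mxOf n m v) z - s_lim c z) ^+ 2 * pdens V m v)%:E))).
    rewrite le_eqVlt; apply/orP; left; apply/eqP; apply: eq_iint => v.
    by rewrite -prod_dens_mxOf.
  apply: le_iint.
  - apply/measurable_EFinP; apply: measurable_funM => //.
    exact: measurable_snm_dist.
  - apply: emeasurable_funD; apply: measurable_funeM => //.
    exact: emeasurable_sum.
  - by move=> v; rewrite lee_fin mulr_ge0// sqr_ge0.
  - move=> v; rewrite sumEFin -!EFinM -EFinD lee_fin -mulr_suml mulrA -mulrDl.
    by rewrite ler_wpM2r//; exact: snm_dist_sqr_le.
have mS : measurable_fun [set: seqR R] (fun v => \sum_j (N j v * pdens V m v)%:E)%E.
  exact: emeasurable_sum.
have S0 v : (0 <= \sum_j (N j v * pdens V m v)%:E)%E by exact: sume_ge0.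
rewrite iintD; last 4 first.
- exact: measurable_funeM.
- exact: measurable_funeM.
- by move=> v; rewrite mule_ge0 ?lee_fin.
- by move=> v; rewrite mule_ge0 ?lee_fin.
rewrite iintZl ?lee_fin// iintZl ?lee_fin//.
rewrite iint_pdens// mule1 iint_sum//.
pose B := 2 * kappa C * eta^-1 ^+ 2 / n%:R.
have B0 : 0 <= B.
  rewrite /B divr_ge0// mulr_ge0//; first by rewrite mulr_ge0// kappa_ge0.
  by rewrite exprn_ge0// ltW.
have NB j : (iint (m * n) (fun v => (N j v * pdens V m v)%:E) <= B%:E)%E.
  have := @intMx_column_le R n V mV Z m j (fun X => nsq (loo_dev (Ymx X) z j)) B
    (mN j) (fun X => nsq_ge0 _) B0 (fun X => Exp_nsq_loo_dev X j e0 ez).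
  apply: le_trans; rewrite /intMx le_eqVlt; apply/orP; left; apply/eqP.
  by apply: eq_iint => v; rewrite -prod_dens_mxOf.
apply: (@le_trans _ _ (a%:E * (\sum_(j < m) B%:E) + b%:E)%E).
  by apply: leeD => //; apply: lee_wpmul2l; rewrite ?lee_fin//; apply: lee_sum.
rewrite sumEFin sumr_const card_ord -EFinM -EFinD lee_fin -[B *+ m]mulr_natl.
have mn : m%:R / n%:R <= c + K.
  have : K * 1 <= K * n%:R by rewrite ler_wpM2l// ler1n.
  move: cK; rewrite ler_pdivrMr// ler_norml; lra.
have mn0 : 0 <= m%:R / n%:R :> R by rewrite divr_ge0.
have x0 : 0 <= eta^-1 ^+ 6 / n%:R by rewrite divr_ge0// exprn_ge0// ltW.
have -> : a * (m%:R * B) = 16 * kappa C * (m%:R / n%:R) ^+ 2 * (eta^-1 ^+ 6 / n%:R).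
  by rewrite /a /B; field; rewrite !gt_eqF.
rewrite [leRHS]mulrDl; apply: lerD.
  apply: ler_wpM2r => //; apply: ler_wpM2l; first by rewrite mulr_ge0// kappa_ge0.
  by rewrite ler_pXn2r// nnegrE (le_trans mn0 mn).
have -> : b = 2 * (3 * c + 9 * K) ^+ 2 * (eta^-1 ^+ 6 / n%:R) * n%:R^-1.
  by rewrite /b; field; rewrite !gt_eqF.
rewrite ler_piMr//.
  by rewrite mulr_ge0// mulr_ge0// sqr_ge0.
by rewrite invf_le1// ler1n.
Qed.

Lemma L2err_ge0 (z : R[i]) (c : R) : (0 <= L2err m V c z)%E.
Proof.
case: (H1) => _ [Z _]; apply: iint_ge0 => v; rewrite lee_fin mulr_ge0 ?sqr_ge0//.
by apply: prodr_ge0 => k _; exact: dens_ge0.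
Qed.

End MeanSquareError.

(** * The cut-off n^(-1/13) and the conclusion *)

Section Threshold.
Variable R : realType.
Implicit Types n : nat.

Definition threshold n : R := powR n%:R (- (13%:R)^-1).

Lemma threshold_pow n : (0 < n)%N -> threshold n ^+ 13 = n%:R^-1.
Proof.
move=> n0; rewrite -powR_mulrn ?powR_ge0// /threshold -powRrM.
by rewrite mulNr mulVf ?pnatr_eq0// powR_inv1.
Qed.

Lemma threshold_gt0 n : (0 < n)%N -> 0 < threshold n.
Proof. by move=> n0; rewrite powR_gt0// ltr0n. Qed.

Lemma threshold_le1 n : (0 < n)%N -> threshold n <= 1.
Proof.
move=> n0; rewrite -(ler_pXn2r (ltn0Sn 12)) ?nnegrE ?(ltW (threshold_gt0 n0))//.
by rewrite threshold_pow// expr1n invf_le1 ?ltr0n// ler1n.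
Qed.

(** As the 13th power of the threshold is 1/n, the left side is its 7th power; the first power is
    enough for the limit. *)
Lemma threshold_inv6 n : (0 < n)%N -> (threshold n)^-1 ^+ 6 / n%:R <= threshold n.
Proof.
move=> n0; have e0 := threshold_gt0 n0; have e1 := threshold_le1 n0.
rewrite -threshold_pow//.
have -> : (threshold n)^-1 ^+ 6 * threshold n ^+ 13 = threshold n * threshold n ^+ 6.
  rewrite -exprS exprVn -[13%N]/(6 + 7)%N exprD mulKf// expf_neq0// gt_eqF//.
by rewrite ler_piMr ?(ltW e0)// exprn_ile1// ltW.
Qed.

Lemma cvg_threshold : threshold @ \oo --> (0 : R).
Proof.
apply/cvgrPdist_le => e e0; near=> n.
have n0 : (0 < n)%N by near: n; exact: nbhs_infty_gt.
have t0 := threshold_gt0 n0.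
rewrite sub0r normrN gtr0_norm// -(ler_pXn2r (ltn0Sn 12)) ?nnegrE ?(ltW e0) ?(ltW t0)//.
rewrite threshold_pow// invf_ple ?posrE ?ltr0n ?exprn_gt0//.
by near: n; exact: nbhs_infty_ger.
Unshelve. all: by end_near.
Qed.

End Threshold.

Unset Implicit Arguments.

Theorem theorem2p1 (R : realType)
  (* Hypothesis 1 *)
  (mu C : R) (HC : 0 < C)
  (V : forall n : nat, 'rV[R]_n -> R)
  (H1 : forall n : nat, Hyp1_n mu C (V n))
  (* Hypothesis 3 *)
  (m : nat -> nat) (c sigma : R) (Hc : 1 <= c)
  (Hmn : (fun n => (m n)%:R / n%:R) @ \oo --> c)
  (Hsig : (fun n => c * n%:R - (m n)%:R) @ \oo --> sigma)
  (* the fixed constant R in the definition of C_{v0} *)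
  (Rb : R) (HRb : 0 < Rb) :
  (fun n : nat =>
     ereal_sup [set L2err (m n) (V n) c z
               | z in Cset (powR (n%:R) (- (13%:R)^-1)) Rb])
    @ \oo --> 0%E.
Proof.
(* A bound for |c n - m| once [n] is large, by convergence to [sigma]. *)
pose K : R := `|sigma| + 1.
pose D := 16 * kappa C * (c + K) ^+ 2 + 2 * (3 * c + 9 * K) ^+ 2.
apply: (@squeeze_cvge _ _ _ _ (fun=> 0%E) _ (fun n => (D * threshold R n)%:E)); last 2 first.
- exact: cvg_cst.
- apply/cvg_EFin; first exact: nearW.
  rewrite (_ : 0 = D * 0); last by rewrite mulr0.
  by apply: cvgMr; exact: cvg_threshold.
near=> n.
have n0 : (0 < n)%N by near: n; exact: nbhs_infty_gt.
have e0 := threshold_gt0 R n0; have e1 := threshold_le1 R n0.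
have cK : `|c * n%:R - (m n)%:R| <= K.
  near: n; move/cvgrPdist_le : Hsig => /(_ 1 ltr01); apply: filterS => n h.
  rewrite /K -[c * _ - _](subrK sigma) addrC (le_trans (ler_normD _ _))// lerD2l.
  by rewrite distrC.
have eR : threshold R n < Rb.
  near: n; move/cvgrPdist_lt : (@cvg_threshold R) => /(_ Rb HRb); apply: filterS => n.
  by rewrite sub0r normrN; apply: le_lt_trans; exact: ler_norm.
have D0 : 0 <= D.
  rewrite addr_ge0// mulr_ge0 ?sqr_ge0//.
  by rewrite mulr_ge0// kappa_ge0.
apply/andP; split.
(* The supremum of an empty set is [-oo], so the lower bound 0 needs a point of the domain: i times
   the threshold, of modulus below [Rb] for large [n]. *)
- pose z := Complex 0 (threshold R n).
  apply: (@le_trans _ _ (L2err (m n) (V n) c z)); first exact: L2err_ge0 (H1 n) _ _.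
  apply: ereal_sup_ubound; exists z => //; split => /=.
    by rewrite ger0_norm// ltW.
  by rewrite expr0n/= add0r sqrtr_sqr ger0_norm// ltW.
- apply: ge_ereal_sup => _ [z [ze _] <-].
  apply: (le_trans (L2err_le HC n0 (H1 n) Hc (eta := threshold R n) _ ze cK)).
    by rewrite e0.
  rewrite lee_fin -/D ler_wpM2l//; exact: threshold_inv6.
Unshelve. all: by end_near.
Qed.
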